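(* Let $\widetilde{X}_n = X_n\times(I_n+P_n)$, where $X_n$, $P_n$, $\mu_X$, $a$, $b$, $r$, $s$, $\theta_1,\ldots,\theta_r$ satisfy the standing assumptions given in the context (in particular $X_n$ is non-negative definite and $\mu_X\ne\delta_0$). Let $i_0\in\{1,\ldots,r\}$ be such that $1/\theta_{i_0}\in(T_{\mu_X}(a^-),T_{\mu_X}(b^+))$. For each $n$, define $$\widetilde{\lambda}_{i_0}:=\begin{cases}\lambda_{i_0}(\widetilde{X}_n) & \text{if }\theta_{i_0}>0,\\ \lambda_{n-r+i_0}(\widetilde{X}_n) & \text{if }\theta_{i_0}<0,\end{cases}$$ and let $\widetilde{u}$ be a unit-norm eigenvector of $\widetilde{X}_n$ associated with the eigenvalue $\widetilde{\lambda}_{i_0}$. Then, as $n\to\infty$: (a) almost surely $$|\langle\widetilde{u},\ker(\theta_{i_0}I_n-P_n)\rangle|^2\longrightarrow\frac{-1}{\theta_{i_0}^2\,\rho\,T_{\mu_X}'(\rho)+\theta_{i_0}},$$ where $\rho=T_{\mu_X}^{-1}(1/\theta_{i_0})$ is the almost sure limit of $\widetilde{\lambda}_{i_0}$; (b) almost surely $$\Big\langle\widetilde{u},\ \bigoplus_{\theta\in\{\theta_1,\ldots,\theta_r\}\setminus\{\theta_{i_0}\}}\ker(\theta I_n-P_n)\Big\rangle\longrightarrow0.$$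
   Context: For a matrix $M$ of size $n\times n$ with real eigenvalues, these are ordered as $\lambda_1(M)\ge\cdots\ge\lambda_n(M)$ (the eigenvalues of $X_n(I_n+P_n)$ are real because $X_n$ is non-negative definite and $P_n$ is Hermitian). For a function $f$ and $c\in\mathbb{R}$, $f(c^+)=\lim_{z\downarrow c}f(z)$ and $f(c^-)=\lim_{z\uparrow c}f(z)$. For a subspace $F$ of a Euclidean (or Hermitian) space $E$ and $x\in E$, $\langle x,F\rangle$ denotes the norm of the orthogonal projection of $x$ onto $F$. Standing assumptions. All random objects are defined on a common probability space. For each $n$, $X_n$ is an $n\times n$ real symmetric (or complex Hermitian) non-negative definite random matrix with empirical eigenvalue distribution $\mu_{X_n}=\frac1n\sum_{j=1}^n\delta_{\lambda_j(X_n)}$. Almost surely, $\mu_{X_n}$ converges weakly as $n\to\infty$ to a non-random compactly supported probability measure $\mu_X$ on $\mathbb{R}$, which is not the Dirac mass at zero. Let $a$ and $b$ be the infimum and supremum of the support of $\mu_X$; it is assumed that $\lambda_n(X_n)\to a$ and $\lambda_1(X_n)\to b$ almost surely. Let $r\ge1$ be fixed and let $\theta_1\ge\cdots\ge\theta_r$ be deterministic non-zero real numbers independent of $n$; let $s\in\{0,\ldots,r\}$ be such that $\theta_1\ge\cdots\ge\theta_s>0>\theta_{s+1}\ge\cdots\ge\theta_r$. For each $n$ ($n\ge r$), $P_n$ is an $n\times n$ symmetric (or Hermitian) random matrix of rank $r$ whose $r$ non-zero eigenvalues are $\theta_1,\ldots,\theta_r$. $X_n$ and $P_n$ are independent, and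 either $X_n$ or $P_n$ is orthogonally invariant (in the symmetric case) or unitarily invariant (in the Hermitian case), i.e. its distribution is invariant under conjugation by every orthogonal (respectively unitary) matrix. The $T$-transform of $\mu_X$ is $T_{\mu_X}(z)=\int\frac{t}{z-t}\,d\mu_X(t)$ for $z\notin\operatorname{supp}\mu_X$. It realizes decreasing homeomorphisms from $(-\infty,a)$ onto $(T_{\mu_X}(a^-),0)$ and from $(b,+\infty)$ onto $(0,T_{\mu_X}(b^+))$; $T_{\mu_X}^{-1}$ denotes the inverses of these homeomorphisms. *)

(* Defs.v *)
From HB Require Import structures.
From mathcomp Require Import all_boot all_order all_algebra.
From mathcomp Require Import spectral complex.
From mathcomp Require Import all_classical all_reals all_analysis.

Set Implicit Arguments.
Unset Strict Implicit.
Unset Printing Implicit Defensive.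

Import Order.TTheory GRing.Theory Num.Theory.
Import numFieldNormedType.Exports.

Local Open Scope classical_set_scope.
Local Open Scope ring_scope.
Local Open Scope complex_scope.
Local Open Scope sesquilinear_scope.

(* Both the real symmetric and the complex Hermitian case live in 'M[R[i]]_n:
   a real symmetric matrix is a Hermitian matrix with real entries, and an
   orthogonal matrix is a unitary matrix with real entries. *)
Inductive symmetry_class := RealSymmetric | ComplexHermitian.

Definition over_class (R : realType) (c : symmetry_class) m n
    (A : 'M[R[i]]_(m, n)) : bool :=
  if c is RealSymmetric then A \is a realmx else true.

Definition selfadjoint_mx (R : realType) (c : symmetry_class) n
    (A : 'M[R[i]]_n) : bool :=
  over_class c A && (A \is hermsymmx).

Definition nonneg_def (R : realType) n (A : 'M[R[i]]_n) : Prop :=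
  A \is hermsymmx /\ forall v : 'cV[R[i]]_n, 0 <= (v^t* *m A *m v) 0 0.

(* Eigenvalues are counted with algebraic multiplicity. *)
Definition eigenvalues (R : realType) n (M : 'M[R[i]]_n) : seq R[i] :=
  sval (closed_field_poly_normal (char_poly M)).

(* lambda k M is the k-th largest eigenvalue, with k ranging over 1, ..., n; it
   is meant for matrices all of whose eigenvalues are real. *)
Definition lambda (R : realType) n (k : nat) (M : 'M[R[i]]_n) : R :=
  nth 0 (sort >=%R [seq complex.Re z | z <- eigenvalues M]) k.-1.

Definition esd (R : realType) n (M : 'M[R[i]]_n) : {measure set R -> \bar R} :=
  mscale (n%:R^-1)%:nng (msum (fun k => \d_(lambda k.+1 M)) n).

Definition weak_cvg (R : realType) (nu : nat -> {measure set R -> \bar R})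
    (mu : {measure set R -> \bar R}) : Prop :=
  forall f : R -> R, continuous f -> bounded_fun f ->
    \int[nu n]_x f x @[n --> \oo] --> \int[mu]_x f x.

Definition supp (R : realType) (mu : {measure set R -> \bar R}) : set R :=
  [set x | forall U : set R, open U -> U x -> (0 < mu U)%E].

Definition T_transform (R : realType) (mu : {measure set R -> \bar R})
    (z : R) : R :=
  \int[mu]_t (t / (z - t)).

(* One-sided limits of the T-transform; they may be infinite. *)
Definition T_left (R : realType) (mu : {measure set R -> \bar R}) (c : R)
    : \bar R :=
  lim ((T_transform mu z)%:E @[z --> c^'-]).

Definition T_right (R : realType) (mu : {measure set R -> \bar R}) (c : R)
    : \bar R :=
  lim ((T_transform mu z)%:E @[z --> c^'+]).

(* Positive values are attained on (sup supp, +oo) and negative ones on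
   (-oo, inf supp). *)
Definition T_inv (R : realType) (mu : {measure set R -> \bar R}) (y : R) : R :=
  if 0 < y then xget 0 [set z | sup (supp mu) < z /\ T_transform mu z = y]
  else xget 0 [set z | z < inf (supp mu) /\ T_transform mu z = y].

(* Borel sigma-algebra of 'M[R[i]]_n: it is generated by the real and imaginary
   parts of the entries. *)
Definition mx_cylinders (R : realType) n : set (set 'M[R[i]]_n) :=
  [set S | exists i j, exists2 B : set R, measurable B &
     S = (fun A : 'M[R[i]]_n => complex.Re (A i j)) @^-1` B \/
     S = (fun A : 'M[R[i]]_n => complex.Im (A i j)) @^-1` B].

Definition mx_borel (R : realType) n : set (set 'M[R[i]]_n) :=
  <<s @mx_cylinders R n >>.

Definition random_mx (R : realType) (d : measure_display)
    (Omega : measurableType d) n (X : Omega -> 'M[R[i]]_n) : Prop :=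
  forall S, mx_borel S -> measurable (X @^-1` S).

Definition independent_mx (R : realType) (d : measure_display)
    (Omega : measurableType d) (Pr : probability Omega R) n
    (X Y : Omega -> 'M[R[i]]_n) : Prop :=
  forall S S', mx_borel S -> mx_borel S' ->
    (Pr (X @^-1` S `&` Y @^-1` S') = Pr (X @^-1` S) * Pr (Y @^-1` S'))%E.

Definition conj_invariant (R : realType) (d : measure_display)
    (Omega : measurableType d) (Pr : probability Omega R)
    (c : symmetry_class) n (X : Omega -> 'M[R[i]]_n) : Prop :=
  forall U : 'M[R[i]]_n, U \is unitarymx -> over_class c U ->
  forall S, mx_borel S ->
    Pr ((fun w => U *m X w *m U^t*) @^-1` S) = Pr (X @^-1` S).

Definition vnorm (R : realType) n (x : 'cV[R[i]]_n) : R :=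
  Num.sqrt (complex.Re (dotmx x^T x^T)).

(* Subspaces are represented, as usual, by row spaces: F stands for the set of
   column vectors v with (v^T <= F)%MS. In the real case this is the
   complexification, which does not change the projections of real vectors. *)
Definition cker (R : realType) n (A : 'M[R[i]]_n) : 'M[R[i]]_n := kermx A^T.

Definition proj_norm (R : realType) n (x : 'cV[R[i]]_n) (F : 'M[R[i]]_n) : R :=
  vnorm (x^T *m proj_ortho F)^T.

Definition spiked_eigenvalue (R : realType) n r (theta : 'I_r -> R) (i0 : 'I_r)
    (M : 'M[R[i]]_n) : R :=
  if 0 < theta i0 then lambda i0.+1 M else lambda (n - r + i0.+1) M.

Definition unit_eigenvector (R : realType) (c : symmetry_class) n
    (M : 'M[R[i]]_n) (l : R) (u : 'cV[R[i]]_n) : Prop :=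
  [/\ over_class c u, vnorm u = 1 & M *m u = l%:C *: u].

(* Main.v *)
Require Import Defs.
From HB Require Import structures.
From mathcomp Require Import all_boot all_order all_algebra.
From mathcomp Require Import spectral complex.
From mathcomp Require Import all_classical all_reals all_analysis.
From mathcomp Require Import measurable_realfun ring lra.

Set Implicit Arguments.
Unset Strict Implicit.
Unset Printing Implicit Defensive.

Import Order.TTheory GRing.Theory Num.Theory.
Import numFieldNormedType.Exports.

Local Open Scope classical_set_scope.
Local Open Scope ring_scope.
Local Open Scope complex_scope.
Local Open Scope sesquilinear_scope.

(** Let [V] be the matrix whose columns are orthonormal eigenvectors of the
    perturbation for its non-zero eigenvalues, so that [P = V th V^*] with [th]
    diagonal of fixed size [r]. Everything about the spikes of [X (1 + P)] is
    read off the compressed resolvents [K(z) = V^* (X / (z - X)) V], which are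
    matrices of size [r].

    Concentration. For [z] outside [[a, b]], [K(z)] tends almost surely to the
    scalar [T(z)], and [V^* (X / (z - X))^2 V] to the integral of
    [(t / (z - t))^2] ([T_moment]). Heuristically, invariance makes the columns
    of [V] isotropic with respect to [X]. The proof avoids Haar measure: for a
    centered bounded function [A] of [X], the energy [|P A P|^2] has the same
    law after [P] is rotated by a small angle in a coordinate plane. Expanding
    to first order in the angle and summing over all planes gives the Casimir
    operator of the orthogonal group, which multiplies the traceless matrix [A]
    by a factor of order [n], while all other terms remain bounded
    ([sum_drift]). Hence the energy has mean of order [1 / n] and second moment
    of order [1 / n^2] ([energy_second_moment]), which is summable
    ([second_moment_ae_cvg0]). Only real rotations are used, so that both
    symmetry classes are treated at once. The function [t / (z - t)] is first
    replaced by a bounded rational function, and the replacement is undone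
    afterwards because the spectrum of [X] concentrates on [[a, b]]
    ([cutoff_compression_cvg], [compression_tker_cvg]).

    Eigenvalues. With [S] the square root of [X], the matrix [X (1 + P)] has the
    spectrum of the Hermitian matrix [S (1 + P) S = X + B th B^*], where
    [B = S V]. Test vectors of the form [(z - X)^-1 B x] in one direction, and
    completion of the square in the other, show that the number of its
    eigenvalues beyond [z] is the number of spikes [th i] with [T(z) th i > 1],
    whenever [K(z)] is close to [T(z)] ([perturbation_count_lower],
    [perturbation_count_upper]). As [T] is strictly monotone on either side of
    [[a, b]], the eigenvalue of the spike [th i0] is trapped at the point [rho]
    where [T(rho) th i0 = 1] ([spiked_eigenvalue_cvg]). Spikes of both signs are
    handled together through the sign [sg].

    Eigenvectors. If [u] is a unit eigenvector for the eigenvalue [l], then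
    [w = V^* u] satisfies [w = K(l) th w], and its normalization reads
    [<th w, V^* (X / (l - X))^2 V th w> = 1]. In the limit the first equation
    forces [(1 - th i / th i0) w i -> 0], which kills the coordinates on the
    other spikes, and the second one gives the total mass of the remaining ones,
    the inverse of [th i0^2] times the integral of [(t / (rho - t))^2]
    ([other_spikes_cvg0], [spike_mass_cvg]). That integral is
    [- (rho T'(rho) + T(rho))] ([T_moment2_derive]). Finally, the two norms of
    projections of [u] are norms of parts of [w] ([frame_proj_norm]). *)

(** * The Frobenius inner product *)

Section Frobenius.
Variable R : realType.
Notation C := R[i].

(** The real inner product of matrices seen as vectors of real and imaginary
    parts, so that real linear algebra (Cauchy-Schwarz, polarization) applies to
    both symmetry classes at once. *)
Definition ip m n (A B : 'M[C]_(m, n)) : R := complex.Re (\tr (A *m B^t*)).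

Definition fro2 m n (A : 'M[C]_(m, n)) : R := ip A A.

Definition abs2 (z : C) : R := complex.Re z ^+ 2 + complex.Im z ^+ 2.

Lemma conjCE (z : C) : Num.conj z = (complex.Re z -i* complex.Im z)%C.
Proof. by case: z. Qed.

Lemma ReD (x y : C) : complex.Re (x + y) = complex.Re x + complex.Re y.
Proof. by case: x => ? ?; case: y. Qed.

Lemma ImD (x y : C) : complex.Im (x + y) = complex.Im x + complex.Im y.
Proof. by case: x => ? ?; case: y. Qed.

Lemma ReN (x : C) : complex.Re (- x) = - complex.Re x.
Proof. by case: x. Qed.

Lemma ImN (x : C) : complex.Im (- x) = - complex.Im x.
Proof. by case: x. Qed.

Lemma ReM (x y : C) :
  complex.Re (x * y) = complex.Re x * complex.Re y - complex.Im x * complex.Im y.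
Proof. by case: x => ? ?; case: y. Qed.

Lemma ImM (x y : C) :
  complex.Im (x * y) = complex.Re x * complex.Im y + complex.Im x * complex.Re y.
Proof. by case: x => ? ?; case: y. Qed.

Lemma Re_sum (I : Type) (s : seq I) (P : pred I) (F : I -> C) :
  complex.Re (\sum_(i <- s | P i) F i) = \sum_(i <- s | P i) complex.Re (F i).
Proof. by rewrite (big_morph _ ReD erefl). Qed.

Lemma ipE m n (A B : 'M[C]_(m, n)) :
  ip A B = \sum_i \sum_j (complex.Re (A i j) * complex.Re (B i j) +
                          complex.Im (A i j) * complex.Im (B i j)).
Proof.
rewrite /ip /mxtrace Re_sum; apply: eq_bigr => i _.
rewrite mxE Re_sum; apply: eq_bigr => j _.
by rewrite !mxE ReM conjCE /= mulrN opprK.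
Qed.

Lemma ipC m n (A B : 'M[C]_(m, n)) : ip A B = ip B A.
Proof.
rewrite !ipE; apply: eq_bigr => i _; apply: eq_bigr => j _.
by rewrite mulrC [complex.Im _ * _]mulrC.
Qed.

Lemma ipDl m n (A B D : 'M[C]_(m, n)) : ip (A + B) D = ip A D + ip B D.
Proof. by rewrite /ip mulmxDl mxtraceD ReD. Qed.

Lemma ipDr m n (A B D : 'M[C]_(m, n)) : ip D (A + B) = ip D A + ip D B.
Proof. by rewrite ipC ipDl !(ipC D). Qed.

Lemma ipNl m n (A D : 'M[C]_(m, n)) : ip (- A) D = - ip A D.
Proof. by rewrite /ip mulNmx raddfN /= ReN. Qed.

Lemma ipNr m n (A D : 'M[C]_(m, n)) : ip D (- A) = - ip D A.
Proof. by rewrite ipC ipNl ipC. Qed.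

Lemma ipZl m n (k : R) (A D : 'M[C]_(m, n)) : ip (k%:C *: A) D = k * ip A D.
Proof. by rewrite /ip -scalemxAl mxtraceZ ReM /= mul0r subr0. Qed.

Lemma ipZr m n (k : R) (A D : 'M[C]_(m, n)) : ip D (k%:C *: A) = k * ip D A.
Proof. by rewrite ipC ipZl ipC. Qed.

Lemma ip0l m n (D : 'M[C]_(m, n)) : ip 0 D = 0.
Proof. by rewrite /ip mul0mx mxtrace0. Qed.

Lemma ip_sumr m n (I : Type) (s : seq I) (P : pred I) (F : I -> 'M[C]_(m, n)) D :
  ip D (\sum_(i <- s | P i) F i) = \sum_(i <- s | P i) ip D (F i).
Proof.
rewrite (big_morph _ (fun x y => ipDr x y D) (_ : ip D 0 = 0))//.
by rewrite ipC ip0l.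
Qed.

Lemma fro2E m n (A : 'M[C]_(m, n)) : fro2 A = \sum_i \sum_j abs2 (A i j).
Proof. by rewrite /fro2 ipE; do 2!apply: eq_bigr => ? _; rewrite -!expr2. Qed.

Lemma abs2_ge0 z : 0 <= abs2 z. Proof. by rewrite addr_ge0 ?sqr_ge0. Qed.

Lemma abs2M x y : abs2 (x * y) = abs2 x * abs2 y.
Proof. by case: x y => a b [d e]; rewrite /abs2 /=; ring. Qed.

Lemma abs2_norm (z : C) : (abs2 z)%:C = `|z| ^+ 2.
Proof. exact: add_Re2_Im2. Qed.

Lemma fro2_ge0 m n (A : 'M[C]_(m, n)) : 0 <= fro2 A.
Proof. by rewrite fro2E; do 2!apply: sumr_ge0 => ? _; exact: abs2_ge0. Qed.

Lemma fro2_eq0 m n (A : 'M[C]_(m, n)) : fro2 A = 0 -> A = 0.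
Proof.
move=> A0; apply/matrixP => i j; rewrite mxE.
have := A0; rewrite fro2E => /eqP.
rewrite psumr_eq0; last by move=> ? _; apply: sumr_ge0 => ? _; exact: abs2_ge0.
move=> /allP /(_ i); rewrite mem_index_enum => /(_ isT) /=.
rewrite psumr_eq0; last by move=> ? _; exact: abs2_ge0.
move=> /allP /(_ j); rewrite mem_index_enum => /(_ isT) /=.
rewrite paddr_eq0 ?sqr_ge0// !sqrf_eq0 => /andP[/eqP re /eqP im].
by apply/eqP; rewrite eq_complex re im !eqxx.
Qed.

Lemma fro2D m n (A B : 'M[C]_(m, n)) : fro2 (A + B) = fro2 A + 2 * ip A B + fro2 B.
Proof.
rewrite /fro2 ipDl !ipDr (ipC B A).
by move: (ip A A) (ip A B) (ip B B) => x y z; ring. Qed.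

Lemma fro2N m n (A : 'M[C]_(m, n)) : fro2 (- A) = fro2 A.
Proof. by rewrite /fro2 ipNl ipNr opprK. Qed.

Lemma fro2B m n (A B : 'M[C]_(m, n)) : fro2 (A - B) = fro2 A - 2 * ip A B + fro2 B.
Proof. by rewrite fro2D ipNr fro2N; move: (fro2 A) (ip A B) (fro2 B) => x y z; ring. Qed.

Lemma fro2Z m n (k : R) (A : 'M[C]_(m, n)) : fro2 (k%:C *: A) = k ^+ 2 * fro2 A.
Proof. by rewrite /fro2 ipZl ipZr; move: (ip A A) => x; ring. Qed.

Lemma fro2D_le m n (A B : 'M[C]_(m, n)) :
  fro2 (A + B) <= 2 * (fro2 A + fro2 B).
Proof.
have := fro2_ge0 (A - B); rewrite fro2B fro2D.
by move: (fro2 A) (ip A B) (fro2 B) => x y z; lra.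
Qed.

Lemma ip_le m n (A B : 'M[C]_(m, n)) : `|ip A B| <= (fro2 A + fro2 B) / 2.
Proof.
have := fro2_ge0 (A - B); have := fro2_ge0 (A + B); rewrite fro2B fro2D.
move: (fro2 A) (ip A B) (fro2 B) => x y z h1 h2.
by rewrite ler_norml; apply/andP; split; lra.
Qed.

Lemma ip_CS m n (A B : 'M[C]_(m, n)) : ip A B ^+ 2 <= fro2 A * fro2 B.
Proof.
have [B0|B0] := eqVneq (fro2 B) 0.
  by rewrite B0 (fro2_eq0 B0) ipC ip0l mulr0 expr0n.
have Bp : 0 < fro2 B by rewrite lt_def B0 fro2_ge0.
(* the projection of [A] on the orthogonal of [B], up to a factor *)
have := fro2_ge0 ((fro2 B)%:C *: A - (ip A B)%:C *: B).
rewrite fro2B !fro2Z ipZl ipZr.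
move: (fro2 A) (ip A B) (fro2 B) Bp => x y z zp.
have -> : z ^+ 2 * x - 2 * (z * (y * y)) + y ^+ 2 * z =
  z * (x * z - y ^+ 2) by ring.
by rewrite pmulr_rge0// subr_ge0.
Qed.

Lemma fro2_tr m n (A : 'M[C]_(m, n)) : fro2 A^T = fro2 A.
Proof.
rewrite !fro2E exchange_big; do 2!apply: eq_bigr => ? _; by rewrite mxE.
Qed.

Lemma abs2_conj z : abs2 (Num.conj z) = abs2 z.
Proof. by rewrite conjCE /abs2 /= sqrrN. Qed.

Lemma fro2_adj m n (A : 'M[C]_(m, n)) : fro2 (A^t*) = fro2 A.
Proof.
rewrite -(fro2_tr A) !fro2E; do 2!apply: eq_bigr => ? _.
by rewrite !mxE abs2_conj.
Qed.

Lemma fro2_trace m n (A : 'M[C]_(m, n)) : fro2 A = complex.Re (\tr (A^t* *m A)).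
Proof. by rewrite -fro2_adj /fro2 /ip trmxCK. Qed.

Lemma adjM m n p (A : 'M[C]_(m, n)) (B : 'M[C]_(n, p)) :
  (A *m B)^t* = B^t* *m A^t*.
Proof. by rewrite trmx_mul map_mxM. Qed.

Lemma adjD m n (A B : 'M[C]_(m, n)) : (A + B)^t* = A^t* + B^t*.
Proof. by apply/matrixP => i j; rewrite !mxE rmorphD. Qed.

Lemma adjZ m n (a : C) (A : 'M[C]_(m, n)) : (a *: A)^t* = Num.conj a *: A^t*.
Proof. by apply/matrixP => i j; rewrite !mxE rmorphM. Qed.

Lemma adj_scalar n (a : C) : (a%:M : 'M[C]_n)^t* = (Num.conj a)%:M.
Proof. by rewrite tr_scalar_mx map_scalar_mx. Qed.

Lemma realC_conj (x : R) : Num.conj (x%:C) = x%:C :> C.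
Proof. by rewrite conjCE /= oppr0. Qed.

Lemma fro2_isoml m n p (V : 'M[C]_(m, n)) (A : 'M[C]_(n, p)) :
  V^t* *m V = 1%:M -> fro2 (V *m A) = fro2 A.
Proof.
by move=> VV; rewrite !fro2_trace adjM -mulmxA (mulmxA _ V) VV mul1mx.
Qed.

Lemma fro2_isomr m n p (V : 'M[C]_(n, m)) (A : 'M[C]_(p, n)) :
  V *m V^t* = 1%:M -> fro2 (A *m V) = fro2 A.
Proof.
by move=> VV; rewrite /fro2 /ip adjM mulmxA -(mulmxA A) VV mulmx1.
Qed.

Lemma abs2_dot n (A : 'rV[C]_n) (B : 'cV[C]_n) :
  abs2 ((A *m B) 0 0) <= fro2 A * fro2 B.
Proof.
rewrite -lecR abs2_norm.
have h : `|dotmx A (B^t*)| ^+ 2 <= dotmx A A * dotmx (B^t*) (B^t*).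
  by have [] := CauchySchwarz (@dotmx R[i] n) A (B^t*).
rewrite !dotmxE trmxCK in h.
have E (D : 'rV[C]_n) : (fro2 D)%:C = (D *m D^t*) 0 0.
  rewrite mxE fro2E big_ord1 rmorph_sum; apply: eq_bigr => j _.
  by rewrite !mxE /= abs2_norm normCK.
by rewrite rmorphM /= -(fro2_adj B) !E trmxCK; exact: h.
Qed.

(** Cauchy-Schwarz, entry by entry. *)
Lemma fro2_mul m n p (A : 'M[C]_(m, n)) (B : 'M[C]_(n, p)) :
  fro2 (A *m B) <= fro2 A * fro2 B.
Proof.
have rE q s (D : 'M[C]_(q, s)) : fro2 D = \sum_i fro2 (row i D).
  rewrite fro2E; apply: eq_bigr => i _; rewrite fro2E big_ord1.
  by apply: eq_bigr => j _; rewrite mxE.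
have cE q s (D : 'M[C]_(q, s)) : fro2 D = \sum_j fro2 (col j D).
  rewrite -fro2_tr rE; apply: eq_bigr => j _.
  by rewrite -fro2_tr; congr fro2; apply/matrixP => a b; rewrite !mxE.
rewrite fro2E (rE _ _ A) (cE _ _ B) mulr_suml; apply: ler_sum => i _.
rewrite mulr_sumr; apply: ler_sum => j _.
apply: le_trans (abs2_dot (row i A) (col j B)).
rewrite le_eqVlt; apply/orP; left; apply/eqP; congr abs2.
by rewrite !mxE; apply: eq_bigr => k _; rewrite !mxE.
Qed.

Lemma fro2_sum_delta m n p q (B : 'M[C]_(m, n)) (D : 'M[C]_(p, q)) :
  \sum_k \sum_l fro2 (B *m delta_mx k l *m D) = fro2 B * fro2 D.
Proof.
have e k l i j : (B *m delta_mx k l *m D) i j = B i k * D l j.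
  rewrite !mxE (bigD1 l)//= big1 ?addr0.
    rewrite mxE (bigD1 k)//= big1 ?addr0; first by rewrite mxE !eqxx mulr1.
    by move=> a ak; rewrite mxE (negPf ak) mulr0.
  move=> a al; rewrite mxE big1 ?mul0r// => b _.
  by rewrite mxE (negPf al) andbF mulr0.
transitivity (\sum_k \sum_l ((\sum_i abs2 (B i k)) * (\sum_j abs2 (D l j)))).
  do 2!apply: eq_bigr => ? _; rewrite fro2E mulr_suml; apply: eq_bigr => ? _.
  by rewrite mulr_sumr; apply: eq_bigr => ? _; rewrite e abs2M.
under eq_bigr do rewrite -mulr_sumr.
by rewrite -mulr_suml (fro2E D) fro2E exchange_big.
Qed.

End Frobenius.

(** * Averaging over plane rotations *)

Section PlaneRotations.
Variables (K : comNzRingType) (n : nat).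
Implicit Types (A P : 'M[K]_n) (k l : 'I_n) (s eta : K).

(** The infinitesimal rotation in the coordinate plane of [k] and [l]; it
    vanishes when [k = l]. *)
Definition plane_gen k l : 'M[K]_n := delta_mx k l - delta_mx l k.

(** For [eta = 1 - cos phi] and [s = sin phi] this is the rotation of angle
    [phi] in the plane of [k] and [l]. With the constraint [s^2 = 2 eta - eta^2]
    in place of the trigonometric functions, all identities become
    polynomial. *)
Definition plane_rot k l eta s : 'M[K]_n :=
  1%:M + eta *: (plane_gen k l *m plane_gen k l) + s *: plane_gen k l.

Lemma plane_gen_sq k l : plane_gen k l *m plane_gen k l =
  (delta_mx k l + delta_mx l k) *+ (k == l) - (delta_mx k k + delta_mx l l).
Proof.
rewrite /plane_gen !(mulmxBl, mulmxBr) !mul_delta_mx_cond !eqxx !mulr1n.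
rewrite (eq_sym l k) mulrnDl.
case: eqP => [->|_]; apply/matrixP => i j; rewrite !mxE; ring.
Qed.

Lemma plane_gen_cube k l :
  plane_gen k l *m plane_gen k l *m plane_gen k l = - plane_gen k l.
Proof.
have [->|kl] := eqVneq k l; first by rewrite /plane_gen subrr !mul0mx oppr0.
rewrite plane_gen_sq (negPf kl) mulr0n sub0r mulNmx mulmxDl; congr (- _).
rewrite /plane_gen !mulmxBr !mul_delta_mx_cond !eqxx (eq_sym l k) (negPf kl).
by rewrite !mulr1n !mulr0n subr0 sub0r.
Qed.

Lemma plane_rotM k l eta s : s ^+ 2 = 2 * eta - eta ^+ 2 ->
  plane_rot k l eta s *m plane_rot k l eta (- s) = 1%:M.
Proof.
move=> es; rewrite /plane_rot.
move: (plane_gen k l) (plane_gen_cube k l) => J J3.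
have J4 : J *m J *m (J *m J) = - (J *m J) by rewrite mulmxA J3 mulNmx.
have J3' : J *m (J *m J) = - J by rewrite mulmxA.
rewrite !(mulmxDl, mulmxDr) !mul1mx !mulmx1.
rewrite -!scalemxAl -!scalemxAr J4 J3 J3'.
move: (J *m J) => J2; move: J {J3 J4 J3'} => J.
apply/matrixP => i j; rewrite !mxE.
move: (J2 i j) (J i j) (_ == _)%:R => a b d.
apply/eqP; rewrite -subr_eq0; apply/eqP.
transitivity ((2 * eta - eta ^+ 2 - s ^+ 2) * a); first by ring.
by rewrite es subrr mul0r.
Qed.

(** The coefficients of the conjugate of [A] by [plane_rot k l eta s] in the
    monomials [eta], [eta^2], [s] and [s eta]; replacing [s^2] by its value
    leaves no other monomial. The first one is the double commutator of [A] with
    the generator, the third one the commutator. *)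
Definition cas1 k l A : 'M[K]_n := let J := plane_gen k l in
  J *m J *m A + A *m (J *m J) - 2 *: (J *m A *m J).
Definition cas2 k l A : 'M[K]_n := let J := plane_gen k l in
  J *m J *m A *m (J *m J) + J *m A *m J.
Definition der1 k l A : 'M[K]_n := let J := plane_gen k l in A *m J - J *m A.
Definition der2 k l A : 'M[K]_n := let J := plane_gen k l in
  J *m J *m A *m J - J *m A *m (J *m J).

Lemma plane_rotE k l eta s A : s ^+ 2 = 2 * eta - eta ^+ 2 ->
  plane_rot k l eta (- s) *m A *m plane_rot k l eta s =
  A + eta *: cas1 k l A + eta ^+ 2 *: cas2 k l A +
  s *: (der1 k l A + eta *: der2 k l A).
Proof.
move=> es; rewrite /plane_rot /cas1 /cas2 /der1 /der2.
move: (plane_gen k l) => J.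
rewrite !(mulmxDl, mulmxDr) !mul1mx !mulmx1.
rewrite -!scalemxAl -!scalemxAr -?scalemxAl.
move: (A *m J) (J *m A) (A *m (J *m J)) (J *m J *m A) (J *m A *m J)
  (J *m A *m (J *m J)) (J *m J *m A *m J) (J *m J *m A *m (J *m J)) =>
  B8 B7 B6 B5 B4 B3 B2 B1.
apply/matrixP => i j; rewrite !mxE.
move: (A i j) (B1 i j) (B2 i j) (B3 i j) (B4 i j) (B5 i j) (B6 i j)
  (B7 i j) (B8 i j) => a b1 b2 b3 b4 b5 b6 b7 b8.
apply/eqP; rewrite -subr_eq0; apply/eqP.
transitivity ((2 * eta - eta ^+ 2 - s ^+ 2) * b4); first by ring.
by rewrite es subrr mul0r.
Qed.

(** Summed over all planes, the double commutators give the quadratic Casimir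
    operator of the orthogonal group acting on matrices by conjugation. On a
    traceless matrix it is the multiplication by [- 4 (n - 1)], up to a
    transpose whose coefficient does not grow with [n]. *)
Lemma sum_cas1 A : \sum_k \sum_l cas1 k l A =
  - (4 * (n%:R - 1)) *: A - 4 *: A^T + (4 * \tr A)%:M.
Proof.
have dAd k l k' l' : delta_mx k l *m A *m delta_mx k' l' =
    A l k' *: delta_mx k l' :> 'M[K]_n.
  apply/matrixP => i j; rewrite !mxE (bigD1 k')//= big1 ?addr0.
    rewrite !mxE (bigD1 l)//= big1 ?addr0.
      rewrite mxE !eqxx /= andbT.
      by case: (i == k); case: (j == l'); rewrite ?mul0r ?mulr0 ?mul1r ?mulr1.
    by move=> a al; rewrite mxE (negPf al) andbF mul0r.
  by move=> a al; rewrite [X in _ * X]mxE (negPf al) mulr0.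
have sumJ2 : \sum_k \sum_l (plane_gen k l *m plane_gen k l) =
    - (2 * (n%:R - 1)) *: 1%:M :> 'M[K]_n.
  have s1 : \sum_k delta_mx k k = 1%:M :> 'M[K]_n.
    apply/matrixP => i j; rewrite summxE mxE (bigD1 i)//= big1 ?addr0.
      by rewrite mxE eqxx eq_sym.
    by move=> a ai; rewrite mxE eq_sym (negPf ai).
  transitivity (\sum_k \sum_(l < n) ((delta_mx k l + delta_mx l k) *+ (k == l)) -
     \sum_(k < n) \sum_l (delta_mx k k + delta_mx l l) : 'M[K]_n).
    rewrite -sumrB; apply: eq_bigr => k _; rewrite -sumrB; apply: eq_bigr => l _.
    exact: plane_gen_sq.
  have -> : \sum_k \sum_(l < n) ((delta_mx k l + delta_mx l k) *+ (k == l)) =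
      2 *: 1%:M :> 'M[K]_n.
    rewrite -s1 scaler_sumr; apply: eq_bigr => k _; rewrite (bigD1 k)//= big1.
      by rewrite eqxx mulr1n addr0 scaler_nat mulr2n.
    by move=> l lk; rewrite eq_sym (negPf lk).
  have -> : \sum_(k < n) \sum_(l < n) (delta_mx k k + delta_mx l l) =
      (2 * n%:R) *: 1%:M :> 'M[K]_n.
    transitivity (\sum_(k < n) (n%:R *: delta_mx k k + 1%:M) : 'M[K]_n).
      apply: eq_bigr => k _; rewrite big_split /= s1 sumr_const card_ord.
      by rewrite scaler_nat.
    rewrite big_split /= -scaler_sumr s1 sumr_const card_ord -scaler_nat.
    by rewrite -scalerDl mulr_natl mulr2n.
  by rewrite -scalerBl; congr (_ *: _); ring.
have sumJAJ : \sum_k \sum_l (plane_gen k l *m A *m plane_gen k l) =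
    2 *: (A^T - (\tr A)%:M).
  have tAT : \sum_k \sum_l (A l k *: delta_mx k l) = A^T :> 'M[K]_n.
    rewrite [RHS]matrix_sum_delta.
    by do 2!apply: eq_bigr => ? _; rewrite mxE.
  have tAT' : \sum_k \sum_l (A k l *: delta_mx l k) = A^T :> 'M[K]_n.
    by rewrite exchange_big.
  have ttr : \sum_k \sum_(l < n) (A l l *: delta_mx k k) = (\tr A)%:M :> 'M[K]_n.
    apply/matrixP => i j; rewrite summxE (bigD1 i)//= [X in _ + X]big1 ?addr0.
      rewrite summxE mxE /mxtrace -mulr_natr mulr_suml; apply: eq_bigr => l _.
      by rewrite !mxE eqxx (eq_sym j) /=.
    move=> a ai; rewrite summxE big1// => l _.
    by rewrite !mxE eq_sym (negPf ai) mulr0.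
  have ttr' : \sum_(k < n) \sum_l (A k k *: delta_mx l l) = (\tr A)%:M :> 'M[K]_n.
    by rewrite exchange_big.
  transitivity (\sum_k \sum_l (A l k *: delta_mx k l + A k l *: delta_mx l k
      - (A l l *: delta_mx k k + A k k *: delta_mx l l))).
    apply: eq_bigr => k _; apply: eq_bigr => l _.
    rewrite /plane_gen !(mulmxBl, mulmxBr) !dAd.
    by apply/matrixP => i j; rewrite !mxE; ring.
  transitivity (\sum_k \sum_l (A l k *: delta_mx k l) +
     \sum_k \sum_l (A k l *: delta_mx l k) -
     (\sum_k \sum_(l < n) (A l l *: delta_mx k k) +
     \sum_(k < n) \sum_l (A k k *: delta_mx l l)) : 'M[K]_n).
    rewrite -!big_split -sumrB; apply: eq_bigr => k _ /=.
    by rewrite -!big_split -sumrB.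
  rewrite tAT tAT' ttr ttr'.
  by apply/matrixP => i j; rewrite !mxE; ring.
transitivity ((\sum_k \sum_l (plane_gen k l *m plane_gen k l)) *m A +
   A *m (\sum_k \sum_l (plane_gen k l *m plane_gen k l)) -
   2 *: \sum_k \sum_l (plane_gen k l *m A *m plane_gen k l)).
  rewrite mulmx_suml mulmx_sumr scaler_sumr -big_split -sumrB.
  apply: eq_bigr => k _ /=.
  by rewrite mulmx_suml mulmx_sumr scaler_sumr -big_split -sumrB.
rewrite sumJ2 sumJAJ -scalemxAl -scalemxAr mul1mx mulmx1.
apply/matrixP => i j; rewrite !mxE.
by case: (i == j); rewrite ?mulr1n ?mulr0n; ring.
Qed.

End PlaneRotations.
Arguments plane_gen {K n} k l.
Arguments plane_gen_sq {K n} k l.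
Arguments plane_gen_cube {K n} k l.

Section PlaneRotationsUnitary.
Variables (R : realType) (n : nat).
Notation C := R[i].
Implicit Types (k l : 'I_n) (s eta : R).

Lemma plane_gen_real k l : (plane_gen k l : 'M[C]_n) \is a realmx.
Proof.
apply/mxOverP => i j; rewrite !mxE.
by rewrite rpredB// realn.
Qed.

Lemma plane_gen_adj k l : (plane_gen k l : 'M[C]_n)^t* = - plane_gen k l.
Proof.
apply/matrixP => i j; rewrite !mxE rmorphB /= !conjC_nat opprB.
by rewrite ![(j == _) && _]andbC.
Qed.

Lemma plane_rot_adj k l eta s :
  (plane_rot k l eta%:C s%:C : 'M[C]_n)^t* = plane_rot k l eta%:C (- s%:C).
Proof.
rewrite /plane_rot; move: (plane_gen k l) (plane_gen_adj k l) => J JE.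
rewrite !adjD !adjZ !realC_conj adj_scalar rmorph1.
rewrite adjM !JE mulNmx mulmxN opprK scalerN.
by rewrite scaleNr.
Qed.

Lemma plane_rot_real k l eta s : (plane_rot k l eta%:C s%:C : 'M[C]_n) \is a realmx.
Proof.
have gr : (plane_gen k l *m plane_gen k l : 'M[C]_n) \is a realmx.
  apply/mxOverP => i j; rewrite mxE; apply: rpred_sum => a _.
  by rewrite rpredM// (mxOverP (plane_gen_real k l)).
apply/mxOverP => i j; rewrite !mxE.
rewrite rpredD ?rpredD//; first exact: realn.
  rewrite rpredM//; first by rewrite complex_real.
  by have /mxOverP /(_ i j) := gr; rewrite mxE.
rewrite rpredM//; first by rewrite complex_real.
by have /mxOverP /(_ i j) := plane_gen_real k l; rewrite !mxE.
Qed.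

Lemma plane_rot_unitary k l eta s : s ^+ 2 = 2 * eta - eta ^+ 2 ->
  (plane_rot k l eta%:C s%:C : 'M[C]_n) \is unitarymx.
Proof.
move=> es; apply/unitarymxP; rewrite plane_rot_adj plane_rotM//.
by rewrite -!rmorphXn /= es rmorphB rmorphM /= rmorph_nat.
Qed.

End PlaneRotationsUnitary.

(** * The energy of a compressed matrix *)

Lemma sum2D (V : nmodType) m n (F G : 'I_m -> 'I_n -> V) :
  \sum_k \sum_l (F k l + G k l) = \sum_k \sum_l F k l + \sum_k \sum_l G k l.
Proof. by rewrite -big_split; apply: eq_bigr => k _; rewrite big_split. Qed.

Lemma sum2M (K : pzSemiRingType) m n (c : K) (F : 'I_m -> 'I_n -> K) :
  \sum_k \sum_l c * F k l = c * \sum_k \sum_l F k l.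
Proof. by rewrite mulr_sumr; apply: eq_bigr => k _; rewrite mulr_sumr. Qed.

Lemma ip_sum2 (R : realType) m n p q (D : 'M[R[i]]_(p, q))
    (F : 'I_m -> 'I_n -> 'M[R[i]]_(p, q)) :
  ip D (\sum_k \sum_l F k l) = \sum_k \sum_l ip D (F k l).
Proof. by rewrite ip_sumr; apply: eq_bigr => k _; rewrite ip_sumr. Qed.

Section CompressionEnergy.
Variables (R : realType) (n : nat).
Notation C := R[i].
Implicit Types (A P : 'M[C]_n) (k l : 'I_n) (s eta : R).
Local Opaque ip fro2.

(** With [P] the perturbation and [A] a centered function of the large matrix,
    the energy is the quantity shown to be small. When [P] is rotated in the
    plane of [k] and [l], the mean over the two opposite angles has derivative
    [drift] with respect to [eta], and the difference is [4 s slope] to first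
    order. *)
Definition energy P A : R := fro2 (P *m A *m P).
Definition drift k l P A : R :=
  2 * ip (P *m A *m P) (P *m cas1 k l A *m P) + 2 * fro2 (P *m der1 k l A *m P).
Definition slope k l P A : R := ip (P *m A *m P) (P *m der1 k l A *m P).

Lemma normM_le (x y a b : R) : `|x| <= a -> `|y| <= b -> `|x * y| <= a * b.
Proof. by move=> xa yb; rewrite normrM ler_pM. Qed.

Lemma normD_le (x y a b : R) : `|x| <= a -> `|y| <= b -> `|x + y| <= a + b.
Proof. by move=> xa yb; apply: le_trans (ler_normD _ _) _; rewrite lerD. Qed.

Lemma normB_le (x y a b : R) : `|x| <= a -> `|y| <= b -> `|x - y| <= a + b.
Proof. by move=> xa yb; apply: normD_le => //; rewrite normrN. Qed.

Lemma le_of_eq (x y z : R) : x <= y -> y = z -> x <= z.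
Proof. by move=> xy <-. Qed.

Let norm_nat (m : nat) : `|m%:R : R| <= m%:R.
Proof. by rewrite normr_nat. Qed.

(** The scalar part of the second-order expansion: [Nb + m] and [Nb - m] are the
    energies after rotations of opposite angles. The odd part [m] cancels from
    their mean, but the mean of the squares keeps [m^2], which contributes
    [4 s^2 q^2 = 8 eta q^2] to first order. *)
Lemma avg_square_expansion (L eta s N al om q t : R) :
  0 <= L -> `|eta| <= 1 -> s ^+ 2 = 2 * eta - eta ^+ 2 ->
  `|N| <= L -> `|q| <= L -> `|al| <= 4 * L -> `|om| <= 16 * L -> `|t| <= 5 * L ->
  let Nb := N + eta * al + eta ^+ 2 * om in
  let m := 2 * s * (q + eta * t) in
  `|((Nb + m) + (Nb - m)) / 2 - N - eta * al| <= 16 * L * eta ^+ 2 /\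
  `|((Nb + m) ^+ 2 + (Nb - m) ^+ 2) / 2 - N ^+ 2 -
    eta * (2 * N * al + 8 * q ^+ 2)| <= 1000 * L ^+ 2 * eta ^+ 2.
Proof.
move=> L0 E es NL qL alL omL tL Nb m; split.
  have -> : ((Nb + m) + (Nb - m)) / 2 - N - eta * al = om * eta ^+ 2.
    by rewrite /Nb; field.
  by rewrite normrM [`|eta ^+ 2|]ger0_norm ?sqr_ge0// ler_wpM2r// sqr_ge0.
have -> : ((Nb + m) ^+ 2 + (Nb - m) ^+ 2) / 2 - N ^+ 2 -
    eta * (2 * N * al + 8 * q ^+ 2) =
  (al * al + 2 * (N * om) + 2 * (eta * (al * om)) + eta * (eta * (om * om)) +
   16 * (q * t) + 8 * (eta * (t * t)) -
   4 * ((q + eta * t) * (q + eta * t))) * eta ^+ 2.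
  transitivity (Nb ^+ 2 + 4 * s ^+ 2 * (q + eta * t) ^+ 2 - N ^+ 2 -
      eta * (2 * N * al + 8 * q ^+ 2)); first by rewrite /m; field.
  by rewrite es /Nb; ring.
rewrite normrM [`|eta ^+ 2|]ger0_norm ?sqr_ge0//.
apply: ler_wpM2r; first exact: sqr_ge0.
have qt := normD_le qL (normM_le E tL).
(* term by term, the sum is at most [856 L^2] *)
apply: le_trans (normB_le (normD_le (normD_le (normD_le (normD_le (normD_le
  (normM_le alL alL) (normM_le (norm_nat 2) (normM_le NL omL)))
  (normM_le (norm_nat 2) (normM_le E (normM_le alL omL))))
  (normM_le E (normM_le E (normM_le omL omL))))
  (normM_le (norm_nat 16) (normM_le qL tL)))
  (normM_le (norm_nat 8) (normM_le E (normM_le tL tL))))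
  (normM_le (norm_nat 4) (normM_le qt qt))) _.
have -> : 4 * L * (4 * L) + 2 * (L * (16 * L)) + 2 * (1 * (4 * L * (16 * L))) +
  1 * (1 * (16 * L * (16 * L))) + 16 * (L * (5 * L)) + 8 * (1 * (5 * L * (5 * L))) +
  4 * ((L + 1 * (5 * L)) * (L + 1 * (5 * L))) = 856 * L ^+ 2 by ring.
by rewrite ler_wpM2r ?sqr_ge0// ler_nat.
Qed.

(** The expansion of a squared norm along a curve that is polynomial in [eta]
    and [s]; all that matters is that the coefficients are vectors of norm at
    most [L]. *)
Lemma avg_expansion m p (Z d1 d2 o1 o2 : 'M[C]_(m, p)) (L eta s : R) :
  0 < eta -> eta <= 1 -> s ^+ 2 = 2 * eta - eta ^+ 2 ->
  fro2 Z <= L -> fro2 d1 <= L -> fro2 d2 <= L -> fro2 o1 <= L -> fro2 o2 <= L ->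
  let Zb := Z + eta%:C *: d1 + (eta ^+ 2)%:C *: d2 in
  let o := o1 + eta%:C *: o2 in
  let Np := fro2 (Zb + s%:C *: o) in
  let Nm := fro2 (Zb + (- s)%:C *: o) in
  let alpha := 2 * ip Z d1 + 2 * fro2 o1 in
  `|(Np + Nm) / 2 - fro2 Z - eta * alpha| <= 16 * L * eta ^+ 2 /\
  `|(Np ^+ 2 + Nm ^+ 2) / 2 - fro2 Z ^+ 2 -
    eta * (2 * fro2 Z * alpha + 8 * ip Z o1 ^+ 2)| <= 1000 * L ^+ 2 * eta ^+ 2.
Proof.
move=> e0 e1 es LZ Ld1 Ld2 Lo1 Lo2 Zb o Np Nm alpha.
have L0 : 0 <= L by apply: le_trans LZ; exact: fro2_ge0.
have E : `|eta| <= 1 by rewrite gtr0_norm.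
have ipL (x y : 'M[C]_(m, p)) a : fro2 x <= a -> fro2 y <= a -> `|ip x y| <= a.
  move=> xa ya; apply: le_trans (ip_le _ _) _.
  by rewrite ler_pdivrMr ?ltr0n// mulr_natr mulr2n lerD.
have frL (x : 'M[C]_(m, p)) a : fro2 x <= a -> `|fro2 x| <= a.
  by move=> xa; rewrite ger0_norm// fro2_ge0.
have sumL (x y : 'M[C]_(m, p)) : fro2 x <= L -> fro2 y <= L ->
    fro2 (x + eta%:C *: y) <= 4 * L.
  move=> xL yL; apply: le_trans (fro2D_le _ _) _; rewrite fro2Z.
  have h : eta ^+ 2 * fro2 y <= 1 * L.
    by apply: ler_pM; rewrite ?sqr_ge0 ?fro2_ge0// expr_le1// ltW.
  have -> : 4 * L = 2 * (L + 1 * L) by ring.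
  by rewrite ler_pM2l ?ltr0n// lerD.
pose e := d1 + eta%:C *: d2.
have Le : fro2 e <= 4 * L by exact: sumL.
have Lo : fro2 o <= 4 * L by exact: sumL.
have ZbE : Zb = Z + eta%:C *: e.
  by rewrite /Zb /e scalerDr addrA scalerA -rmorphM -expr2.
pose om := 2 * ip Z d2 + fro2 e + 2 * (2 * ip o1 o2 + eta * fro2 o2) - fro2 o.
pose t := ip Z o2 + ip e o.
have foE : fro2 o = fro2 o1 + 2 * (eta * ip o1 o2) + eta ^+ 2 * fro2 o2.
  by rewrite /o fro2D fro2Z ipZr.
have feE : ip Z e = ip Z d1 + eta * ip Z d2 by rewrite /e ipDr ipZr.
have fZb : fro2 Zb + s ^+ 2 * fro2 o = fro2 Z + eta * alpha + eta ^+ 2 * om.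
  rewrite ZbE fro2D ipZr fro2Z feE es /om /alpha foE.
  clear; move: (fro2 Z) (ip Z d1) (ip Z d2) (fro2 e) (fro2 o1) (ip o1 o2) (fro2 o2).
  by move=> *; ring.
have qE : ip Zb o = ip Z o1 + eta * t.
  rewrite ZbE ipDl {1}/o ipDr ipZr ipZl /t.
  by clear; move: (ip Z o1) (ip Z o2) (ip e o) => *; ring.
have NpE : Np = fro2 Zb + s ^+ 2 * fro2 o + 2 * s * ip Zb o.
  rewrite /Np fro2D fro2Z ipZr.
  by clear; move: (fro2 Zb) (ip Zb o) (fro2 o) => *; ring.
have NmE : Nm = fro2 Zb + s ^+ 2 * fro2 o - 2 * s * ip Zb o.
  rewrite /Nm fro2D fro2Z ipZr.
  by clear; move: (fro2 Zb) (ip Zb o) (fro2 o) => *; ring.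
have omL : `|om| <= 16 * L.
  apply: le_of_eq (normB_le (normD_le (normD_le
    (normM_le (norm_nat 2) (ipL _ _ _ LZ Ld2)) (frL _ _ Le))
    (normM_le (norm_nat 2) (normD_le (normM_le (norm_nat 2) (ipL _ _ _ Lo1 Lo2))
      (normM_le E (frL _ _ Lo2))))) (frL _ _ Lo)) _.
  by clear; ring.
have LL4 : L <= 4 * L by rewrite ler_peMl// ler1n.
have tL : `|t| <= 5 * L.
  apply: le_of_eq (normD_le (ipL _ _ _ LZ Lo2) (ipL _ _ _ Le Lo)) _.
  by clear; ring.
have alL : `|alpha| <= 4 * L.
  apply: le_of_eq (normD_le (normM_le (norm_nat 2) (ipL _ _ _ LZ Ld1))
    (normM_le (norm_nat 2) (frL _ _ Lo1))) _.
  by clear; ring.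
rewrite NpE NmE fZb qE.
exact: (avg_square_expansion L0 E es (frL _ _ LZ) (ipL _ _ _ LZ Lo1) alL omL tL).
Qed.

Lemma fro2_delta (i j : 'I_n) : fro2 (delta_mx i j : 'M[C]_n) = 1.
Proof.
rewrite fro2E (bigD1 i)//= [X in _ + X]big1 ?addr0; last first.
  move=> a ai; rewrite big1// => b _.
  by rewrite mxE (negPf ai) /abs2 /= expr0n addr0.
rewrite (bigD1 j)//= [X in _ + X]big1 ?addr0; last first.
  move=> b bj; by rewrite mxE (negPf bj) andbF /abs2 /= expr0n addr0.
by rewrite mxE !eqxx /abs2 /= expr1n expr0n addr0.
Qed.

Lemma fro2_plane_gen k l : fro2 (plane_gen k l : 'M[C]_n) <= 4.
Proof.
apply: le_of_eq (fro2D_le _ _) _; rewrite fro2N !fro2_delta.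
by clear; ring.
Qed.

(** Crude bounds suffice here, and they may grow with the size of the matrices:
    they only control the terms of second order in [eta], which disappear in the
    limit [eta -> 0] taken at fixed size. *)
Lemma word_bounds k l P A (p a : R) : fro2 P <= p -> fro2 A <= a ->
  [/\ fro2 (P *m A *m P) <= 1000 * p ^+ 2 * a,
      fro2 (P *m cas1 k l A *m P) <= 1000 * p ^+ 2 * a,
      fro2 (P *m cas2 k l A *m P) <= 1000 * p ^+ 2 * a,
      fro2 (P *m der1 k l A *m P) <= 1000 * p ^+ 2 * a &
      fro2 (P *m der2 k l A *m P) <= 1000 * p ^+ 2 * a].
Proof.
(* the constants come from [fro2 J <= 4] and from the factor [2] in [fro2D_le] *)
move=> Pp Aa; have p0 := le_trans (fro2_ge0 _) Pp.
have a0 := le_trans (fro2_ge0 _) Aa.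
have mul m1 m2 m3 (B : 'M[C]_(m1, m2)) (D : 'M[C]_(m2, m3)) (x y : R) :
    fro2 B <= x -> fro2 D <= y -> fro2 (B *m D) <= x * y.
  by move=> Bx Dy; apply: le_trans (fro2_mul _ _) _; rewrite ler_pM ?fro2_ge0.
have add (B D : 'M[C]_n) (x y : R) :
    fro2 B <= x -> fro2 D <= y -> fro2 (B + D) <= 2 * (x + y).
  move=> Bx Dy; apply: le_trans (fro2D_le _ _) _.
  by rewrite ler_pM2l ?ltr0n// lerD.
have addN (B D : 'M[C]_n) (x y : R) :
    fro2 B <= x -> fro2 D <= y -> fro2 (B - D) <= 2 * (x + y).
  by move=> Bx Dy; apply: add => //; rewrite fro2N.
have J4 := fro2_plane_gen k l.
have PWP (W : 'M[C]_n) (c : R) : c <= 1000 -> fro2 W <= c * a ->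
    fro2 (P *m W *m P) <= 1000 * p ^+ 2 * a.
  move=> c1 Wc; apply: le_trans (mul _ _ _ _ _ _ _ (mul _ _ _ _ _ _ _ Pp Wc) Pp) _.
  have -> : p * (c * a) * p = c * (p ^+ 2 * a) by clear; ring.
  by rewrite -mulrA; apply: ler_wpM2r => //; rewrite mulr_ge0 ?sqr_ge0.
have JJ := mul _ _ _ _ _ _ _ J4 J4.
split.
- by apply: (PWP _ 1); rewrite ?mul1r// ler1n.
- apply: (PWP _ 256); first by rewrite ler_nat.
  apply: le_trans.
    apply: addN; first apply: add.
    + exact: (mul _ _ _ _ _ _ _ JJ Aa).
    + exact: (mul _ _ _ _ _ _ _ Aa JJ).
    + rewrite -[2%:R](rmorph_nat (real_complex R)) fro2Z.
      apply: ler_wpM2l; first exact: sqr_ge0.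
      exact: (mul _ _ _ _ _ _ _ (mul _ _ _ _ _ _ _ J4 Aa) J4).
  by rewrite le_eqVlt; apply/orP; left; apply/eqP; clear; ring.
- apply: (PWP _ 544); first by rewrite ler_nat.
  apply: le_trans.
    apply: add.
    + exact: (mul _ _ _ _ _ _ _ (mul _ _ _ _ _ _ _ JJ Aa) JJ).
    + exact: (mul _ _ _ _ _ _ _ (mul _ _ _ _ _ _ _ J4 Aa) J4).
  by rewrite le_eqVlt; apply/orP; left; apply/eqP; clear; ring.
- apply: (PWP _ 16); first by rewrite ler_nat.
  apply: le_trans.
    apply: addN.
    + exact: (mul _ _ _ _ _ _ _ Aa J4).
    + exact: (mul _ _ _ _ _ _ _ J4 Aa).
  by rewrite le_eqVlt; apply/orP; left; apply/eqP; clear; ring.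
- apply: (PWP _ 256); first by rewrite ler_nat.
  apply: le_trans.
    apply: addN.
    + exact: (mul _ _ _ _ _ _ _ (mul _ _ _ _ _ _ _ JJ Aa) J4).
    + exact: (mul _ _ _ _ _ _ _ (mul _ _ _ _ _ _ _ J4 Aa) JJ).
  by rewrite le_eqVlt; apply/orP; left; apply/eqP; clear; ring.
Qed.

(** The outer unitary factors do not change the norm; this converts a rotation
    of the large matrix into one of the perturbation. *)
Lemma energy_rotE (G P A : 'M[C]_n) : G \is unitarymx ->
  energy P (G^t* *m A *m G) = energy (G *m P *m G^t*) A.
Proof.
move=> GU; rewrite /energy.
have GG : G *m G^t* = 1%:M by apply/unitarymxP.
have GG' : G^t* *m G = 1%:M.
  by have := unitarymxP (etrans (trmxC_unitary G) GU); rewrite trmxCK.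
have -> : G *m P *m G^t* *m A *m (G *m P *m G^t*) =
    G *m (P *m (G^t* *m A *m G) *m P) *m G^t*.
  by clear; move: (G^t*) => H; rewrite !mulmxA.
rewrite (fro2_isomr (V := G^t*)); last by rewrite trmxCK.
by rewrite (fro2_isoml _ GG').
Qed.

Lemma avg_energy k l P A (p a eta s : R) :
  fro2 P <= p -> fro2 A <= a ->
  0 < eta -> eta <= 1 -> s ^+ 2 = 2 * eta - eta ^+ 2 ->
  let Rp : 'M[C]_n := plane_rot k l eta%:C s%:C in
  let Rm : 'M[C]_n := plane_rot k l eta%:C (- s)%:C in
  let Np := energy (Rp *m P *m Rp^t*) A in
  let Nm := energy (Rm *m P *m Rm^t*) A in
  let L := 1000 * p ^+ 2 * a in
  `|(Np + Nm) / 2 - energy P A - eta * drift k l P A| <= 16 * L * eta ^+ 2 /\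
  `|(Np ^+ 2 + Nm ^+ 2) / 2 - energy P A ^+ 2 -
    eta * (2 * energy P A * drift k l P A + 8 * slope k l P A ^+ 2)|
    <= 1000 * L ^+ 2 * eta ^+ 2.
Proof.
move=> Pp Aa e0 e1 es Rp Rm Np Nm L.
have [b1 b2 b3 b4 b5] := word_bounds k l Pp Aa.
have E s' : s' ^+ 2 = 2 * eta - eta ^+ 2 ->
    energy (plane_rot k l eta%:C s'%:C *m P *m (plane_rot k l eta%:C s'%:C)^t*) A =
    fro2 (P *m A *m P + eta%:C *: (P *m cas1 k l A *m P) +
      (eta ^+ 2)%:C *: (P *m cas2 k l A *m P) +
      s'%:C *: (P *m der1 k l A *m P + eta%:C *: (P *m der2 k l A *m P))).
  move=> es'; rewrite -energy_rotE ?plane_rot_unitary// plane_rot_adj plane_rotE.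
    rewrite /energy rmorphXn /=; congr fro2; clear.
    move: (cas1 k l A) (cas2 k l A) (der1 k l A) (der2 k l A) (eta%:C) (s'%:C).
    move=> c1 c2 e1 e2 x y.
    rewrite !mulmxDr !mulmxDl -!scalemxAr -!scalemxAl.
    by rewrite !mulmxDr !mulmxDl -!scalemxAr -!scalemxAl.
  by rewrite -!rmorphXn /= es' rmorphB rmorphM /= rmorph_nat.
have esN : (- s) ^+ 2 = 2 * eta - eta ^+ 2 by rewrite sqrrN.
have := avg_expansion e0 e1 es b1 b2 b3 b4 b5.
by rewrite /= -(E s es) -(E (- s) esN).
Qed.

(** The source of concentration: through the Casimir operator the energy of a
    traceless matrix enters the total drift with the factor [- 8 (n - 1)],
    whereas the remaining terms are bounded independently of [n], by the
    Frobenius norm of the perturbation and the operator norm of [A]. *)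
Lemma sum_drift P A (p K : R) : fro2 P = p -> \tr A = 0 ->
  (forall B : 'M[C]_n, fro2 (A *m B) <= K * fro2 B) ->
  (forall B : 'M[C]_n, fro2 (B *m A) <= K * fro2 B) ->
  \sum_k \sum_l drift k l P A <=
    - (8 * (n%:R - 1)) * energy P A + 40 * K * p ^+ 2 /\
  \sum_k \sum_l slope k l P A ^+ 2 <= 16 * K * p ^+ 2 * energy P A.
Proof.
move=> Pp trA opl opr; set Z := P *m A *m P.
have p0 : 0 <= p by rewrite -Pp fro2_ge0.
have PA : fro2 (P *m A) <= K * p by rewrite -Pp; exact: opr.
have AP : fro2 (A *m P) <= K * p by rewrite -Pp; exact: opl.
have sder : \sum_k \sum_l fro2 (P *m der1 k l A *m P) <= 16 * K * p ^+ 2.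
  (* each of the two factors around the generator is [P] or a product with [A] *)
  have sJ (B D : 'M[C]_n) : fro2 B <= K * p /\ fro2 D <= p \/
      fro2 B <= p /\ fro2 D <= K * p ->
      \sum_k \sum_l fro2 (B *m plane_gen k l *m D) <= 4 * K * p ^+ 2.
    move=> h; have BD : fro2 B * fro2 D <= K * p * p.
      case: h => [] [hB hD]; first by rewrite ler_pM ?fro2_ge0.
      by rewrite mulrC ler_pM ?fro2_ge0.
    apply: (@le_trans _ _ (\sum_k \sum_l
        2 * (fro2 (B *m delta_mx k l *m D) + fro2 (B *m delta_mx l k *m D)))).
      apply: ler_sum => k _; apply: ler_sum => l _.
      rewrite /plane_gen mulmxBr mulmxBl.
      by apply: le_trans (fro2D_le _ _) _; rewrite fro2N.
    have E : \sum_k \sum_l fro2 (B *m delta_mx l k *m D) = fro2 B * fro2 D.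
      by rewrite exchange_big; exact: fro2_sum_delta.
    have -> : \sum_k \sum_l
        2 * (fro2 (B *m delta_mx k l *m D) + fro2 (B *m delta_mx l k *m D)) =
        2 * (fro2 B * fro2 D + fro2 B * fro2 D).
      by rewrite sum2M sum2D; congr (2 * (_ + _)); [exact: fro2_sum_delta|exact: E].
    have -> : 4 * K * p ^+ 2 = 2 * (K * p * p + K * p * p) by clear; ring.
    by rewrite ler_pM2l ?ltr0n// lerD.
  apply: (@le_trans _ _ (\sum_k \sum_l 2 * (fro2 (P *m A *m plane_gen k l *m P) +
      fro2 (P *m plane_gen k l *m (A *m P))))).
    apply: ler_sum => k _; apply: ler_sum => l _.
    rewrite /der1 mulmxBr mulmxBl !mulmxA.
    by apply: le_trans (fro2D_le _ _) _; rewrite fro2N.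
  rewrite sum2M sum2D.
  have h1 : \sum_k \sum_l fro2 (P *m A *m plane_gen k l *m P) <= 4 * K * p ^+ 2.
    by apply: sJ; left; rewrite Pp.
  have h2 : \sum_k \sum_l fro2 (P *m plane_gen k l *m (A *m P)) <= 4 * K * p ^+ 2.
    by apply: sJ; right; rewrite Pp.
  have -> : 16 * K * p ^+ 2 = 2 * (4 * K * p ^+ 2 + 4 * K * p ^+ 2) by clear; ring.
  by rewrite ler_pM2l ?ltr0n// lerD.
have ZE : energy P A = fro2 Z by [].
split; last first.
  apply: (@le_trans _ _ (\sum_k \sum_l fro2 Z * fro2 (P *m der1 k l A *m P))).
    by apply: ler_sum => k _; apply: ler_sum => l _; exact: ip_CS.
  by rewrite sum2M ZE mulrC; apply: ler_wpM2r; rewrite ?fro2_ge0.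
have -> : \sum_k \sum_l drift k l P A =
    2 * ip Z (P *m (\sum_k \sum_l cas1 k l A) *m P) +
    2 * \sum_k \sum_l fro2 (P *m der1 k l A *m P).
  have -> : P *m (\sum_k \sum_l cas1 k l A) *m P =
      \sum_k \sum_l P *m cas1 k l A *m P.
    rewrite mulmx_sumr mulmx_suml; apply: eq_bigr => k _.
    by rewrite mulmx_sumr mulmx_suml.
  transitivity (\sum_k \sum_l 2 * ip Z (P *m cas1 k l A *m P) +
      \sum_k \sum_l 2 * fro2 (P *m der1 k l A *m P)); first exact: sum2D.
  by congr (_ + _); rewrite sum2M// ip_sum2.
have -> : P *m (\sum_k \sum_l cas1 k l A) *m P =
    (- (4 * (n%:R - 1)))%:C *: Z - (4 : R)%:C *: (P *m A^T *m P).
  rewrite sum_cas1 trA mulr0 raddf0 addr0 mulmxBr mulmxBl.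
  rewrite -!scalemxAr -!scalemxAl.
  by rewrite rmorphN rmorphM rmorphB /= !rmorph_nat rmorph1.
have tA : fro2 (P *m A^T *m P) <= K * p ^+ 2.
  rewrite -mulmxA; apply: le_trans (fro2_mul _ _) _.
  rewrite Pp expr2 mulrCA; apply: ler_wpM2l => //.
  by rewrite -fro2_tr trmx_mul trmxK (le_trans (opr _))// fro2_tr Pp.
have ZK : fro2 Z <= K * p ^+ 2.
  apply: le_trans (fro2_mul _ _) _; rewrite Pp expr2 mulrA.
  by apply: ler_wpM2r.
rewrite ipDr ipNr !ipZr ZE (_ : ip Z Z = fro2 Z)//.
have := ip_le Z (P *m A^T *m P); rewrite ler_norml => /andP[h _].
move: sder h tA ZK; rewrite -!(mulrA _ K).
move: (\sum_k _) (ip Z _) (fro2 (P *m A^T *m P)) (fro2 Z) (K * p ^+ 2) (n%:R : R).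
by clear; move=> x1 x2 x3 x4 x5 x6 h1 h2 h3 h4; lra.
Qed.

End CompressionEnergy.

(** * Measurability of matrix-valued maps *)

(** With the convention [0^-1 = 0], the inverse is the pointwise limit of the
    continuous functions [x / (x^2 + 1 / m)]. *)
Lemma measurable_invr (R : realType) : measurable_fun setT (fun x : R => x^-1).
Proof.
pose h (m : nat) (x : R) := x / (x ^+ 2 + m.+1%:R^-1).
have pos m (x : R) : 0 < x ^+ 2 + m.+1%:R^-1.
  by rewrite ltr_wpDl ?sqr_ge0// invr_gt0 ltr0n.
apply: (@measurable_fun_cvg _ _ _ setT h).
  move=> m; apply: continuous_measurable_fun => x.
  apply: cvgM; first exact: cvg_id.
  apply: cvgV; first by rewrite gt_eqF.
  by apply: cvgD; [exact: exprn_continuous | exact: cvg_cst].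
move=> x _ /=.
have [->|x0] := eqVneq x 0.
  rewrite invr0 /h; under eq_fun do rewrite mul0r; exact: cvg_cst.
have -> : x^-1 = x / (x ^+ 2 + 0) by rewrite addr0 expr2 invfM mulrA mulfV// mul1r.
apply: cvgM; first exact: cvg_cst.
apply: cvgV; first by rewrite addr0 sqrf_eq0.
by apply: cvgD; [exact: cvg_cst | exact: cvg_harmonic].
Qed.

Section MatrixMeasurable.
Context (R : realType) d (T : measurableType d).
Notation C := R[i].

Definition cmeas (f : T -> C) :=
  measurable_fun setT (fun w => complex.Re (f w)) /\
  measurable_fun setT (fun w => complex.Im (f w)).

Definition mxmeas m n (F : T -> 'M[C]_(m, n)) :=
  forall i j, cmeas (fun w => F w i j).

Lemma cmeas_cst (z : C) : cmeas (fun=> z).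
Proof. by split; exact: measurable_cst. Qed.

Lemma cmeasD f g : cmeas f -> cmeas g -> cmeas (fun w => f w + g w).
Proof.
move=> [f1 f2] [g1 g2]; split; under eq_fun do rewrite ?ReD ?ImD;
  exact: measurable_funD.
Qed.

Lemma cmeasN f : cmeas f -> cmeas (fun w => - f w).
Proof.
move=> [f1 f2]; split; under eq_fun do rewrite ?ReN ?ImN; exact: measurable_funN.
Qed.

Lemma cmeasM f g : cmeas f -> cmeas g -> cmeas (fun w => f w * g w).
Proof.
move=> [f1 f2] [g1 g2]; split; under eq_fun do rewrite ?ReM ?ImM.
  by apply: measurable_funB; exact: measurable_funM.
by apply: measurable_funD; exact: measurable_funM.
Qed.

Lemma cmeas_conj f : cmeas f -> cmeas (fun w => Num.conj (f w)).
Proof.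
move=> [f1 f2]; split; under eq_fun do rewrite conjCE /=; first exact: f1.
exact: measurable_funN.
Qed.

Lemma cmeasV f : cmeas f -> cmeas (fun w => (f w)^-1).
Proof.
move=> [f1 f2].
have m2 : measurable_fun setT (fun w => (complex.Re (f w) ^+ 2 + complex.Im (f w) ^+ 2)^-1).
  apply: (@measurableT_comp _ _ _ _ _ _ (fun x : R => x^-1)).
    exact: measurable_invr.
  by apply: measurable_funD; exact: measurable_funX.
have E w : (f w)^-1 = Complex
   (complex.Re (f w) / (complex.Re (f w) ^+ 2 + complex.Im (f w) ^+ 2))
   (- (complex.Im (f w) / (complex.Re (f w) ^+ 2 + complex.Im (f w) ^+ 2))).
  by case: (f w).
split; under eq_fun do rewrite E /=; first exact: measurable_funM.
by apply: measurable_funN; exact: measurable_funM.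
Qed.

Lemma cmeas_sum (I : Type) (s : seq I) (P : pred I) (F : I -> T -> C) :
  (forall i, cmeas (F i)) -> cmeas (fun w => \sum_(i <- s | P i) F i w).
Proof.
move=> mF; elim: s => [|a s IH].
  by under eq_fun do rewrite big_nil; exact: cmeas_cst.
under eq_fun do rewrite big_cons; case: (P a) => //; exact: cmeasD.
Qed.

Lemma cmeas_prod (I : Type) (s : seq I) (P : pred I) (F : I -> T -> C) :
  (forall i, cmeas (F i)) -> cmeas (fun w => \prod_(i <- s | P i) F i w).
Proof.
move=> mF; elim: s => [|a s IH].
  by under eq_fun do rewrite big_nil; exact: cmeas_cst.
under eq_fun do rewrite big_cons; case: (P a) => //; exact: cmeasM.
Qed.

Lemma mxmeas_cst m n (A : 'M[C]_(m, n)) : mxmeas (fun=> A).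
Proof. by move=> i j; exact: cmeas_cst. Qed.

Lemma mxmeasD m n (F G : T -> 'M[C]_(m, n)) :
  mxmeas F -> mxmeas G -> mxmeas (fun w => F w + G w).
Proof. by move=> mF mG i j; under eq_fun do rewrite mxE; exact: cmeasD. Qed.

Lemma mxmeasN m n (F : T -> 'M[C]_(m, n)) : mxmeas F -> mxmeas (fun w => - F w).
Proof. by move=> mF i j; under eq_fun do rewrite mxE; exact: cmeasN. Qed.

Lemma mxmeasZ m n (f : T -> C) (F : T -> 'M[C]_(m, n)) :
  cmeas f -> mxmeas F -> mxmeas (fun w => f w *: F w).
Proof. by move=> mf mF i j; under eq_fun do rewrite mxE; exact: cmeasM. Qed.

Lemma mxmeas_scalar n (f : T -> C) : cmeas f -> mxmeas (fun w => (f w)%:M : 'M[C]_n).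
Proof.
move=> mf i j; under eq_fun do rewrite mxE.
by case: (i == j); [exact: mf | exact: cmeas_cst].
Qed.

Lemma mxmeasM m n p (F : T -> 'M[C]_(m, n)) (G : T -> 'M[C]_(n, p)) :
  mxmeas F -> mxmeas G -> mxmeas (fun w => F w *m G w).
Proof.
move=> mF mG i j; under eq_fun do rewrite mxE.
by apply: cmeas_sum => k; exact: cmeasM.
Qed.

Lemma mxmeas_adj m n (F : T -> 'M[C]_(m, n)) :
  mxmeas F -> mxmeas (fun w => (F w)^t*).
Proof. by move=> mF i j; under eq_fun do rewrite !mxE; exact: cmeas_conj. Qed.

Lemma cmeas_tr n (F : T -> 'M[C]_n) : mxmeas F -> cmeas (fun w => \tr (F w)).
Proof. by move=> mF; apply: cmeas_sum. Qed.

Lemma cmeas_det n (F : T -> 'M[C]_n) : mxmeas F -> cmeas (fun w => \det (F w)).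
Proof.
move=> mF; apply: cmeas_sum => s; apply: cmeasM; first exact: cmeas_cst.
exact: cmeas_prod.
Qed.

Lemma mxmeas_adjugate n (F : T -> 'M[C]_n) :
  mxmeas F -> mxmeas (fun w => \adj (F w)).
Proof.
move=> mF i j; under eq_fun do rewrite mxE.
apply: cmeasM; first exact: cmeas_cst.
by apply: cmeas_det => a b; under eq_fun do rewrite !mxE.
Qed.

Lemma measurable_ip m n (F G : T -> 'M[C]_(m, n)) :
  mxmeas F -> mxmeas G -> measurable_fun setT (fun w => ip (F w) (G w)).
Proof.
move=> mF mG; rewrite /ip.
have [+ _] : cmeas (fun w => \tr (F w *m (G w)^t*)).
  by apply: cmeas_tr; apply: mxmeasM => //; exact: mxmeas_adj.
exact.
Qed.

Lemma measurable_fro2 m n (F : T -> 'M[C]_(m, n)) :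
  mxmeas F -> measurable_fun setT (fun w => fro2 (F w)).
Proof. by move=> mF; exact: measurable_ip. Qed.

End MatrixMeasurable.

Section MatrixBorel.
Context (R : realType) (n : nat).
Notation C := R[i].

(** The carrier of a generated sigma-algebra must be a pointed type. *)
Definition pointed_mx : pointedType := 'M[(R[i] : numFieldType)]_n.
Local Notation mx_space :=
  (@g_sigma_algebraType (Pointed.sort pointed_mx) (@mx_cylinders R n)).

Lemma random_mxP d (T : measurableType d) (X : T -> 'M[C]_n) :
  random_mx X <-> mxmeas X.
Proof.
split=> [mX i j|mX S mS].
  have mC S : mx_cylinders S -> measurable (X @^-1` S).
    by move=> cS; apply: mX; exact: sub_sigma_algebra.
  split=> _ B mB; rewrite setTI.
    by apply: (mC ((fun A : 'M[C]_n => complex.Re (A i j)) @^-1` B)); exists i, j, B => //; left.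
  by apply: (mC ((fun A : 'M[C]_n => complex.Im (A i j)) @^-1` B)); exists i, j, B => //; right.
have h : measurable_fun setT (X : T -> mx_space).
  apply: (@measurability _ _ _ mx_space setT X (@mx_cylinders R n)); first by [].
  move=> _ [S0 [i [j [B mB hB]]] <-].
  rewrite setTI; have [mr mi] := mX i j.
  by case: hB => ->; [have := mr measurableT B mB | have := mi measurableT B mB];
    rewrite setTI.
by have := h measurableT S mS; rewrite setTI.
Qed.

Lemma random_mx_measurable d (T : measurableType d) (X : T -> 'M[C]_n) :
  random_mx X <-> measurable_fun setT (X : T -> mx_space).
Proof.
split=> [mX _ S mS|mX S mS]; first by rewrite setTI; exact: mX.
by have := mX measurableT S mS; rewrite setTI.
Qed.

Lemma mxmeas_snd : mxmeas (fun xy : mx_space * mx_space => xy.2 : 'M[C]_n).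
Proof. by apply/random_mxP/random_mx_measurable; exact: measurable_snd. Qed.

Context d (T : measurableType d) (Pr : probability T R).

(** By independence, both joint laws are the product of the marginal laws. *)
Lemma independent_pair_law (X Y X' Y' : T -> 'M[C]_n)
    (h : mx_space * mx_space -> R) :
  random_mx X -> random_mx Y -> random_mx X' -> random_mx Y' ->
  independent_mx Pr X Y -> independent_mx Pr X' Y' ->
  (forall S, mx_borel S -> Pr (X @^-1` S) = Pr (X' @^-1` S)) ->
  (forall S, mx_borel S -> Pr (Y @^-1` S) = Pr (Y' @^-1` S)) ->
  measurable_fun setT h -> (forall xy, 0 <= h xy) ->
  \int[Pr]_w h (X w, Y w) = \int[Pr]_w h (X' w, Y' w).
Proof.
move=> /random_mx_measurable mX /random_mx_measurable mY.
move=> /random_mx_measurable mX' /random_mx_measurable mY' iXY iXY' eX eY mh h0.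
pose XY w : mx_space * mx_space := (X w, Y w).
pose XY' w : mx_space * mx_space := (X' w, Y' w).
have mXY : measurable_fun setT XY by exact: measurable_fun_pair.
have mXY' : measurable_fun setT XY' by exact: measurable_fun_pair.
pose fX := MeasurableFun.Pack (MeasurableFun.Class (@isMeasurableFun.Build _ _ _ _ (X : T -> mx_space) mX)).
pose fY := MeasurableFun.Pack (MeasurableFun.Class (@isMeasurableFun.Build _ _ _ _ (Y : T -> mx_space) mY)).
pose fXY := MeasurableFun.Pack (MeasurableFun.Class (@isMeasurableFun.Build _ _ _ _ XY mXY)).
pose fXY' := MeasurableFun.Pack (MeasurableFun.Class (@isMeasurableFun.Build _ _ _ _ XY' mXY')).
pose dX : probability mx_space R := distribution Pr fX.
pose dY : probability mx_space R := distribution Pr fY.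
have E1 A : measurable A -> (dX \x dY)%E A = distribution Pr fXY A.
  apply: product_measure_unique => {}A B mA mB.
  exact: iXY.
have E2 A : measurable A -> (dX \x dY)%E A = distribution Pr fXY' A.
  apply: product_measure_unique => {}A B mA mB.
  transitivity (Pr (X' @^-1` A) * Pr (Y' @^-1` B))%E; first exact: iXY'.
  by rewrite -eX// -eY.
congr fine.
have mEh : measurable_fun setT (EFin \o h) by exact/measurable_EFinP.
transitivity (\int[distribution Pr fXY]_xy (h xy)%:E)%E.
  by rewrite ge0_integral_pushforward//= => xy _; rewrite lee_fin.
transitivity (\int[distribution Pr fXY']_xy (h xy)%:E)%E; last first.
  by rewrite ge0_integral_pushforward//= => xy _; rewrite lee_fin.
apply: eq_measure_integral => A mA _.
by rewrite -[LHS]E1// -[RHS]E2.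
Qed.

End MatrixBorel.

(** * The second moment of the energy *)

Section BoundedExpectation.
Context (R : realType) d (T : measurableType d) (Pr : probability T R).

Definition bounded_mfun (f : T -> R) :=
  measurable_fun setT f /\ exists K, forall w, `|f w| <= K.

Lemma bounded_mfun_integrable f : bounded_mfun f ->
  Pr.-integrable setT (EFin \o f).
Proof.
move=> [mf [K fK]]; apply: measurable_bounded_integrable => //.
  by apply: le_lt_trans (probability_le1 Pr measurableT) _; rewrite ltry.
exists `|K|; split; first exact: normr_real.
move=> y Ky w _; apply: le_trans (fK w) _.
by apply: ltW; apply: le_lt_trans Ky; exact: ler_norm.
Qed.

Lemma bounded_mfun_cst c : bounded_mfun (fun=> c).
Proof. by split; [exact: measurable_cst | exists `|c|]. Qed.

Lemma bounded_mfunD f g : bounded_mfun f -> bounded_mfun g ->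
  bounded_mfun (fun w => f w + g w).
Proof.
move=> [mf [K fK]] [mg [L gL]]; split; first exact: measurable_funD.
by exists (K + L) => w; exact: normD_le.
Qed.

Lemma bounded_mfunM f g : bounded_mfun f -> bounded_mfun g ->
  bounded_mfun (fun w => f w * g w).
Proof.
move=> [mf [K fK]] [mg [L gL]]; split; first exact: measurable_funM.
by exists (K * L) => w; exact: normM_le.
Qed.

Lemma bounded_mfunX f m : bounded_mfun f -> bounded_mfun (fun w => f w ^+ m).
Proof.
move=> [mf [K fK]]; split; first exact: measurable_funX.
by exists (K ^+ m) => w; rewrite normrX lerXn2r// nnegrE ?normr_ge0// (le_trans (normr_ge0 _) (fK w)).
Qed.

Lemma bounded_mfun_sum (I : Type) (s : seq I) (F : I -> T -> R) :
  (forall i, bounded_mfun (F i)) -> bounded_mfun (fun w => \sum_(i <- s) F i w).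
Proof.
move=> bF; elim: s => [|a s IH].
  by under eq_fun do rewrite big_nil; exact: bounded_mfun_cst.
by under eq_fun do rewrite big_cons; exact: bounded_mfunD.
Qed.

Lemma bexpD f g : bounded_mfun f -> bounded_mfun g ->
  \int[Pr]_w (f w + g w) = \int[Pr]_w f w + \int[Pr]_w g w.
Proof. by move=> bf bg; rewrite RintegralD//; exact: bounded_mfun_integrable. Qed.

Lemma bexpZ k f : bounded_mfun f -> \int[Pr]_w (k * f w) = k * \int[Pr]_w f w.
Proof. by move=> bf; rewrite RintegralZl//; exact: bounded_mfun_integrable. Qed.

Lemma bexp_cst (k : R) : \int[Pr]_(w in setT) k = k.
Proof.
rewrite Rintegral_cst//.
transitivity (k * fine (1%E : \bar R)); last by rewrite /= mulr1.
by congr (_ * fine _); exact: probability_setT.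
Qed.

Lemma bexp_sum (I : Type) (s : seq I) (F : I -> T -> R) :
  (forall i, bounded_mfun (F i)) ->
  \int[Pr]_w (\sum_(i <- s) F i w) = \sum_(i <- s) \int[Pr]_w F i w.
Proof.
move=> bF; elim: s => [|a s IH].
  by under eq_Rintegral do rewrite big_nil; rewrite bexp_cst big_nil.
under eq_Rintegral do rewrite big_cons.
by rewrite bexpD// ?IH ?big_cons//; exact: bounded_mfun_sum.
Qed.

Lemma le_bexp f g : bounded_mfun f -> bounded_mfun g ->
  (forall w, f w <= g w) -> \int[Pr]_w f w <= \int[Pr]_w g w.
Proof.
move=> bf bg fg; apply: le_Rintegral => //; exact: bounded_mfun_integrable.
Qed.

Lemma norm_bexp_le f k : bounded_mfun f -> (forall w, `|f w| <= k) ->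
  `|\int[Pr]_w f w| <= k.
Proof.
move=> bf fk; rewrite ler_norml; apply/andP; split.
  rewrite -(bexp_cst (- k)); apply: le_bexp => //; first exact: bounded_mfun_cst.
  by move=> w; have := fk w; rewrite ler_norml => /andP[].
rewrite -(bexp_cst k); apply: le_bexp => //; first exact: bounded_mfun_cst.
by move=> w; have := fk w; rewrite ler_norml => /andP[].
Qed.

(** Infinitesimal invariance: take means in the expansion, where the first terms
    cancel, divide by [eta] and let [eta] tend to [0]. *)
Lemma first_order_mean_eq0 (N a : T -> R) (Np Nm : R -> T -> R) (L : R) :
  bounded_mfun N -> bounded_mfun a ->
  (forall s, bounded_mfun (Np s)) -> (forall s, bounded_mfun (Nm s)) ->
  (forall eta, 0 < eta -> eta <= 1 ->
    \int[Pr]_w Np eta w = \int[Pr]_w N w /\ \int[Pr]_w Nm eta w = \int[Pr]_w N w) ->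
  (forall eta w, 0 < eta -> eta <= 1 ->
    `|(Np eta w + Nm eta w) / 2 - N w - eta * a w| <= L * eta ^+ 2) ->
  \int[Pr]_w a w = 0.
Proof.
move=> bN ba bNp bNm eN rem; set E := \int[Pr]_w a w.
have h eta : 0 < eta -> eta <= 1 -> `|E| <= L * eta.
  move=> e0 e1; have [eNp eNm] := eN eta e0 e1.
  have bM k f : bounded_mfun f -> bounded_mfun (fun w => k * f w).
    by move=> bf; apply: bounded_mfunM => //; exact: bounded_mfun_cst.
  have bS : bounded_mfun (fun w => 2^-1 * Np eta w + 2^-1 * Nm eta w).
    by apply: bounded_mfunD; exact: bM.
  have bA : bounded_mfun (fun w => (-1) * N w + (- eta) * a w).
    by apply: bounded_mfunD; exact: bM.
  have H : `|\int[Pr]_w (2^-1 * Np eta w + 2^-1 * Nm eta w +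
      ((-1) * N w + (- eta) * a w))| <= L * eta ^+ 2.
    apply: norm_bexp_le; first exact: bounded_mfunD.
    move=> w; have := rem eta w e0 e1; congr (`|_| <= _).
    by move: (Np eta w) (Nm eta w) (N w) (a w) => *; clear; field.
  have E1 : \int[Pr]_w (2^-1 * Np eta w + 2^-1 * Nm eta w +
      ((-1) * N w + (- eta) * a w)) = - eta * E.
    rewrite (bexpD bS bA) (bexpD (bM _ _ (bNp eta)) (bM _ _ (bNm eta))).
    rewrite (bexpD (bM _ _ bN) (bM _ _ ba)) !bexpZ// eNp eNm -/E.
    by move: (\int[Pr]_w N w) E => x y; clear; field.
  rewrite -(ler_pM2l e0) (_ : eta * `|E| = `|- eta * E|); last first.
    by rewrite normrM normrN (gtr0_norm e0).
  by rewrite -E1 mulrCA -expr2.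
apply/eqP; rewrite -normr_le0; apply/ler_addgt0Pl => e e0; rewrite addr0.
have L0 : 0 <= L by have := h 1 ltr01 (lexx _); rewrite mulr1; exact: le_trans.
pose eta := Num.min 1 (e / (L + 1)).
have L1 : 0 < L + 1 by rewrite ltr_wpDl.
have e'0 : 0 < eta by rewrite lt_min ltr01 divr_gt0.
apply: le_trans (h eta e'0 _) _; first by rewrite ge_min lexx.
apply: (@le_trans _ _ ((L + 1) * eta)).
  by rewrite ler_wpM2r ?(ltW e'0)// lerDl ler01.
by rewrite -ler_pdivlMl// mulrC ge_min lexx orbT.
Qed.

End BoundedExpectation.

Lemma le_refl_of_eq (R : realType) (x y : R) : x = y -> x <= y.
Proof. by move=> ->. Qed.

(** The bound on the mean [E1] obtained from the first inequality is inserted in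
    the second one; each of the two steps gains a factor [1 / u]. *)
Lemma second_moment_arith (R : realType) (u q E1 E2 : R) : 0 < u -> 0 <= q ->
  0 <= - (8 * u) * E1 + 40 * q -> 0 <= - (16 * u) * E2 + 208 * q * E1 ->
  E2 <= 65 * q ^+ 2 / u ^+ 2.
Proof.
move=> u0 q0 m1 m2.
have h1 : u * E1 <= 5 * q by move: m1; lra.
have h2 : u * E2 <= 13 * q * E1 by move: m2; lra.
rewrite ler_pdivlMr ?exprn_gt0//.
have h3 : u * (u * E2) <= 13 * q * (5 * q).
  apply: (le_trans (ler_wpM2l (ltW u0) h2)).
  by rewrite mulrCA ler_wpM2l// mulr_ge0 ?ler0n.
by apply: le_of_eq (le_trans (le_refl_of_eq _) h3) _; ring.
Qed.

Section EnergyMoment.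
Context (R : realType) (n : nat) d (T : measurableType d) (Pr : probability T R).
Notation C := R[i].
Local Notation mx_space :=
  (@g_sigma_algebraType (Pointed.sort (pointed_mx R n)) (@mx_cylinders R n)).

Lemma mxmeas_comp d' (S : measurableType d') (F : S -> 'M[C]_n) (f : T -> S) :
  mxmeas F -> measurable_fun setT f -> mxmeas (fun w => F (f w)).
Proof.
by move=> mF mf i j; have [m1 m2] := mF i j; split;
  [exact: (measurableT_comp m1 mf) | exact: (measurableT_comp m2 mf)].
Qed.

Lemma measurable_energy d' (S : measurableType d') (F G : S -> 'M[C]_n) :
  mxmeas F -> mxmeas G -> measurable_fun setT (fun w => energy (F w) (G w)).
Proof.
by move=> mF mG; apply: measurable_fro2; do 2!apply: mxmeasM => //.
Qed.

Variables (c : symmetry_class) (X P : T -> 'M[C]_n) (A : 'M[C]_n -> 'M[C]_n).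
Variables (p K : R).
Hypothesis mX : random_mx X.
Hypothesis mP : random_mx P.
Hypothesis hermX : forall w, X w \is hermsymmx.
Hypothesis normP : forall w, fro2 (P w) = p.
Hypothesis indepXP : independent_mx Pr X P.
Hypothesis invXP : conj_invariant Pr c X \/ conj_invariant Pr c P.
Hypothesis mA : mxmeas (fun M : mx_space => A M).
Hypothesis equivA : forall M G, M \is hermsymmx -> G \is unitarymx ->
  A (G *m M *m G^t*) = G *m A M *m G^t*.
Hypothesis trA : forall M, M \is hermsymmx -> \tr (A M) = 0.
Hypothesis opA : forall M, M \is hermsymmx -> forall B : 'M[C]_n,
  fro2 (A M *m B) <= K * fro2 B /\ fro2 (B *m A M) <= K * fro2 B.

Let mAX : mxmeas (fun w => A (X w)).
Proof. exact: (mxmeas_comp mA ((random_mx_measurable X).1 mX)). Qed.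

Let mPw : mxmeas P. Proof. exact/random_mxP. Qed.

Lemma conj_random (G : 'M[C]_n) d' (S : measurableType d') (Y : S -> 'M[C]_n) :
  random_mx Y -> random_mx (fun w => G *m Y w *m G^t*).
Proof.
move=> /random_mxP mY; apply/random_mxP; apply: mxmeasM; last exact: mxmeas_cst.
by apply: mxmeasM => //; exact: mxmeas_cst.
Qed.

Lemma conj_borel (G : 'M[C]_n) (S : set 'M[C]_n) :
  mx_borel S -> mx_borel ((fun M => G *m M *m G^t*) @^-1` S).
Proof.
move=> mS; have := @conj_random G _ mx_space id.
apply => //; apply/random_mx_measurable; exact: measurable_id.
Qed.

(** If the perturbation is invariant, rotating it does not change the joint law
    of the pair. If it is the large matrix that is invariant, a simultaneous
    conjugation, which the energy does not see, moves the rotation from one to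
    the other. *)
Lemma energy_rot_invariant (G : 'M[C]_n) m : G \is unitarymx -> G \is a realmx ->
  \int[Pr]_w (energy (G *m P w *m G^t*) (A (X w)) ^+ m) =
  \int[Pr]_w (energy (P w) (A (X w)) ^+ m).
Proof.
move=> GU Gr.
have overG M : M \is a realmx -> over_class c M by case: (c).
pose h (xy : mx_space * mx_space) : R := energy xy.2 (A xy.1) ^+ m.
have mh : measurable_fun setT h.
  apply: measurable_funX; apply: measurable_energy; first exact: mxmeas_snd.
  by move=> i j; have [m1 m2] := mA i j; split;
    [exact: (measurableT_comp m1 measurable_fst)
    |exact: (measurableT_comp m2 measurable_fst)].
have h0 xy : 0 <= h xy by rewrite exprn_ge0// fro2_ge0.
case: invXP => [invX|invP]; last first.
  apply: (@independent_pair_law _ _ _ _ Pr X (fun w => G *m P w *m G^t*) X P h) => //.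
  - exact: conj_random.
  - by move=> S S' mS mS'; exact: (indepXP mS (conj_borel G mS')).
  - by move=> S mS; apply: invP => //; exact: overG.
have GsU : G^t* \is unitarymx by rewrite trmxC_unitary.
transitivity (\int[Pr]_w h (G^t* *m X w *m (G^t*)^t*, P w)).
  apply: eq_Rintegral => w _; congr (_ ^+ m).
  rewrite /= -(energy_rotE _ _ GU); congr energy.
  by have := equivA (hermX w) GsU; rewrite trmxCK => ->.
apply: (@independent_pair_law _ _ _ _ Pr (fun w => G^t* *m X w *m (G^t*)^t*) P X P h) => //.
- exact: conj_random.
- move=> S S' mS mS'; exact: (indepXP (conj_borel _ mS) mS').
- move=> S mS; apply: invX => //; apply: overG; apply/mxOverP => i j; rewrite !mxE.
  by have /mxOverP/(_ j i)/CrealP -> := Gr; exact: (mxOverP Gr).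
Qed.

(* [a] bounds the squared Frobenius norm of [A (X w)], and [L] that of all words
   occurring in the expansion of the energy. *)
Let a := n%:R * K.
Let L := 1000 * p ^+ 2 * a.

Let fro2A w : fro2 (A (X w)) <= a.
Proof.
have [+ _] := opA (hermX w) 1%:M; rewrite mulmx1 => h; apply: le_of_eq h _.
rewrite /a mulrC; congr (_ * _); rewrite fro2E.
transitivity (\sum_(i < n) (1 : R)); last by rewrite sumr_const card_ord.
apply: eq_bigr => i _; rewrite (bigD1 i)//= big1 => [|j ji].
  by rewrite mxE eqxx /abs2 /= expr1n expr0n !addr0.
by rewrite mxE eq_sym (negPf ji) /abs2 /= expr0n addr0.
Qed.

Let bounded_energy (G : 'M[C]_n) :
  bounded_mfun (fun w => energy (G *m P w *m G^t*) (A (X w))).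
Proof.
split.
  apply: measurable_energy => //; apply: mxmeasM; last exact: mxmeas_cst.
  by apply: mxmeasM => //; exact: mxmeas_cst.
pose g := fro2 G * p * fro2 G; exists (g * a * g) => w.
have gQ : fro2 (G *m P w *m G^t*) <= g.
  apply: le_trans (fro2_mul _ _) _; rewrite fro2_adj.
  by apply: ler_wpM2r (fro2_ge0 _) _ _ _; rewrite -(normP w); exact: fro2_mul.
rewrite ger0_norm ?fro2_ge0//.
apply: le_trans (fro2_mul _ _) _.
apply: ler_pM; rewrite ?fro2_ge0//.
apply: le_trans (fro2_mul _ _) _.
by apply: ler_pM; rewrite ?fro2_ge0//; exact: fro2A.
Qed.

Lemma bounded_energy1 : bounded_mfun (fun w => energy (P w) (A (X w))).
Proof.
have := bounded_energy 1%:M; congr bounded_mfun; apply/funext => w.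
by rewrite mul1mx adj_scalar rmorph1 mulmx1.
Qed.

Let measurable_word (B : T -> 'M[C]_n) : mxmeas B ->
  mxmeas (fun w => P w *m B w *m P w).
Proof. by move=> mB; do 2!apply: mxmeasM => //. Qed.

Let mxmeas_cas1 k l : mxmeas (fun w => cas1 k l (A (X w))).
Proof.
apply: mxmeasD; last apply: mxmeasN; first apply: mxmeasD.
- by apply: mxmeasM => //; exact: mxmeas_cst.
- by apply: mxmeasM => //; exact: mxmeas_cst.
- apply: mxmeasZ; first exact: cmeas_cst.
  by apply: mxmeasM; [apply: mxmeasM => //|]; exact: mxmeas_cst.
Qed.

Let mxmeas_der1 k l : mxmeas (fun w => der1 k l (A (X w))).
Proof.
by apply: mxmeasD; last apply: mxmeasN; apply: mxmeasM => //; exact: mxmeas_cst.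
Qed.

Let word_boundsE w k l := word_bounds k l (le_refl_of_eq (normP w)) (fro2A w).

Let bounded_drift k l : bounded_mfun (fun w => drift k l (P w) (A (X w))).
Proof.
split.
  apply: measurable_funD; apply: measurable_funM; try exact: measurable_cst.
    by apply: measurable_ip; apply: measurable_word.
  by apply: measurable_fro2; apply: measurable_word.
exists (4 * L) => w; have [b1 b2 _ b3 _] := word_boundsE w k l.
apply: le_of_eq (normD_le (normM_le (_ : `|2| <= 2)
  (le_trans (ip_le _ _) (ler_wpM2r _ (lerD b1 b2))))
  (normM_le (_ : `|2| <= 2) (_ : _ <= L))) _; rewrite ?normr_nat ?invr_ge0 ?ler0n//.
  by rewrite ger0_norm ?fro2_ge0.
by rewrite -/L; field.
Qed.

Let bounded_slope k l : bounded_mfun (fun w => slope k l (P w) (A (X w))).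
Proof.
split; first by apply: measurable_ip; apply: measurable_word.
exists L => w; have [b1 _ _ b3 _] := word_boundsE w k l.
apply: le_of_eq (le_trans (ip_le _ _) (ler_wpM2r _ (lerD b1 b3))) _.
  by rewrite invr_ge0 ler0n.
by rewrite -/L; field.
Qed.

Let angle (eta : R) := Num.sqrt (2 * eta - eta ^+ 2).

Let angle_sq eta : 0 < eta -> eta <= 1 -> angle eta ^+ 2 = 2 * eta - eta ^+ 2.
Proof.
move=> e0 e1; rewrite sqr_sqrtr// (_ : 2 * eta - eta ^+ 2 = eta * (2 - eta)).
  by rewrite mulr_ge0 ?(ltW e0)// subr_ge0 (le_trans e1)// ler1n.
by ring.
Qed.

Let rot k l eta s : 'M[C]_n := plane_rot k l eta%:C s%:C.

Let mean_rot k l eta s m : s ^+ 2 = 2 * eta - eta ^+ 2 ->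
  \int[Pr]_w (energy (rot k l eta s *m P w *m (rot k l eta s)^t*) (A (X w)) ^+ m) =
  \int[Pr]_w (energy (P w) (A (X w)) ^+ m).
Proof.
move=> es; apply: energy_rot_invariant; first exact: plane_rot_unitary.
exact: plane_rot_real.
Qed.

Let mean_drift k l : \int[Pr]_w drift k l (P w) (A (X w)) = 0.
Proof.
pose N s eta w := energy (rot k l eta (s * angle eta) *m P w *m
  (rot k l eta (s * angle eta))^t*) (A (X w)).
apply: (@first_order_mean_eq0 _ _ _ _ (fun w => energy (P w) (A (X w))) _
  (N 1) (N (-1)) (16 * L)).
- exact: bounded_energy1.
- exact: bounded_drift.
- by move=> eta; exact: bounded_energy.
- by move=> eta; exact: bounded_energy.
- move=> eta e0 e1.
  have ep : (1 * angle eta) ^+ 2 = 2 * eta - eta ^+ 2 by rewrite mul1r angle_sq.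
  have em : (-1 * angle eta) ^+ 2 = 2 * eta - eta ^+ 2.
    by rewrite mulN1r sqrrN angle_sq.
  by split; [exact: (mean_rot k l 1 ep) | exact: (mean_rot k l 1 em)].
- move=> eta w e0 e1; rewrite /N mul1r mulN1r.
  by have [] := avg_energy k l (le_refl_of_eq (normP w)) (fro2A w) e0 e1 (angle_sq e0 e1).
Qed.

Let mean_drift2 k l : \int[Pr]_w (2 * energy (P w) (A (X w)) * drift k l (P w) (A (X w)) +
  8 * slope k l (P w) (A (X w)) ^+ 2) = 0.
Proof.
pose N s eta w := energy (rot k l eta (s * angle eta) *m P w *m
  (rot k l eta (s * angle eta))^t*) (A (X w)).
apply: (@first_order_mean_eq0 _ _ _ _ (fun w => energy (P w) (A (X w)) ^+ 2) _
  (fun eta w => N 1 eta w ^+ 2) (fun eta w => N (-1) eta w ^+ 2) (1000 * L ^+ 2)).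
- exact: bounded_mfunX bounded_energy1.
- apply: bounded_mfunD; apply: bounded_mfunM.
  + by apply: bounded_mfunM bounded_energy1; exact: bounded_mfun_cst.
  + exact: bounded_drift.
  + exact: bounded_mfun_cst.
  + by apply: bounded_mfunX; exact: bounded_slope.
- by move=> eta; apply: bounded_mfunX; exact: bounded_energy.
- by move=> eta; apply: bounded_mfunX; exact: bounded_energy.
- move=> eta e0 e1.
  have ep : (1 * angle eta) ^+ 2 = 2 * eta - eta ^+ 2 by rewrite mul1r angle_sq.
  have em : (-1 * angle eta) ^+ 2 = 2 * eta - eta ^+ 2.
    by rewrite mulN1r sqrrN angle_sq.
  by split; [exact: (mean_rot k l 2 ep) | exact: (mean_rot k l 2 em)].
- move=> eta w e0 e1; rewrite /N mul1r mulN1r.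
  by have [] := avg_energy k l (le_refl_of_eq (normP w)) (fro2A w) e0 e1 (angle_sq e0 e1).
Qed.

(** By invariance the drifts of the energy and of its square have zero mean for
    every plane. Their sums over all planes bound [n - 1] times the mean of the
    energy by a constant, and [n - 1] times the mean of its square by a constant
    times the mean of the energy. *)
Lemma energy_second_moment : (1 < n)%N -> 0 <= K ->
  \int[Pr]_w (energy (P w) (A (X w)) ^+ 2) <=
  65 * K ^+ 2 * p ^+ 4 / (n%:R - 1) ^+ 2.
Proof.
move=> n1 K0; set E2 := \int[Pr]_w _.
pose N w := energy (P w) (A (X w)).
pose E1 := \int[Pr]_w N w.
have bN : bounded_mfun N by exact: bounded_energy1.
have N0 w : 0 <= N w by exact: fro2_ge0.
have bM k f : bounded_mfun f -> bounded_mfun (fun w => k * f w).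
  by move=> bf; apply: bounded_mfunM => //; exact: bounded_mfun_cst.
have sd w := sum_drift (normP w) (trA (hermX w))
  (fun B => (opA (hermX w) B).1) (fun B => (opA (hermX w) B).2).
pose u : R := n%:R - 1; have u0 : 0 < u by rewrite subr_gt0 ltr1n.
pose q := K * p ^+ 2.
have q0 : 0 <= q by rewrite mulr_ge0// sqr_ge0.
have m1 : 0 <= - (8 * u) * E1 + 40 * q.
  have -> : 0 = \int[Pr]_w (\sum_k \sum_l drift k l (P w) (A (X w))) :> R.
    rewrite bexp_sum; last by move=> k; apply: bounded_mfun_sum.
    by rewrite big1// => k _; rewrite bexp_sum// big1.
  rewrite -[40 * q](bexp_cst Pr) -bexpZ// -bexpD//; last 2 first.
    exact: bM.
    exact: bounded_mfun_cst.
  apply: le_bexp.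
  - by apply: bounded_mfun_sum => k; apply: bounded_mfun_sum.
  - by apply: bounded_mfunD; [exact: bM | exact: bounded_mfun_cst].
  - by move=> w; have [+ _] := sd w; rewrite -mulrA.
have m2 : 0 <= - (16 * u) * E2 + 208 * q * E1.
  have bt k l : bounded_mfun (fun w => 2 * N w * drift k l (P w) (A (X w)) +
      8 * slope k l (P w) (A (X w)) ^+ 2).
    apply: bounded_mfunD; first by apply: bounded_mfunM => //; exact: bM.
    by apply: bM; exact: (bounded_mfunX 2 (bounded_slope k l)).
  have -> : 0 = \int[Pr]_w (\sum_k \sum_l (2 * N w * drift k l (P w) (A (X w)) +
      8 * slope k l (P w) (A (X w)) ^+ 2)) :> R.
    rewrite bexp_sum; last by move=> k; apply: bounded_mfun_sum.
    by rewrite big1// => k _; rewrite bexp_sum// big1.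
  rewrite -!bexpZ//; last exact: bounded_mfunX.
  rewrite -bexpD; [|by apply: bM; exact: bounded_mfunX|exact: bM].
  apply: le_bexp.
  - by apply: bounded_mfun_sum => k; apply: bounded_mfun_sum.
  - by apply: bounded_mfunD; apply: bM => //; exact: bounded_mfunX.
  - move=> w; rewrite sum2D !sum2M.
    have [h1 h2] := sd w; rewrite -/(N w) in h1 h2 *.
    apply: le_trans (lerD (ler_wpM2l _ h1) (ler_wpM2l _ h2)) _; rewrite ?ler0n//.
      by rewrite mulr_ge0 ?ler0n.
    by rewrite le_eqVlt; apply/orP; left; apply/eqP; rewrite /u /q; ring.
have -> : 65 * K ^+ 2 * p ^+ 4 = 65 * q ^+ 2.
  by rewrite /q; ring.
rewrite -/u.
exact: second_moment_arith u0 q0 m1 m2.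
Qed.

End EnergyMoment.

(** * Almost sure convergence of the energy *)

Section AlmostSure.
Context (R : realType) d (T : measurableType d) (Pr : probability T R).

Lemma bounded_series_cvg0 (u : R^nat) (B : R) :
  (forall m, 0 <= u m) -> (forall m, series u m <= B) -> u @ \oo --> (0 : R).
Proof.
move=> u0 uB; apply: cvg_series_cvg_0; apply: nondecreasing_is_cvgn.
  by apply/nondecreasing_seqP => m; rewrite !seriesEnat /= big_nat_recr//= lerDl.
by exists B => x [m _ <-]; exact: uB.
Qed.

(** The series of the [N m] has a finite mean, by monotone convergence, hence it
    converges almost surely. *)
Lemma summable_mean_cvg0 (N : nat -> T -> R) (v : R^nat) (B : R) :
  (forall m, bounded_mfun (N m)) -> (forall m w, 0 <= N m w) ->
  (forall m, \int[Pr]_w N m w <= v m) -> (forall m, series v m <= B) ->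
  {ae Pr, forall w, N m w @[m --> \oo] --> (0 : R)}.
Proof.
move=> bN N0 Nv vB.
pose g w := (\sum_(0 <= m <oo) (N m w)%:E)%E.
have mN m : measurable_fun setT (EFin \o N m) by apply/measurable_EFinP; case: (bN m).
have g0 w : (0 <= g w)%E by apply: nneseries_ge0 => m _ _; rewrite lee_fin.
have Ng w k : (series (fun m => N m w) k)%:E%E = (\sum_(0 <= m < k) (N m w)%:E)%E.
  by rewrite seriesEnat sumEFin.
have intg : (\int[Pr]_w g w <= B%:E)%E.
  rewrite integral_nneseries//; last by move=> m w _; rewrite lee_fin.
  apply: lime_le.
    by apply: is_cvg_nneseries => m _ _; apply: integral_ge0 => w _; rewrite lee_fin.
  apply: nearW => k; apply: (@le_trans _ _ (series v k)%:E); last by rewrite lee_fin.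
  rewrite seriesEnat -sumEFin; apply: lee_sum => m _.
  have := Nv m; rewrite -lee_fin /Rintegral fineK//.
  exact: (integrable_fin_num _ (bounded_mfun_integrable Pr (bN m))).
have mg : measurable_fun setT g.
  apply: ge0_emeasurable_sum => [|m] *; last exact: mN.
  by rewrite lee_fin.
have ig : Pr.-integrable setT g.
  apply/integrableP; split => //.
  under eq_integral do rewrite gee0_abs//.
  by apply: le_lt_trans intg _; rewrite ltry.
apply: filterS (integrable_ae measurableT ig) => w /(_ I) gw.
apply: (@bounded_series_cvg0 _ (fine (g w))) => // k.
rewrite -lee_fin fineK// Ng.
by apply: nneseries_lim_ge => m _ _; rewrite lee_fin.
Qed.

(** Comparison with the telescoping series of [1 / (k (k + 1))]. *)
Lemma series_inv_sq_le m :
  series (fun k => (k.+1%:R ^+ 2)^-1 : R) m <= 2.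
Proof.
have S m' : series (fun k => (k.+1%:R ^+ 2)^-1 : R) m'.+1 =
    series (fun k => (k.+1%:R ^+ 2)^-1 : R) m' + (m'.+1%:R ^+ 2)^-1.
  by rewrite !seriesEnat /= big_nat_recr.
case: m => [|m]; first by rewrite seriesEnat /= big_geq.
suff h : series (fun k => (k.+1%:R ^+ 2)^-1 : R) m.+1 <= 2 - m.+1%:R^-1.
  by apply: le_trans h _; rewrite gerBl invr_ge0 ler0n.
elim: m => [|m IH].
  by rewrite S seriesEnat /= big_geq// expr1n invr1 add0r -(natrB _ (isT : (1 <= 2)%N)).
rewrite S; apply: le_trans (lerD IH (lexx _)) _.
rewrite -addrA lerD2l.
have m1 : 0 < m.+1%:R :> R by rewrite ltr0n.
have m2 : 0 < m.+2%:R :> R by rewrite ltr0n.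
have -> : (m.+1%:R^-1 : R) = m.+2%:R^-1 + (m.+1%:R * m.+2%:R)^-1.
  have -> : (m.+2%:R : R) = m.+1%:R + 1 by rewrite -natr1.
  by field; rewrite !gt_eqF//= ?addr_gt0// ?ltr0n.
rewrite opprD -addrA gerDl addrC subr_le0 lef_pV2 ?posrE ?mulr_gt0 ?exprn_gt0//.
by rewrite expr2 ler_pM2r// ler_nat.
Qed.

(** The second moments are summable, so the squares tend to [0]. *)
Lemma second_moment_ae_cvg0 (N : nat -> T -> R) (C : R) (n0 : nat) :
  (forall m, (n0 <= m)%N -> bounded_mfun (N m)) ->
  (forall m w, 0 <= N m w) ->
  (forall m, (n0 <= m)%N -> (1 < m)%N ->
     \int[Pr]_w (N m w ^+ 2) <= C / (m%:R - 1) ^+ 2) ->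
  {ae Pr, forall w, N m w @[m --> \oo] --> (0 : R)}.
Proof.
move=> bN N0 N2; pose k := maxn n0 2.
have C0 : 0 <= C.
  have q0 : 0 < (k%:R - 1 : R) ^+ 2.
    by rewrite exprn_gt0// subr_gt0 ltr1n (leq_maxr n0 2).
  have : 0 <= C / (k%:R - 1) ^+ 2.
    apply: le_trans (N2 k (leq_maxl _ _) (leq_maxr _ _)).
    by apply: Rintegral_ge0 => w _; exact: sqr_ge0.
  by rewrite pmulr_lge0 ?invr_gt0.
have h : {ae Pr, forall w, N (m + k)%N w ^+ 2 @[m --> \oo] --> (0 : R)}.
  apply: (@summable_mean_cvg0 (fun m w => N (m + k)%N w ^+ 2)
    (fun m => C * (m.+1%:R ^+ 2)^-1) (C * 2)).
  - move=> m; apply: bounded_mfunX; apply: bN.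
    by rewrite (leq_trans (leq_maxl n0 2))// leq_addl.
  - by move=> m w; exact: sqr_ge0.
  - move=> m; apply: le_trans (N2 _ _ _) _.
    + by rewrite (leq_trans (leq_maxl n0 2))// leq_addl.
    + by rewrite (leq_trans (leq_maxr n0 2))// leq_addl.
    + rewrite ler_wpM2l// lef_pV2 ?posrE ?exprn_gt0 ?subr_gt0 ?ltr0n//; last first.
        by rewrite ltr1n (leq_trans (leq_maxr n0 2))// leq_addl.
      rewrite lerXn2r ?nnegrE ?ler0n//.
        by rewrite subr_ge0 ler1n (leq_trans _ (leq_addl m k))// (leq_trans _ (leq_maxr n0 2)).
      rewrite lerBrDr natr1 ler_nat -addn2 leq_add2l; exact: leq_maxr.
  - move=> m; have -> : series (fun m => C * (m.+1%:R ^+ 2)^-1) m =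
        C * series (fun m => (m.+1%:R ^+ 2)^-1) m.
      by rewrite !seriesEnat /= mulr_sumr.
    by rewrite ler_wpM2l// series_inv_sq_le.
apply: filterS h => w h.
have /(_ _) hh := continuous_cvg _ (@sqrt_continuous R 0) h.
rewrite -(cvg_shiftn k).
have -> : (fun m => N (m + k)%N w) = (fun m => Num.sqrt (N (m + k)%N w ^+ 2)).
  by apply/funext => m; rewrite sqrtr_sqr ger0_norm.
by rewrite sqrtr0 in hh; exact: hh.
Qed.

End AlmostSure.

(** * Functional calculus of Hermitian matrices *)

Section FunctionalCalculus.
Variable R : realType.
Notation C := R[i].

(** For Hermitian matrices; taking real parts makes the eigenvalues real
    numbers. *)
Definition evals n (M : 'M[C]_n) (i : 'I_n) : R := complex.Re (spectral_diag M 0 i).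

Definition fcalc n (f : R -> C) (M : 'M[C]_n) : 'M[C]_n :=
  (spectralmx M)^t* *m diag_mx (\row_i f (evals M i)) *m spectralmx M.

Lemma unitaryK n (U : 'M[C]_n) : U \is unitarymx -> U^t* *m U = 1%:M.
Proof.
by move=> UU; have := unitarymxP (etrans (trmxC_unitary U) UU); rewrite trmxCK.
Qed.

Variable n : nat.
Implicit Types (M : 'M[C]_n) (f g : R -> C).

Lemma spectralK M : (spectralmx M)^t* *m spectralmx M = 1%:M.
Proof. exact/unitaryK/spectral_unitarymx. Qed.

Lemma spectralKV M : spectralmx M *m (spectralmx M)^t* = 1%:M.
Proof. exact/unitarymxP/spectral_unitarymx. Qed.

Definition in_eigenbasis M (D : 'M[C]_n) : 'M[C]_n :=
  (spectralmx M)^t* *m D *m spectralmx M.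

Lemma eq_fcalc f g M : (forall i, f (evals M i) = g (evals M i)) ->
  fcalc f M = fcalc g M.
Proof.
move=> fg; apply: (congr1 (fun d => in_eigenbasis M (diag_mx d))).
by apply/rowP => i; rewrite !mxE.
Qed.

Lemma fcalc_id M : M \is hermsymmx -> fcalc (fun t => t%:C) M = M.
Proof.
move=> Mh; have /orthomx_spectralP := hermitian_normalmx Mh.
rewrite (invmx_unitary (spectral_unitarymx M)) => ME; rewrite [RHS]ME.
apply: (congr1 (fun d => in_eigenbasis M (diag_mx d))).
apply/rowP => i; rewrite !mxE /evals.
by apply: RRe_real; exact: (mxOverP (hermitian_spectral_diag_real Mh)).
Qed.

Lemma fcalcM f g M : fcalc f M *m fcalc g M = fcalc (fun t => f t * g t) M.
Proof.
transitivity (in_eigenbasis M (diag_mx (\row_i f (evals M i)) *m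
    diag_mx (\row_i g (evals M i)))).
  rewrite /fcalc /in_eigenbasis; have := spectralKV M.
  move: (spectralmx M) ((spectralmx M)^t*) => U V UV.
  by rewrite !mulmxA -(mulmxA _ U V) UV mulmx1.
rewrite mulmx_diag; apply: (congr1 (fun d => in_eigenbasis M (diag_mx d))).
by apply/rowP => i; rewrite !mxE.
Qed.

Lemma fcalcD f g M : fcalc f M + fcalc g M = fcalc (fun t => f t + g t) M.
Proof.
rewrite /fcalc -mulmxDl -mulmxDr; apply: (congr1 (in_eigenbasis M)).
apply/matrixP => i j; rewrite !mxE.
by case: (i == j); rewrite ?mulr1n ?mulr0n ?addr0.
Qed.

Lemma fcalcZ (a : C) f M : a *: fcalc f M = fcalc (fun t => a * f t) M.
Proof.
rewrite /fcalc scalemxAl scalemxAr; apply: (congr1 (in_eigenbasis M)).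
apply/matrixP => i j; rewrite !mxE.
by case: (i == j); rewrite ?mulr1n ?mulr0n ?mulr0.
Qed.

Lemma fcalc_cst (a : C) M : fcalc (fun=> a) M = a%:M.
Proof.
rewrite /fcalc (_ : diag_mx _ = a%:M); last first.
  by apply/matrixP => i j; rewrite !mxE.
by rewrite mul_mx_scalar -scalemxAl spectralK scalemx1.
Qed.

Lemma fcalcB f g M : fcalc f M - fcalc g M = fcalc (fun t => f t - g t) M.
Proof.
rewrite -scaleN1r fcalcZ fcalcD; apply: eq_fcalc => i; by rewrite mulN1r.
Qed.

Lemma fcalc_adj f M : (fcalc f M)^t* = fcalc (fun t => Num.conj (f t)) M.
Proof.
rewrite /fcalc !adjM trmxCK mulmxA; apply: (congr1 (in_eigenbasis M)).
apply/matrixP => i j; rewrite !mxE eq_sym.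
by case: eqP => [->|_]; rewrite ?mulr1n ?mulr0n ?rmorph0.
Qed.

Lemma fcalc_trace f M : \tr (fcalc f M) = \sum_i f (evals M i).
Proof.
rewrite /fcalc mxtrace_mulC mulmxA spectralKV mul1mx.
by rewrite mxtrace_diag; apply: eq_bigr => i _; rewrite mxE.
Qed.

Lemma fro2_diagl p (d : 'rV[C]_n) (B : 'M[C]_(n, p)) (K : R) :
  (forall i, abs2 (d 0 i) <= K) -> fro2 (diag_mx d *m B) <= K * fro2 B.
Proof.
move=> dK; rewrite mul_diag_mx !fro2E mulr_sumr; apply: ler_sum => i _.
rewrite mulr_sumr; apply: ler_sum => j _; rewrite mxE abs2M.
by rewrite ler_wpM2r// abs2_ge0.
Qed.

(** Up to unitary factors, which preserve the Frobenius norm, this is the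
    multiplication by a diagonal matrix. *)
Lemma fro2_fcalcl p f M (B : 'M[C]_(n, p)) (K : R) :
  (forall i, abs2 (f (evals M i)) <= K) -> fro2 (fcalc f M *m B) <= K * fro2 B.
Proof.
move=> fK; rewrite /fcalc -!mulmxA fro2_isoml ?trmxCK ?spectralKV//.
rewrite -(fro2_isoml B (spectralK M)); apply: fro2_diagl => i.
by rewrite mxE.
Qed.

Lemma fro2_fcalcr p f M (B : 'M[C]_(p, n)) (K : R) :
  (forall i, abs2 (f (evals M i)) <= K) -> fro2 (B *m fcalc f M) <= K * fro2 B.
Proof.
move=> fK; rewrite -fro2_adj adjM fcalc_adj -(fro2_adj B).
by apply: fro2_fcalcl => i; rewrite abs2_conj.
Qed.

End FunctionalCalculus.

(** * Eigenvalues *)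

Section Eigenvalues.
Variable R : realType.
Notation C := R[i].

Lemma char_poly_conj n (U D : 'M[C]_n) : U \is unitarymx ->
  char_poly (U^t* *m D *m U) = char_poly D.
Proof.
move=> UU; rewrite /char_poly /char_poly_mx.
have uU : U^t* *m U = 1%:M by exact: unitaryK.
have pU : map_mx polyC (U^t*) *m map_mx polyC U = 1%:M.
  by rewrite -map_mxM uU map_mx1.
have -> : 'X%:M - map_mx polyC (U^t* *m D *m U) =
    map_mx polyC (U^t*) *m ('X%:M - map_mx polyC D) *m map_mx polyC U.
  rewrite mulmxBr mulmxBl !map_mxM; congr (_ - _).
  by rewrite mul_mx_scalar -scalemxAl pU scalemx1.
by rewrite !det_mulmx mulrAC -det_mulmx pU det1 mul1r.
Qed.

(** The block matrix with rows [X, A] and [B, 1] is brought to triangular form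
    by two column operations; its determinant times [X^n] is computed in two
    ways. *)
Lemma char_poly_mulC n (A B : 'M[C]_n) : char_poly (A *m B) = char_poly (B *m A).
Proof.
rewrite /char_poly /char_poly_mx.
pose a := map_mx polyC A; pose b := map_mx polyC B.
have -> : map_mx polyC (A *m B) = a *m b by rewrite map_mxM.
have -> : map_mx polyC (B *m A) = b *m a by rewrite map_mxM.
pose M : 'M[{poly C}]_(n + n) := block_mx 'X%:M a b 1%:M.
have e1 : M *m block_mx 1%:M 0 (- b) 1%:M = block_mx ('X%:M - a *m b) a 0 1%:M.
  rewrite mulmx_block !mulmx1 !mulmx0 !mulmxN !mul1mx !add0r.
  by rewrite subrr.
have e2 : M *m block_mx 1%:M (- a) 0 'X%:M = block_mx 'X%:M 0 b ('X%:M - b *m a).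
  rewrite mulmx_block !mulmx1 !mulmx0 !addr0 !mulmxN.
  rewrite mul_scalar_mx mul_mx_scalar addNr mul_mx_scalar scalemx1.
  by rewrite addrC.
have d1 : \det M = \det ('X%:M - a *m b).
  have := congr1 determinant e1; rewrite det_mulmx det_lblock det_ublock.
  by rewrite !det1 !mulr1.
have d2 : \det M * 'X ^+ n = 'X ^+ n * \det ('X%:M - b *m a).
  have := congr1 determinant e2; rewrite det_mulmx det_lblock det_ublock.
  by rewrite !det1 !det_scalar mul1r.
apply: (@mulfI _ ('X ^+ n)); first by rewrite expf_neq0// polyX_eq0.
by rewrite -d1 -d2 mulrC.
Qed.

Lemma eigenvalues_prod n (M : 'M[C]_n) (s : seq C) :
  char_poly M = \prod_(z <- s) ('X - z%:P) -> perm_eq (eigenvalues M) s.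
Proof.
move=> Ms; apply: prod_XsubC_eq; rewrite -Ms /eigenvalues.
case: closed_field_poly_normal => /= r; rewrite (eqP (char_poly_monic M)).
by rewrite scale1r => ->.
Qed.

Lemma eigenvalues_diag n (e : 'I_n -> R) (U M : 'M[C]_n) : U \is unitarymx ->
  M = U^t* *m diag_mx (\row_i (e i)%:C) *m U ->
  perm_eq (eigenvalues M) [seq (e i)%:C | i <- enum 'I_n].
Proof.
move=> UU ->; apply: eigenvalues_prod; rewrite char_poly_conj//.
rewrite char_poly_trig ?diag_mx_is_trig// big_map big_enum /=.
by apply: eq_bigr => i _; rewrite !mxE eqxx mulr1n.
Qed.

Lemma eigenvalues_herm n (M : 'M[C]_n) : M \is hermsymmx ->
  perm_eq (eigenvalues M) [seq (evals M i)%:C | i <- enum 'I_n].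
Proof.
move=> Mh; apply: (eigenvalues_diag (spectral_unitarymx M)).
by rewrite -[LHS](fcalc_id Mh).
Qed.

Lemma eigenvalues_mulC n (A B : 'M[C]_n) :
  eigenvalues (A *m B) = eigenvalues (B *m A).
Proof. by rewrite /eigenvalues char_poly_mulC. Qed.

(** Comparing the sorted eigenvalues with a level amounts to counting
    eigenvalues, which reduces their location to dimension counts. *)
Lemma sorted_nth_gt (s : seq R) (z : R) (k : nat) :
  (k < size s)%N -> (z < nth 0 (sort >=%R s) k) = (k < count (> z) s)%N.
Proof.
rewrite -(size_sort >=%R s) -(permP (permEl (perm_sort >=%R s))).
have : sorted >=%R (sort >=%R s) by apply: sort_sorted => x y; exact: le_total.
elim: (sort _ _) k => [//|x t IH] k xt ks /=.
have ts : sorted >=%R t by exact: path_sorted xt.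
have [zx|xz] := ltP z x.
  by case: k ks => [|k] ks /=; [rewrite zx | rewrite add1n ltnS IH].
have all_le y : y \in t -> y <= x.
  by move: xt => /= /order_path_min /allP h /h; apply; move=> a b c /= ? /le_trans; apply.
rewrite (_ : count _ t = 0%N) ?addn0 ?ltn0; last first.
  apply/eqP; rewrite -leqn0 leqNgt -has_count; apply/hasPn => y /all_le yx /=.
  by rewrite -leNgt (le_trans yx).
case: k ks => [|k] ks /=; first by rewrite ltNge xz.
apply/negbTE; rewrite -leNgt (le_trans _ xz)//; apply: all_le.
by rewrite mem_nth.
Qed.

Lemma lambda_gt n (e : 'I_n -> R) (M : 'M[C]_n) (z : R) (k : nat) :
  perm_eq (eigenvalues M) [seq (e i)%:C | i <- enum 'I_n] ->
  (k < n)%N -> (z < lambda k.+1 M) = (k < #|[pred i | (z < e i)%R]|)%N.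
Proof.
move=> Me kn; rewrite /lambda /=.
have pe : perm_eq [seq complex.Re z | z <- eigenvalues M] [seq e i | i <- enum 'I_n].
  by rewrite (_ : [seq e i | i <- _] = [seq complex.Re z | z <- [seq (e i)%:C | i <- enum 'I_n]]) ?perm_map// -map_comp.
rewrite sorted_nth_gt; last by rewrite (perm_size pe) size_map size_enum_ord.
rewrite (permP pe) count_map -size_filter cardE.
by rewrite /enum_mem filter_predT -enumT.
Qed.

Lemma lambda_nth n (e : 'I_n -> R) (M : 'M[C]_n) (k : nat) :
  perm_eq (eigenvalues M) [seq (e i)%:C | i <- enum 'I_n] ->
  (k < n)%N -> exists i, lambda k.+1 M = e i.
Proof.
move=> Me kn; rewrite /lambda /=.
have pe : perm_eq [seq complex.Re z | z <- eigenvalues M] [seq e i | i <- enum 'I_n].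
  by rewrite (_ : [seq e i | i <- _] = [seq complex.Re z | z <- [seq (e i)%:C | i <- enum 'I_n]]) ?perm_map// -map_comp.
have : nth 0 (sort >=%R [seq complex.Re z | z <- eigenvalues M]) k \in
    [seq e i | i <- enum 'I_n].
  rewrite -(perm_mem pe) -(mem_sort >=%R); apply: mem_nth.
  by rewrite size_sort (perm_size pe) size_map size_enum_ord.
by move=> /mapP[i _ ->]; exists i.
Qed.

End Eigenvalues.

(** * Counting eigenvalues of a finite-rank perturbation *)

Section Counting.
Variable R : realType.
Notation C := R[i].

Lemma ip_adjl m n p (A : 'M[C]_(m, p)) (B : 'M[C]_(m, n)) (D : 'M[C]_(n, p)) :
  ip A (B *m D) = ip (B^t* *m A) D.
Proof. by rewrite /ip adjM mulmxA [in LHS]mxtrace_mulC mulmxA. Qed.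

Definition rdiag n (e : 'I_n -> R) : 'M[C]_n := diag_mx (\row_i (e i)%:C).

Lemma abs2Zr (k : R) (z : C) : abs2 (k%:C * z) = k ^+ 2 * abs2 z.
Proof. by case: z => a b; rewrite /abs2 /=; ring. Qed.

Lemma fro2_cV n (x : 'cV[C]_n) : fro2 x = \sum_i abs2 (x i 0).
Proof. by rewrite fro2E; apply: eq_bigr => i _; rewrite big_ord1. Qed.

Lemma ip_rdiag n (e : 'I_n -> R) (y : 'cV[C]_n) :
  ip y (rdiag e *m y) = \sum_i e i * abs2 (y i 0).
Proof.
rewrite /rdiag mul_diag_mx ipE; apply: eq_bigr => i _; rewrite big_ord1 !mxE.
by case: (y i 0) => u v; rewrite /abs2 /=; ring.
Qed.

Lemma fro2_rdiag n (e : 'I_n -> R) (y : 'cV[C]_n) :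
  fro2 (rdiag e *m y) = \sum_i e i ^+ 2 * abs2 (y i 0).
Proof.
rewrite /rdiag mul_diag_mx fro2_cV; apply: eq_bigr => i _.
by rewrite !mxE abs2Zr.
Qed.

Lemma rdiag_adj n (e : 'I_n -> R) : (rdiag e)^t* = rdiag e.
Proof.
apply/matrixP => i j; rewrite !mxE eq_sym.
by case: eqP => [->|_]; rewrite ?mulr1n ?mulr0n ?rmorph0//; exact: realC_conj.
Qed.

Lemma wide_kernel m k (N : 'M[C]_(m, k)) : (m < k)%N ->
  exists2 x : 'cV[C]_k, x != 0 & N *m x = 0.
Proof.
move=> mk; have : kermx N^T != 0.
  rewrite kermx_eq0 /row_free mxrank_tr neq_ltn; apply/orP; left.
  by apply: leq_ltn_trans mk; exact: rank_leq_row.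
move=> /rowV0Pn[v vk v0]; exists v^T; first by rewrite trmx_eq0.
apply: trmx_inj; rewrite trmx_mul trmxK trmx0; exact/sub_kermxP.
Qed.

(** As a map on column vectors, the extension by zero of vectors indexed by [I];
    its transpose is the restriction to [I]. *)
Definition sel n (I : {pred 'I_n}) : 'M[C]_(n, #|I|) :=
  \matrix_(i, j) (i == enum_val j)%:R.

Lemma sel_notin n (I : {pred 'I_n}) (x : 'cV[C]_#|I|) i :
  i \notin I -> (sel I *m x) i 0 = 0.
Proof.
move=> iI; rewrite mxE big1// => j _; rewrite mxE.
by case: eqP iI => [->|_ _]; rewrite ?enum_valP// mul0r.
Qed.

Lemma sel_tr n (I : {pred 'I_n}) (y : 'cV[C]_n) j :
  ((sel I)^T *m y) j 0 = y (enum_val j) 0.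
Proof.
rewrite mxE (bigD1 (enum_val j))//= big1 ?addr0; first by rewrite !mxE eqxx mul1r.
by move=> i ij; rewrite !mxE (negPf ij) mul0r.
Qed.

Lemma sel_val n (I : {pred 'I_n}) (x : 'cV[C]_#|I|) j :
  (sel I *m x) (enum_val j) 0 = x j 0.
Proof.
rewrite mxE (bigD1 j)//= big1 ?addr0; first by rewrite mxE eqxx mul1r.
by move=> i ij; rewrite mxE (inj_eq enum_val_inj) eq_sym (negPf ij) mul0r.
Qed.

Lemma sel_inj n (I : {pred 'I_n}) (x : 'cV[C]_#|I|) : sel I *m x = 0 -> x = 0.
Proof.
move=> h; apply/matrixP => j a; rewrite ord1 mxE -(sel_val x j) h.
by rewrite mxE.
Qed.

Lemma fro2_gt0 m n (x : 'M[C]_(m, n)) : x != 0 -> 0 < fro2 x.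
Proof.
move=> x0; rewrite lt_def fro2_ge0 andbT; apply: contra x0 => /eqP h.
by apply/eqP; exact: fro2_eq0.
Qed.

Section SpectralCount.
Variables (n : nat) (U H : 'M[C]_n) (e : 'I_n -> R).
Hypothesis UU : U \is unitarymx.
Hypothesis HE : H = U^t* *m rdiag e *m U.

Let qE (x : 'cV[C]_n) : ip x (H *m x) = \sum_i e i * abs2 ((U *m x) i 0).
Proof. by rewrite HE -!mulmxA ip_adjl trmxCK ip_rdiag. Qed.

Let fE (x : 'cV[C]_n) : fro2 x = \sum_i abs2 ((U *m x) i 0).
Proof. by rewrite -fro2_cV fro2_isoml// unitaryK. Qed.

(** Courant-Fischer: were [k] larger than the number of eigenvalues above [z],
    the range of [W] would contain a vector orthogonal to all their
    eigenvectors. *)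
Lemma count_gt_lower k (W : 'M[C]_(n, k)) (z : R) :
  (forall x : 'cV[C]_k, x != 0 -> z * fro2 (W *m x) < ip (W *m x) (H *m (W *m x))) ->
  (k <= #|[pred i | (z < e i)%R]|)%N.
Proof.
move=> pos; rewrite leqNgt; apply/negP => lt.
have [x x0 hx] := wide_kernel ((sel [pred i | z < e i])^T *m (U *m W)) lt.
have := pos x x0; rewrite qE fE mulr_sumr ltNge => /negP; apply.
apply: ler_sum => i _; have [zi|iz] := ltP z (e i); last first.
  by rewrite ler_wpM2r// abs2_ge0.
suff -> : (U *m (W *m x)) i 0 = 0 by rewrite /abs2 /= expr0n addr0 !mulr0.
have iI : i \in [pred i | z < e i] by [].
have hx' : (sel [pred i | z < e i])^T *m (U *m (W *m x)) = 0.
  by rewrite -hx !mulmxA.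
by rewrite -(enum_rankK_in iI iI) -sel_tr hx' mxE.
Qed.

(** Were there more than [k] eigenvalues above [z], some combination of their
    eigenvectors would be in the kernel of [D]. *)
Lemma count_gt_upper k (D : 'M[C]_(k, n)) (z : R) :
  (forall x : 'cV[C]_n, D *m x = 0 -> ip x (H *m x) <= z * fro2 x) ->
  (#|[pred i | (z < e i)%R]| <= k)%N.
Proof.
move=> neg; rewrite leqNgt; apply/negP => lt.
set I := [pred i | z < e i] in lt.
have [x x0 hx] := wide_kernel (D *m U^t* *m sel I) lt.
pose y := U^t* *m (sel I *m x).
have Uy : U *m y = sel I *m x by rewrite /y mulmxA (unitarymxP UU) mul1mx.
have := neg y; rewrite /y !mulmxA hx => /(_ erefl); rewrite -!mulmxA -/y.
rewrite leNgt => /negP; apply; rewrite qE fE Uy mulr_sumr.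
have s0 : sel I *m x != 0 by apply: contra x0 => /eqP/sel_inj ->.
have : 0 < \sum_i abs2 ((sel I *m x) i 0) by rewrite -fro2_cV fro2_gt0.
rewrite -subr_gt0 => sp; rewrite -subr_gt0 -sumrB.
have le0 i : 0 <= e i * abs2 ((sel I *m x) i 0) - z * abs2 ((sel I *m x) i 0).
  have [iI|iI] := boolP (i \in I); last by rewrite sel_notin// /abs2 /= expr0n addr0 !mulr0 subr0.
  by rewrite -mulrBl mulr_ge0 ?abs2_ge0// subr_ge0 ltW.
rewrite lt_def sumr_ge0 ?andbT//; apply: contraL sp => /eqP h.
rewrite subr0 lt_def negb_and; apply/orP; left; rewrite negbK.
apply/eqP; apply: big1 => i _.
have [iI|iI] := boolP (i \in I); last by rewrite sel_notin// /abs2 /= expr0n addr0.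
have /eqP := h; rewrite psumr_eq0// => /allP/(_ i).
rewrite mem_index_enum => /(_ isT) /=; rewrite -mulrBl mulf_eq0 subr_eq0.
by move: iI; rewrite inE => /gt_eqF -> /= /eqP.
Qed.

End SpectralCount.

(* The inner products and squared norms met in the two counts below are variables
   here, so that only real arithmetic remains. *)
Lemma lower_arith (T th0 Th eps s a b c d : R) :
  0 < (T * T * th0 - 2 * T * Th * eps - Th * (eps * eps) - T - eps) * (s * s) ->
  T * (T * (th0 * (s * s))) <= T * (T * b) ->
  - (T * (eps * s * (Th * s))) <= T * c ->
  a <= eps * s * s -> - (eps * s * (Th * (eps * s))) <= d ->
  T * (s * s) + a < T * (T * b) + T * c + (T * c + d).
Proof. lra. Qed.

Lemma upper_arith (T th1 eps s c z : R) : c * T = 1 -> forall a b d e g h,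
  b <= th1 * (s * s) -> c * c * d <= c * c * (s * (eps * s)) ->
  (th1 + c * c * eps) * (s * s) <= c * (s * s) ->
  a - c * (z * g - s * s) +
    (- (c * (z * g - s * s)) - - (c * (c * (z * h - (T * (s * s) + d))))) <=
  z * (e - 2 * (c * g) + c * c * h) ->
  a + b <= z * e.
Proof.
move=> cT a b d e g h h1 h2 h3 h4.
have E : c * (c * (T * (s * s))) = c * (s * s) by rewrite -[RHS]mul1r -cT; ring.
lra.
Qed.

Section Perturbation.
Variables (n r : nat) (Y G : 'M[C]_n) (B : 'M[C]_(n, r)) (th : 'I_r -> R).
Variables (z T eps : R).
Hypothesis Yh : Y^t* = Y.
Hypothesis GE : (z%:C%:M - Y) *m G = 1%:M.
Hypothesis Yz : forall x : 'cV[C]_n, ip x (Y *m x) <= z * fro2 x.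
Hypothesis T0 : 0 < T.
Hypothesis eps0 : 0 <= eps.
Let K := B^t* *m G *m B.
Hypothesis KT : forall x : 'cV[C]_r,
  fro2 (K *m x - T%:C *: x) <= eps ^+ 2 * fro2 x.
Let H := Y + B *m rdiag th *m B^t*.

Let YG m (x : 'M[C]_(n, m)) : Y *m (G *m x) = z%:C *: (G *m x) - x.
Proof.
have := congr1 (fun M => M *m x) GE; rewrite mul1mx -mulmxA mulmxBl mul_scalar_mx.
move=> h; apply/eqP; rewrite eq_sym subr_eq addrC -subr_eq; exact/eqP.
Qed.

Let norm_ip_le m (x y : 'cV[C]_m) (a b : R) : 0 <= a -> 0 <= b ->
  fro2 x <= a ^+ 2 -> fro2 y <= b ^+ 2 -> `|ip x y| <= a * b.
Proof.
move=> a0 b0 xa yb; rewrite -(@ler_pXn2r _ 2) ?nnegrE ?normr_ge0 ?mulr_ge0//.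
rewrite real_normK ?num_real// exprMn; apply: le_trans (ip_CS _ _) _.
by rewrite ler_pM ?fro2_ge0.
Qed.

Let KxE (x : 'cV[C]_r) (s : R) : 0 <= s -> fro2 x = s ^+ 2 ->
  exists2 f : 'cV[C]_r, K *m x = T%:C *: x + f & fro2 f <= (eps * s) ^+ 2.
Proof.
move=> s0 xs; exists (K *m x - T%:C *: x); first by rewrite addrC subrK.
by rewrite exprMn -xs; exact: KT.
Qed.

(** On test vectors [G B x] the form [H - z] becomes [K th K - K], where [K] is
    close to the scalar [T]. Hence it is close to [T (T th - 1)], which is
    positive for [x] supported on the spikes [th] larger than [1 / T]. *)
Lemma perturbation_count_lower (U : 'M[C]_n) (e : 'I_n -> R)
    (I : {pred 'I_r}) (th0 Th : R) :
  U \is unitarymx -> H = U^t* *m rdiag e *m U -> 0 <= Th ->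
  (forall i, i \in I -> th0 <= th i) -> (forall i, `|th i| <= Th) ->
  0 < T ^+ 2 * th0 - 2 * T * Th * eps - Th * eps ^+ 2 - T - eps ->
  (#|I| <= #|[pred i | (z < e i)%R]|)%N.
Proof.
move=> UU HE Th0 thI thT pos.
apply: (count_gt_lower UU HE (W := G *m B *m sel I)) => x x0.
pose v := sel I *m x; have v0 : v != 0 by apply: contra x0 => /eqP/sel_inj ->.
pose s := Num.sqrt (fro2 v).
have s0 : 0 < s by rewrite sqrtr_gt0 fro2_gt0.
have fv : fro2 v = s ^+ 2 by rewrite sqr_sqrtr ?fro2_ge0.
have [f KvE ff] := KxE (ltW s0) fv.
have -> : G *m B *m sel I *m x = G *m (B *m v) by rewrite !mulmxA.
have -> : ip (G *m (B *m v)) (H *m (G *m (B *m v))) =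
    z * fro2 (G *m (B *m v)) - ip (K *m v) v + ip (K *m v) (rdiag th *m (K *m v)).
  have KvB : B^t* *m (G *m (B *m v)) = K *m v by rewrite /K !mulmxA.
  have e1 : ip (G *m (B *m v)) (Y *m (G *m (B *m v))) =
      z * fro2 (G *m (B *m v)) - ip (K *m v) v.
    by rewrite YG ipDr ipNr ipZr (ip_adjl _ B) KvB.
  have e2 : ip (G *m (B *m v)) (B *m rdiag th *m B^t* *m (G *m (B *m v))) =
      ip (K *m v) (rdiag th *m (K *m v)).
    by rewrite -!(mulmxA B) ip_adjl KvB -(mulmxA (rdiag th)) KvB.
  by rewrite mulmxDl ipDr e1 e2.
rewrite -addrA ltrDl addrC subr_gt0.
have es0 : 0 <= eps * s by rewrite mulr_ge0// ltW.
have dT (y : 'cV[C]_r) a : fro2 y <= a ^+ 2 -> fro2 (rdiag th *m y) <= (Th * a) ^+ 2.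
  move=> ya; rewrite fro2_rdiag exprMn; apply: (@le_trans _ _ (Th ^+ 2 * fro2 y)).
    rewrite fro2_cV mulr_sumr; apply: ler_sum => i _; rewrite ler_wpM2r ?abs2_ge0//.
    by rewrite -[th i ^+ 2]real_normK ?num_real// lerXn2r ?nnegrE.
  by rewrite ler_wpM2l ?sqr_ge0.
have sv : th0 * s ^+ 2 <= ip v (rdiag th *m v).
  rewrite -fv ip_rdiag fro2_cV mulr_sumr; apply: ler_sum => i _.
  have [iI|iI] := boolP (i \in I); first by rewrite ler_wpM2r ?abs2_ge0 ?thI.
  by rewrite /v sel_notin// /abs2 /= expr0n addr0 !mulr0.
have fv' : fro2 v <= s ^+ 2 by rewrite fv.
have b1 : `|ip f v| <= eps * s * s by exact: norm_ip_le (ltW s0) ff fv'.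
have b2 : `|ip f (rdiag th *m v)| <= eps * s * (Th * s).
  by apply: norm_ip_le => //; [rewrite mulr_ge0// ltW | exact: dT].
have b3 : `|ip f (rdiag th *m f)| <= eps * s * (Th * (eps * s)).
  by apply: norm_ip_le => //; [rewrite mulr_ge0 | exact: dT].
rewrite KvE mulmxDr -scalemxAr.
rewrite [ip _ v]ipDl ipZl [X in _ < X]ipDl !ipDr !ipZl !ipZr.
have sym : ip v (rdiag th *m f) = ip f (rdiag th *m v).
  by rewrite ip_adjl rdiag_adj ipC.
rewrite sym -/(fro2 v) fv.
have q0 : 0 < (T ^+ 2 * th0 - 2 * T * Th * eps - Th * eps ^+ 2 - T - eps) * s ^+ 2.
  by rewrite mulr_gt0// exprn_gt0.
have c1 : T * (T * (th0 * s ^+ 2)) <= T * (T * ip v (rdiag th *m v)).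
  by rewrite !ler_pM2l.
have c2 : - (T * (eps * s * (Th * s))) <= T * ip f (rdiag th *m v).
  by rewrite -mulrN ler_pM2l// lerNl; move: b2; rewrite ler_norml lerNl => /andP[].
move: b1 b3; rewrite !ler_norml => /andP[_ b1] /andP[b3 _].
move: q0 c1 c2 b1 b3; rewrite !expr2.
move: (ip f v) (ip v _) (ip f (rdiag th *m v)) (ip f (rdiag th *m f)).
exact: lower_arith.
Qed.

(** Consider vectors [x] such that [y = B^* x] vanishes on [I], so that only the
    other spikes act on them. Expanding the nonnegative form [z - Y] at
    [x - c G B y], with [c = 1 / T], yields [<x, (z - Y) x> >= c |y|^2] up to
    the error of [K], and this absorbs the spikes [th] smaller than [1 / T]. *)
Lemma perturbation_count_upper (U : 'M[C]_n) (e : 'I_n -> R)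
    (I : {pred 'I_r}) (th1 : R) :
  U \is unitarymx -> H = U^t* *m rdiag e *m U ->
  (forall i, i \notin I -> th i <= th1) -> th1 + eps / T ^+ 2 <= T^-1 ->
  (#|[pred i | (z < e i)%R]| <= #|I|)%N.
Proof.
move=> UU HE thI bnd.
apply: (count_gt_upper UU HE (D := (sel I)^T *m B^t*)) => x Dx.
pose y := B^t* *m x.
have yI i : i \in I -> y i 0 = 0.
  move=> iI; rewrite -(enum_rankK_in iI iI) -sel_tr mulmxA Dx; by rewrite mxE.
pose s := Num.sqrt (fro2 y).
have s0 : 0 <= s by exact: sqrtr_ge0.
have fy : fro2 y = s ^+ 2 by rewrite sqr_sqrtr ?fro2_ge0.
have fy' : fro2 y <= s ^+ 2 by rewrite fy.
have [f KyE ff] := KxE s0 fy.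
have b1 : `|ip y f| <= s * (eps * s) by apply: norm_ip_le => //; rewrite mulr_ge0.
have ty : ip y (rdiag th *m y) <= th1 * s ^+ 2.
  rewrite -fy ip_rdiag fro2_cV mulr_sumr; apply: ler_sum => i _.
  have [iI|iI] := boolP (i \in I); last by rewrite ler_wpM2r ?abs2_ge0 ?thI.
  by rewrite yI// /abs2 /= expr0n addr0 !mulr0.
have -> : ip x (H *m x) = ip x (Y *m x) + ip y (rdiag th *m y).
  by rewrite mulmxDl ipDr -!mulmxA [X in _ + X]ip_adjl.
pose c := T^-1; pose g := G *m (B *m y).
have c0 : 0 < c by rewrite invr_gt0.
have Yg : Y *m g = z%:C *: g - B *m y by rewrite /g YG.
have xB : ip x (B *m y) = s ^+ 2 by rewrite ip_adjl -/y -fy.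
have gB : ip g (B *m y) = T * s ^+ 2 + ip y f.
  rewrite ip_adjl /g (_ : B^t* *m (G *m (B *m y)) = K *m y); last first.
    by rewrite /K !mulmxA.
  by rewrite KyE ipDl ipZl -fy (ipC f).
have gY : ip g (Y *m x) = ip x (Y *m g) by rewrite ip_adjl Yh ipC.
have := Yz (x - c%:C *: g).
rewrite mulmxBr -scalemxAr fro2B fro2Z ipDl !ipDr !ipNl !ipNr !ipZl !ipZr gY Yg.
rewrite !ipDr !ipNr !ipZr xB gB -/(fro2 g).
move: b1; rewrite ler_norml => /andP[_ b1].
have cT : c * T = 1 by rewrite mulVf// gt_eqF.
have bc : th1 + c ^+ 2 * eps <= c.
  by move: bnd; rewrite -/c (_ : eps / T ^+ 2 = c ^+ 2 * eps)// /c exprVn mulrC.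
have c2 : c ^+ 2 * ip y f <= c ^+ 2 * (s * (eps * s)).
  by rewrite ler_wpM2l ?sqr_ge0.
have s2 : (th1 + c ^+ 2 * eps) * s ^+ 2 <= c * s ^+ 2.
  by rewrite ler_wpM2r ?sqr_ge0.
move: ty c2 s2; rewrite !expr2.
move: (ip x (Y *m x)) (ip y (rdiag th *m y)) (ip y f) (fro2 x) (ip x g) (fro2 g).
exact: upper_arith cT.
Qed.

End Perturbation.
End Counting.

(** * Spectral decomposition of the perturbation *)

Section SpikeFrame.
Variable R : realType.
Notation C := R[i].

Lemma herm_adj n (M : 'M[C]_n) : M \is hermsymmx -> M^t* = M.
Proof.
by move=> /is_hermitianmxP h; rewrite [RHS]h expr0 scale1r.
Qed.

Lemma adj_herm n (M : 'M[C]_n) : M^t* = M -> M \is hermsymmx.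
Proof. by move=> h; apply/is_hermitianmxP; rewrite expr0 scale1r h. Qed.

(** The columns of [V] are unit eigenvectors of [P] for the non-zero
    eigenvalues, listed in the order of [th]; the other eigenvectors do not
    contribute to the spectral decomposition. *)
Lemma frame_exists n r (P : 'M[C]_n) (th : 'I_r -> R) : (0 < r)%N ->
  P \is hermsymmx -> (forall i, th i != 0) ->
  perm_eq [seq z <- eigenvalues P | z != 0] [seq (th i)%:C | i <- enum 'I_r] ->
  exists V : 'M[C]_(n, r), V^t* *m V = 1%:M /\ P = V *m rdiag th *m V^t*.
Proof.
move=> r0 Ph th0 Pth.
pose U := spectralmx P; pose dC i : C := (evals P i)%:C.
pose L := [seq i <- enum 'I_n | dC i != 0].
have pL : perm_eq [seq (th i)%:C | i <- enum 'I_r] [seq dC i | i <- L].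
  rewrite -(permPl Pth).
  apply: perm_trans (perm_filter _ (eigenvalues_herm Ph)) _.
  by rewrite filter_map.
have szL : size L = r by have := perm_size pL; rewrite size_map size_enum_ord size_map => <-.
have [x0 _] : exists x0 : 'I_n, true.
  by case: {pL} L szL => [/eqP|x ? _]; [rewrite eq_sym -leqn0 leqNgt r0 | exists x].
have /(perm_iotaP 0)[Is pIs sE] := pL.
pose L' := [seq nth x0 L j | j <- Is].
have pL' : perm_eq L' L.
  rewrite -[X in perm_eq _ X](mkseq_nth x0) perm_map//.
  by rewrite (perm_trans pIs)// size_map.
have mL' : [seq dC i | i <- L'] = [seq (th i)%:C | i <- enum 'I_r].
  rewrite sE -map_comp; apply/eq_in_map => j jI /=.
  have jL : (j < size L)%N by have := perm_mem pIs j; rewrite jI mem_iota size_map.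
  by rewrite (nth_map x0).
have szL' : size L' = r by rewrite (perm_size pL').
pose f (i : 'I_r) : 'I_n := nth x0 L' i.
have uL' : uniq L' by rewrite (perm_uniq pL') filter_uniq// enum_uniq.
have finj i j : (f i == f j) = (i == j).
  by rewrite /f nth_uniq ?szL'.
have df i : dC (f i) = (th i)%:C.
  have := congr1 (fun s => nth 0 s i) mL'; rewrite (nth_map x0) ?szL'//.
  by rewrite (nth_map i) ?size_enum_ord// nth_ord_enum.
have fL' : [seq f i | i <- enum 'I_r] = L'.
  apply: (@eq_from_nth _ x0); first by rewrite size_map size_enum_ord.
  move=> k; rewrite size_map size_enum_ord => kr.
  by rewrite (nth_map (Ordinal kr)) ?size_enum_ord// /f nth_enum_ord.
exists (\matrix_(a, i) (U^t*) a (f i)); split.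
  apply/matrixP => i j.
  have h : (U *m U^t*) (f i) (f j) = (f i == f j)%:R by rewrite spectralKV mxE.
  rewrite [RHS]mxE -finj -h !mxE; apply: eq_bigr => a _.
  by rewrite !mxE conjCK.
rewrite -[LHS](fcalc_id Ph); apply/matrixP => a b.
rewrite /fcalc -/U -mulmxA mul_diag_mx mxE.
transitivity (\sum_(m <- L') (U^t*) a m * (dC m * U m b)).
  rewrite (perm_big _ pL') big_filter [RHS]big_mkcond [RHS]big_enum /=.
  apply: eq_bigr => m _; rewrite !mxE -/(dC m).
  by case: eqP => //= ->; rewrite mul0r mulr0.
rewrite -fL' big_map big_enum -mulmxA /rdiag mul_diag_mx mxE /=.
by apply: eq_bigr => i _; rewrite !mxE df conjCK.
Qed.

(** Bessel's inequality. *)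
Lemma isometry_adj_le n r (V : 'M[C]_(n, r)) p (u : 'M[C]_(n, p)) : V^t* *m V = 1%:M ->
  fro2 (V^t* *m u) <= fro2 u.
Proof.
move=> VV; have := fro2_ge0 (u - V *m (V^t* *m u)).
have e : ip u (V *m (V^t* *m u)) = fro2 (V^t* *m u) by rewrite ip_adjl.
rewrite fro2B e fro2_isoml//.
by move: (fro2 u) (fro2 (V^t* *m u)) => x y; lra.
Qed.

Lemma fro2_isometry n r (V : 'M[C]_(n, r)) : V^t* *m V = 1%:M -> fro2 V = r%:R.
Proof.
move=> VV; rewrite fro2_trace VV mxtrace1.
by rewrite (_ : r%:R = (r%:R : R)%:C :> C) // rmorph_nat.
Qed.

(** * Projections on the eigenspaces of the perturbation *)

Lemma vnorm_fro2 n (x : 'cV[C]_n) : vnorm x = Num.sqrt (fro2 x).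
Proof. by rewrite /vnorm dotmxE -fro2_tr /fro2 /ip trace_mx11. Qed.

(** Both projections are the identity on the row space and vanish on its
    orthogonal. *)
Lemma proj_ortho_unique n (Q F : 'M[C]_n) : Q^t* = Q -> Q *m Q = Q ->
  (Q :=: F)%MS -> proj_ortho F = Q.
Proof.
move=> Qh QQ QF.
have QP : Q *m proj_ortho F = Q by rewrite proj_ortho_id ?QF.
have QP' : (1%:M - Q) *m proj_ortho F = 0.
  rewrite proj_ortho_0// -(eqmx_ortho _ QF) orthomx1E Qh mulmxBl mul1mx QQ.
  by rewrite subrr.
by move: QP'; rewrite mulmxBl mul1mx QP => /eqP; rewrite subr_eq0 => /eqP.
Qed.

Section EigenProjections.
Variables (n r : nat) (P : 'M[C]_n) (V : 'M[C]_(n, r)) (th : 'I_r -> R).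
Hypothesis VV : V^t* *m V = 1%:M.
Hypothesis PE : P = V *m rdiag th *m V^t*.

(** The orthogonal projection on the span of the columns of [V] with index in
    [J], transposed since subspaces are row spaces. *)
Definition frame_proj (J : pred 'I_r) : 'M[C]_n :=
  (V *m rdiag (fun i => (J i)%:R) *m V^t*)^T.

Lemma rdiagM (e f : 'I_r -> R) : rdiag e *m rdiag f = rdiag (fun i => e i * f i).
Proof.
rewrite /rdiag mulmx_diag; congr diag_mx; apply/rowP => i.
by rewrite !mxE rmorphM.
Qed.

Lemma frame_mul (e f : 'I_r -> R) :
  (V *m rdiag e *m V^t*) *m (V *m rdiag f *m V^t*) =
  V *m rdiag (fun i => e i * f i) *m V^t*.
Proof.
rewrite -rdiagM !mulmxA -(mulmxA _ (V^t*) V) VV mulmx1.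
by rewrite -!mulmxA.
Qed.

Lemma frame_projM J J' : frame_proj J *m frame_proj J' =
  frame_proj (fun i => J i && J' i).
Proof.
rewrite /frame_proj -trmx_mul frame_mul.
apply: (congr1 (fun e => (V *m rdiag e *m V^t*)^T)).
by apply/funext => i; rewrite /= -natrM mulnb andbC.
Qed.

Lemma frame_proj_adj J : (frame_proj J)^t* = frame_proj J.
Proof.
have : (V *m rdiag (fun i => (J i)%:R) *m V^t*)^t* =
    V *m rdiag (fun i => (J i)%:R) *m V^t*.
  by rewrite !adjM rdiag_adj trmxCK mulmxA.
rewrite /frame_proj; move: (V *m _ *m _) => M Mh.
by rewrite -{2}Mh; apply/matrixP => i j; rewrite !mxE.
Qed.

Lemma frame_proj_norm J (u : 'cV[C]_n) (F : 'M[C]_n) : (frame_proj J :=: F)%MS ->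
  proj_norm u F = Num.sqrt (\sum_(i | J i) abs2 ((V^t* *m u) i 0)).
Proof.
move=> JF; rewrite /proj_norm vnorm_fro2 (proj_ortho_unique _ _ JF); last 2 first.
- exact: frame_proj_adj.
- by rewrite frame_projM; congr frame_proj; apply/funext => i; rewrite andbb.
congr Num.sqrt; rewrite trmx_mul trmxK /frame_proj trmxK -!mulmxA fro2_isoml//.
rewrite fro2_rdiag [RHS]big_mkcond; apply: eq_bigr => i _.
by case: (J i); rewrite ?expr1n ?mul1r// expr0n mul0r.
Qed.

Lemma cker_frame (t : R) : t != 0 ->
  (frame_proj (fun i => (th i == t)%B) :=: cker (t%:C%:M - P))%MS.
Proof.
move=> t0; apply/eqmxP/andP; split.
  apply/sub_kermxP; rewrite /frame_proj -trmx_mul mulmxBl mul_scalar_mx PE frame_mul.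
  rewrite scalemxAl scalemxAr -mulmxBl -mulmxBr.
  rewrite (_ : _ - _ = 0) ?mulmx0 ?mul0mx ?trmx0//.
  apply/matrixP => i j; rewrite !mxE; case: (i == j); rewrite ?mulr0n ?mulr0 ?subrr//.
  rewrite !mulr1n; case: eqP => [->|_]; first by rewrite !mulr1 subrr.
  by rewrite !mulr0 subrr.
(* a vector of the kernel is [P x / t], hence in the span of the frame *)
apply/rV_subP => v /sub_kermxP h.
have tv : t%:C *: v^T = P *m v^T.
  have := congr1 trmx h; rewrite trmx_mul trmxK trmx0 mulmxBl mul_scalar_mx.
  by move/eqP; rewrite subr_eq0 => /eqP.
have tC : t%:C != 0 :> C by rewrite fmorph_eq0.
pose y := V^t* *m v^T.
have yE : t%:C *: y = rdiag th *m y.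
  by rewrite /y scalemxAr tv PE !mulmxA VV mul1mx.
have vE : v^T = V *m y.
  apply: (scalerI tC); rewrite tv PE -!mulmxA -/y -yE.
  by rewrite -scalemxAr.
suff -> : v = v *m frame_proj (fun i => th i == t) by exact: submxMl.
apply: trmx_inj; move: (y) yE vE => {}y yE vE.
rewrite trmx_mul trmxK vE -!mulmxA (mulmxA _ V) VV mul1mx.
apply: (congr1 (mulmx V)).
apply/matrixP => i a; rewrite /rdiag mul_diag_mx !mxE.
have [_|ti] := eqVneq (th i) t; first by rewrite mul1r.
have /matrixP /(_ i a) := yE; rewrite /rdiag mul_diag_mx !mxE => /eqP.
rewrite -subr_eq0 -mulrBl mulf_eq0 -rmorphB fmorph_eq0 subr_eq0 eq_sym (negPf ti) /=.
by move=> /eqP ->; rewrite mulr0.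
Qed.

Lemma sum_cker_frame (t0 : R) (s : seq R) : uniq s -> (forall t, t \in s -> t != 0) ->
  (forall i, th i \in s) ->
  (frame_proj (fun i => th i != t0) :=:
   \sum_(t <- s | t != t0) cker (t%:C%:M - P))%MS.
Proof.
move=> us s0 ths; apply/eqmxP/andP; split.
  have -> : frame_proj (fun i => th i != t0) =
      \sum_(t <- s | t != t0) frame_proj (fun i => th i == t).
    transitivity ((\sum_(t <- s | t != t0)
        V *m rdiag (fun i => (th i == t)%:R) *m V^t*)^T); last by rewrite raddf_sum.
    apply: (congr1 trmx); rewrite -mulmx_suml -mulmx_sumr.
    apply: (congr1 (fun D => V *m D *m V^t*)).
    apply/matrixP => i j; rewrite summxE; under eq_bigr do rewrite !mxE.
    rewrite !mxE; case: (i == j); last by rewrite !mulr0n big1.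
    rewrite !mulr1n big_mkcond (bigD1_seq (th i))//= big1 => [|t ti].
      by rewrite eqxx addr0; case: (th i == t0).
    by rewrite (eq_sym (th i)) (negPf ti); case: ifP.
  rewrite big_seq_cond; apply: (big_ind (fun M => (M <= _)%MS)).
  - exact: sub0mx.
  - by move=> A B; exact: addmx_sub.
  - move=> t /andP[ts tt0]; rewrite (cker_frame (s0 t ts)) big_mkcond (bigD1_seq t)//= tt0.
    exact: addsmxSl.
rewrite big_seq_cond; apply: (big_ind (fun M => (M <= _)%MS)).
- exact: sub0mx.
- by move=> A B hA hB; rewrite addsmx_sub hA.
move=> t /andP[ts tt0].
rewrite -(cker_frame (s0 t ts)).
have -> : frame_proj (fun i => th i == t) =
    frame_proj (fun i => th i == t) *m frame_proj (fun i => th i != t0).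
  rewrite frame_projM; congr frame_proj; apply/funext => i.
  by case: eqP => // ->; rewrite tt0.
exact: submxMl.
Qed.

End EigenProjections.
End SpikeFrame.

(** * The spiked matrix *)

Section SpikedMatrix.
Variable R : realType.
Notation C := R[i].

(** The integrand of the T-transform at [z] is the case [k = 1]. Squares occur
    in the norm of eigenvectors. *)
Definition tker (z : R) (k : nat) (t : R) : R := (t / (z - t)) ^+ k.

Definition compression n r (X : 'M[C]_n) (V : 'M[C]_(n, r)) (f : R -> R) : 'M[C]_r :=
  V^t* *m fcalc (fun t => (f t)%:C) X *m V.

Lemma sandwich_adj m p (B : 'M[C]_(m, p)) (D : 'M[C]_p) :
  (B *m D *m B^t*)^t* = B *m D^t* *m B^t*.
Proof. by rewrite !adjM trmxCK mulmxA. Qed.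

Lemma mulmx_regroup m p (A : 'M[C]_(p, m)) (Q N : 'M[C]_m) (D : 'M[C]_(m, p)) :
  A *m Q *m N *m (Q *m D) = A *m (Q *m N *m Q) *m D.
Proof. by rewrite !mulmxA. Qed.

Variables (n r : nat) (X P : 'M[C]_n) (V : 'M[C]_(n, r)) (th : 'I_r -> R).
Hypothesis Xh : X \is hermsymmx.
Hypothesis X0 : forall i, 0 <= evals X i.
Hypothesis PE : P = V *m rdiag th *m V^t*.

(* [X (1 + P) = S (S (1 + P))] has the same eigenvalues as the Hermitian matrix
   [S (1 + P) S = X + B th B^*]. *)
Let S := fcalc (fun t => (Num.sqrt t)%:C) X.

Let SS : S *m S = X.
Proof.
rewrite fcalcM -[RHS](fcalc_id Xh); apply: eq_fcalc => i.
by rewrite -rmorphM /= -expr2 sqr_sqrtr.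
Qed.

Let Sh : S^t* = S.
Proof. by rewrite fcalc_adj; apply: eq_fcalc => i; rewrite realC_conj. Qed.

Let B := S *m V.
Let H := X + B *m rdiag th *m B^t*.

Let HE : H = S *m (1%:M + P) *m S.
Proof.
rewrite mulmxDr mulmx1 mulmxDl SS; apply: (congr1 (+%R X)).
rewrite /B PE adjM Sh; move: (S) => Q.
by rewrite !mulmxA.
Qed.

Let Hh : H \is hermsymmx.
Proof.
by apply: adj_herm; rewrite /H adjD (herm_adj Xh) sandwich_adj rdiag_adj.
Qed.

Lemma spiked_eigenvalues :
  exists U e, [/\ U \is unitarymx, H = U^t* *m rdiag e *m U &
    perm_eq (eigenvalues (X *m (1%:M + P))) [seq (e i)%:C | i <- enum 'I_n]].
Proof.
exists (spectralmx H), (evals H); split.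
- exact: spectral_unitarymx.
- by rewrite -[LHS](fcalc_id Hh).
- have -> : X *m (1%:M + P) = S *m (S *m (1%:M + P)) by rewrite mulmxA SS.
  by rewrite eigenvalues_mulC -HE; exact: eigenvalues_herm.
Qed.

(* With [sg = -1], counting eigenvalues below [z] becomes counting eigenvalues of
   the opposite matrix above [- z]. *)
Section Sign.
Variables (sg z T eps : R).
Hypothesis sg2 : sg * sg = 1.
Hypothesis evz : forall i, sg * evals X i < sg * z.
Hypothesis T0 : 0 < sg * T.
Hypothesis eps0 : 0 <= eps.
Hypothesis KT : fro2 (compression X V (tker z 1) - T%:C%:M) <= eps ^+ 2.

Let Y := sg%:C *: X.
Let G := fcalc (fun t => sg%:C / (z%:C - t%:C)) X.

Let zt i : z%:C - (evals X i)%:C != 0 :> C.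
Proof.
rewrite -rmorphB fmorph_eq0 subr_eq0; apply: contraTneq (evz i) => ->.
by rewrite ltxx.
Qed.

Let Yh : Y^t* = Y.
Proof. by rewrite adjZ realC_conj (herm_adj Xh). Qed.

Let GE : ((sg * z)%:C%:M - Y) *m G = 1%:M.
Proof.
rewrite /Y -{1}(fcalc_id Xh) fcalcZ -(fcalc_cst _ X) fcalcB fcalcM -(fcalc_cst _ X).
apply: eq_fcalc => i; rewrite rmorphM /= -mulrBr mulrACA -rmorphM sg2.
by rewrite mul1r mulfV.
Qed.

Let Yz (x : 'cV[C]_n) : ip x (Y *m x) <= sg * z * fro2 x.
Proof.
have -> : Y = (spectralmx X)^t* *m rdiag (fun i => sg * evals X i) *m spectralmx X.
  rewrite /Y -{1}(fcalc_id Xh) fcalcZ.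
  apply: (congr1 (fun D => (spectralmx X)^t* *m diag_mx D *m spectralmx X)).
  by apply/rowP => i; rewrite !mxE rmorphM.
rewrite -!mulmxA ip_adjl trmxCK ip_rdiag.
rewrite -(fro2_isoml x (spectralK X)) fro2_cV mulr_sumr; apply: ler_sum => i _.
by rewrite ler_wpM2r ?abs2_ge0// ltW.
Qed.

(* The resolvent compressed by [B = S V] is the compression by [V] of the
   integrand [t / (z - t)]: this is how the T-transform enters. *)
Let KE : B^t* *m G *m B = sg%:C *: compression X V (tker z 1).
Proof.
rewrite /B adjM Sh /compression scalemxAl scalemxAr fcalcZ.
apply: etrans (mulmx_regroup _ _ _ _) _.
rewrite !fcalcM; apply: (congr1 (fun D => V^t* *m D *m V)).
apply: eq_fcalc => i.
have -> : (tker z 1 (evals X i))%:C = (evals X i)%:C / (z%:C - (evals X i)%:C).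
  by rewrite /tker expr1 -rmorphB -fmorphV -rmorphM.
move: (z%:C - _) => w.
have -> : (evals X i)%:C = (Num.sqrt (evals X i))%:C ^+ 2 :> C.
  by rewrite -rmorphXn /= sqr_sqrtr.
by move: (Num.sqrt _)%:C => q; ring.
Qed.

Let KT' (x : 'cV[C]_r) :
  fro2 (B^t* *m G *m B *m x - (sg * T)%:C *: x) <= eps ^+ 2 * fro2 x.
Proof.
rewrite KE -scalemxAl rmorphM /= -scalerA -scalerBr fro2Z expr2 sg2 mul1r.
rewrite -mul_scalar_mx -mulmxBl; apply: le_trans (fro2_mul _ _) _.
by rewrite ler_wpM2r// fro2_ge0.
Qed.

Let H' := Y + B *m rdiag (fun i => sg * th i) *m B^t*.

Let H'E (U : 'M[C]_n) (f : 'I_n -> R) : H = U^t* *m rdiag f *m U ->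
  H' = U^t* *m rdiag (fun i => sg * f i) *m U.
Proof.
have rZ m (g : 'I_m -> R) : rdiag (fun i => sg * g i) = sg%:C *: rdiag g.
  apply/matrixP => i j; rewrite !mxE.
  by case: (i == j); rewrite ?mulr1n ?mulr0n ?mulr0// rmorphM.
have sZ m p (A : 'M[C]_(p, m)) (D : 'M[C]_m) (F : 'M[C]_(m, p)) :
    A *m (sg%:C *: D) *m F = sg%:C *: (A *m D *m F).
  by rewrite -scalemxAr -scalemxAl.
by move=> h; rewrite rZ sZ -h /H' rZ sZ -scalerDr.
Qed.

Lemma spiked_count_lower (U : 'M[C]_n) (f : 'I_n -> R) (I : {pred 'I_r}) (th0 Th : R) :
  U \is unitarymx -> H = U^t* *m rdiag f *m U -> 0 <= Th ->
  (forall i, i \in I -> th0 <= sg * th i) -> (forall i, `|th i| <= Th) ->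
  `|sg| = 1 ->
  let T' := sg * T in
  0 < T' ^+ 2 * th0 - 2 * T' * Th * eps - Th * eps ^+ 2 - T' - eps ->
  (#|I| <= #|[pred i | (sg * z < sg * f i)%R]|)%N.
Proof.
move=> UU /H'E hf Th0 thI thT sg1 T' pos.
apply: (perturbation_count_lower GE T0 eps0 KT' UU hf Th0 thI _ pos).
by move=> i; rewrite normrM sg1 mul1r.
Qed.

Lemma spiked_count_upper (U : 'M[C]_n) (f : 'I_n -> R) (I : {pred 'I_r}) (th1 : R) :
  U \is unitarymx -> H = U^t* *m rdiag f *m U ->
  (forall i, i \notin I -> sg * th i <= th1) ->
  th1 + eps / (sg * T) ^+ 2 <= (sg * T)^-1 ->
  (#|[pred i | (sg * z < sg * f i)%R]| <= #|I|)%N.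
Proof.
move=> UU /H'E hf thI bnd.
exact: (perturbation_count_upper Yh GE Yz T0 eps0 KT' UU hf thI bnd).
Qed.

End Sign.
End SpikedMatrix.

Lemma card_ord_lt r m : (m <= r)%N -> #|[pred j : 'I_r | (j < m)%N]| = m.
Proof.
move=> mr; rewrite -sum1_card; transitivity (\sum_(j < r | (j < m)%N) 1)%N => //.
by rewrite -(big_ord_widen r (fun=> 1%N) mr) sum1_card card_ord.
Qed.

Lemma card_ord_ge r m : (m <= r)%N -> #|[pred j : 'I_r | (m <= j)%N]| = (r - m)%N.
Proof.
move=> mr; apply/eqP; rewrite -(eqn_add2l m) subnKC// -{1}(card_ord_lt mr).
rewrite -[X in _ == X]card_ord -(cardC [pred j : 'I_r | (j < m)%N]).
by apply/eqP; congr addn; apply: eq_card => j; rewrite !inE leqNgt.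
Qed.

(** * Location of the spiked eigenvalue *)

Section SpikeLocation.
Variable R : realType.
Notation C := R[i].
Variables (n r : nat) (X P : 'M[C]_n) (V : 'M[C]_(n, r)) (th : 'I_r -> R) (i0 : 'I_r).
Hypothesis rn : (r <= n)%N.
Hypothesis Xh : X \is hermsymmx.
Hypothesis X0 : forall i, 0 <= evals X i.
Hypothesis PE : P = V *m rdiag th *m V^t*.
Hypothesis th_noninc : forall i j : 'I_r, (i <= j)%N -> th j <= th i.
Variables (sg z T eps : R).
Hypothesis sg1 : sg = 1 \/ sg = -1.
Hypothesis evz : forall i, sg * evals X i < sg * z.
Hypothesis T0 : 0 < sg * T.
Hypothesis th0 : 0 < sg * th i0.
Hypothesis eps0 : 0 <= eps.
Hypothesis KT : fro2 (compression X V (tker z 1) - T%:C%:M) <= eps ^+ 2.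

Let l := spiked_eigenvalue th i0 (X *m (1%:M + P)).

Let sg2 : sg * sg = 1. Proof. by case: sg1 => ->; rewrite ?mulrNN mulr1. Qed.

Let i0n : (i0 < n)%N. Proof. exact: leq_trans rn. Qed.

(* the index, counted from 0, of the eigenvalue of a negative spike *)
Let kn : (n - r + i0 < n)%N.
Proof. by rewrite -[X in (_ < X)%N](subnK rn) ltn_add2l. Qed.

Let card_two (p q : pred 'I_n) : (forall i, p i -> ~~ q i) ->
  (#|[pred i | p i]| + #|[pred i | q i]| <= n)%N.
Proof.
move=> pq; rewrite -[X in (_ <= X)%N]card_ord -(cardC [pred i | p i]) leq_add2l.
apply: subset_leq_card; apply/fintype.subsetP => i; rewrite !inE => qi.
by apply/negP => /pq; rewrite qi.
Qed.

Let card_cover (p q : pred 'I_n) : (forall i, p i || q i) ->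
  (n <= #|[pred i | p i]| + #|[pred i | q i]|)%N.
Proof.
move=> pq; rewrite -[X in (X <= _)%N]card_ord -(cardC [pred i | p i]) leq_add2l.
apply: subset_leq_card; apply/fintype.subsetP => i; rewrite !inE => npi.
by have := pq i; rewrite (negPf npi).
Qed.

(** At least as many eigenvalues lie beyond [z] as there are spikes at least as
    far from [0] as [th i0], on the same side. *)
Lemma spiked_eigenvalue_lower (Th : R) : 0 <= Th -> (forall i, `|th i| <= Th) ->
  let T' := sg * T in
  0 < T' ^+ 2 * (sg * th i0) - 2 * T' * Th * eps - Th * eps ^+ 2 - T' - eps ->
  sg * z <= sg * l.
Proof.
move=> Th0 thT T' pos.
have [U [e [UU HE pe]]] := spiked_eigenvalues Xh X0 PE.
have sgn : `|sg| = 1 by case: sg1 => ->; rewrite ?normrN normr1.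
have low (I : {pred 'I_r}) (hI : forall i, i \in I -> sg * th i0 <= sg * th i) :=
  @spiked_count_lower _ _ _ _ _ _ Xh X0 sg z T eps sg2 evz T0 eps0 KT
  U e I (sg * th i0) Th UU HE Th0 hI thT sgn pos.
rewrite /l /spiked_eigenvalue.
have th0' := th0; case: sg1 => sE; rewrite sE in low th0' *.
  rewrite mul1r in th0'; rewrite th0' !mul1r; apply: ltW.
  rewrite (lambda_gt z pe i0n).
  have := low [pred j : 'I_r | (j < i0.+1)%N]; rewrite card_ord_lt// => h.
  apply: leq_trans (h _) _.
    by move=> i; rewrite inE ltnS !mul1r => /th_noninc.
  by apply: subset_leq_card; apply/fintype.subsetP => i; rewrite !inE !mul1r.
rewrite mulN1r oppr_gt0 in th0'; rewrite ltNge (ltW th0') /= !mulN1r lerN2 addnS.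
rewrite leNgt (lambda_gt z pe kn) -leqNgt.
have h2 : (r - i0 <= #|[pred i | (e i < z)%R]|)%N.
  have := low [pred j : 'I_r | (i0 <= j)%N]; rewrite card_ord_ge; last exact: ltnW.
  move=> h; apply: leq_trans (h _) _.
    by move=> i; rewrite inE !mulN1r lerN2 => /th_noninc.
  by apply: subset_leq_card; apply/fintype.subsetP => i; rewrite !inE !mulN1r ltrN2.
have h3 : (#|[pred i | (z < e i)%R]| + #|[pred i | (e i < z)%R]| <= n)%N.
  apply: (@card_two (fun i => z < e i) (fun i => e i < z)).
  by move=> i zi; rewrite -leNgt ltW.
rewrite -(leq_add2r (r - i0)) -addnA subnKC ?subnK//; last exact: ltnW.
by apply: leq_trans h3; rewrite leq_add2l.
Qed.

(** On the side of [th i0], only spikes farther from [0] than [th i0] can exceed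
    [1 / T] in absolute value, and these are too few to push the eigenvalue
    beyond [z]. *)
Lemma spiked_eigenvalue_upper :
  sg * th i0 + eps / (sg * T) ^+ 2 <= (sg * T)^-1 ->
  sg * l <= sg * z.
Proof.
move=> bnd.
have [U [e [UU HE pe]]] := spiked_eigenvalues Xh X0 PE.
have up (I : {pred 'I_r}) (hI : forall i, i \notin I -> sg * th i <= sg * th i0) :=
  @spiked_count_upper _ _ _ _ _ _ Xh X0 sg z T eps sg2 evz T0 eps0 KT
  U e I (sg * th i0) UU HE hI bnd.
rewrite /l /spiked_eigenvalue.
have th0' := th0; case: sg1 => sE; rewrite sE in up th0' *.
  rewrite mul1r in th0'; rewrite th0' !mul1r.
  rewrite leNgt (lambda_gt z pe i0n) -leqNgt.
  have := up [pred j : 'I_r | (j < i0)%N]; rewrite card_ord_lt; last exact: ltnW.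
  move=> h; apply: leq_trans (h _).
    by apply: subset_leq_card; apply/fintype.subsetP => i; rewrite !inE !mul1r.
  by move=> i; rewrite inE -leqNgt !mul1r => /th_noninc.
rewrite mulN1r oppr_gt0 in th0'; rewrite ltNge (ltW th0') /= !mulN1r lerN2 addnS.
have mn := kn; set m := (n - r + i0)%N in mn *.
rewrite leNgt; apply/negP => lz.
have h1 : (#|[pred i | (lambda m.+1 (X *m (1%:M + P)) < e i)%R]| <= m)%N.
  by rewrite leqNgt -(lambda_gt _ pe mn) ltxx.
have h2 : (#|[pred i | (e i < z)%R]| <= r - i0.+1)%N.
  have := up [pred j : 'I_r | (i0.+1 <= j)%N]; rewrite card_ord_ge//.
  move=> h; apply: leq_trans (h _).
    by apply: subset_leq_card; apply/fintype.subsetP => i; rewrite !inE !mulN1r ltrN2.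
  by move=> i; rewrite inE -leqNgt !mulN1r lerN2 => /th_noninc.
have h3 : (n <= #|[pred i | (lambda m.+1 (X *m (1%:M + P)) < e i)%R]| +
    #|[pred i | (e i < z)%R]|)%N.
  apply: (@card_cover (fun i => lambda m.+1 (X *m (1%:M + P)) < e i) (fun i => e i < z)).
  by move=> i; case: ltP => //= /le_lt_trans; apply.
have := leq_trans h3 (leq_add h1 h2).
have e1 : (m + (r - i0.+1)).+1 = n by rewrite /m -addnA -addnS -addnS -addSnnS subnKC// subnK.
by rewrite -{1}e1 ltnn.
Qed.

End SpikeLocation.

(** * Eigenvectors of the spiked matrix *)

Section SpikeEigenvector.
Variable R : realType.
Notation C := R[i].
Variables (n r : nat) (X P : 'M[C]_n) (V : 'M[C]_(n, r)) (th : 'I_r -> R).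
Hypothesis Xh : X \is hermsymmx.
Hypothesis VV : V^t* *m V = 1%:M.
Hypothesis PE : P = V *m rdiag th *m V^t*.
Variables (l : R) (u : 'cV[C]_n).
Hypothesis u1 : fro2 u = 1.
Hypothesis eigu : X *m (1%:M + P) *m u = l%:C *: u.
Hypothesis evl : forall i, evals X i != l.

Let w := V^t* *m u.

(** The eigenvalue equation reads [(l - X) u = X P u]. *)
Lemma eigenvector_resolvent :
  u = fcalc (fun t => (tker l 1 t)%:C) X *m (V *m (rdiag th *m w)).
Proof.
have lt i : l%:C - (evals X i)%:C != 0 :> C.
  by rewrite -rmorphB fmorph_eq0 subr_eq0 eq_sym.
have e1 : (l%:C%:M - X) *m u = X *m (V *m (rdiag th *m w)).
  rewrite mulmxBl mul_scalar_mx -eigu mulmxDr mulmx1 mulmxDl addrAC subrr add0r.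
  by rewrite PE /w !mulmxA.
have e2 : fcalc (fun t => (l%:C - t%:C)^-1) X *m (l%:C%:M - X) = 1%:M.
  rewrite -[X in _ - X](fcalc_id Xh) -(fcalc_cst _ X) fcalcB fcalcM -(fcalc_cst _ X).
  by apply: eq_fcalc => i; rewrite mulVf.
have e3 : fcalc (fun t => (l%:C - t%:C)^-1) X *m X = fcalc (fun t => (tker l 1 t)%:C) X.
  rewrite -[X in _ *m X](fcalc_id Xh) fcalcM.
  by apply: eq_fcalc => i; rewrite /tker expr1 rmorphM fmorphV rmorphB mulrC.
by rewrite -e3 -mulmxA -e1 mulmxA e2 mul1mx.
Qed.

(** The coordinates of the eigenvector in the frame solve a linear system of
    fixed size [r]. *)
Lemma eigenvector_frame : w = compression X V (tker l 1) *m (rdiag th *m w).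
Proof. by rewrite {1}/w {1}eigenvector_resolvent /compression !mulmxA. Qed.

(** Insert the formula for [u] in [<u, u> = 1]; the function of [X] in it is
    real, so its square appears. *)
Lemma eigenvector_norm :
  ip (rdiag th *m w) (compression X V (tker l 2) *m (rdiag th *m w)) = 1.
Proof.
rewrite -u1 [in RHS]eigenvector_resolvent; move: (rdiag th *m w) => y.
have fE : (fcalc (fun t => (tker l 1 t)%:C) X)^t* *m fcalc (fun t => (tker l 1 t)%:C) X = fcalc (fun t => (tker l 2 t)%:C) X.
  rewrite fcalc_adj fcalcM; apply: eq_fcalc => i.
  rewrite realC_conj /tker expr1 expr2. exact: esym (rmorphM _ _ _).
have cE : compression X V (tker l 2) *m y = V^t* *m (fcalc (fun t => (tker l 2 t)%:C) X *m (V *m y)).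
  by rewrite /compression !mulmxA.
rewrite cE ip_adjl trmxCK -fE -mulmxA.
move: (V *m y) (fcalc _ X) => v Q.
by rewrite ip_adjl trmxCK.
Qed.

Let w_le1 : fro2 w <= 1.
Proof. by rewrite -u1; exact: isometry_adj_le. Qed.

Variables (i0 : 'I_r) (T tau Th dl : R).
Hypothesis thT : forall i, `|th i| <= Th.
Hypothesis dl0 : 0 < dl.
Hypothesis gap : forall i, th i != th i0 -> dl <= (1 - T * th i) ^+ 2.

Let e1 := fro2 (compression X V (tker l 1) - T%:C%:M).
Let e2 := fro2 (compression X V (tker l 2) - tau%:C%:M).
Let S1 := \sum_(i | th i == th i0) abs2 (w i 0).
Let S2 := \sum_(i | th i != th i0) abs2 (w i 0).

Let Th0 : 0 <= Th. Proof. exact: le_trans (normr_ge0 _) (thT i0). Qed.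

Let th2 i : th i ^+ 2 <= Th ^+ 2.
Proof. by rewrite -real_normK ?num_real// lerXn2r ?nnegrE ?normr_ge0. Qed.

Let thw : fro2 (rdiag th *m w) <= Th ^+ 2.
Proof.
rewrite fro2_rdiag -[X in _ <= X]mulr1.
apply: (@le_trans _ _ (Th ^+ 2 * fro2 w)); last by rewrite ler_wpM2l ?sqr_ge0.
rewrite fro2_cV mulr_sumr; apply: ler_sum => i _.
by rewrite ler_wpM2r// abs2_ge0.
Qed.

(** When the compressed resolvent is close to [T], the linear system gives
    [(1 - T th i) w i ~ 0], and [1 - T th i] only vanishes on the spikes equal
    to [1 / T]. *)
Lemma eigenvector_other_spikes : dl * S2 <= Th ^+ 2 * e1.
Proof.
have h : w - T%:C *: (rdiag th *m w) =
    (compression X V (tker l 1) - T%:C%:M) *m (rdiag th *m w).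
  by rewrite mulmxBl -eigenvector_frame mul_scalar_mx.
apply: (@le_trans _ _ (fro2 (w - T%:C *: (rdiag th *m w)))); last first.
  rewrite h mulrC; apply: le_trans (fro2_mul _ _) _.
  by apply: ler_wpM2l => //; exact: fro2_ge0.
rewrite fro2_cV [X in _ <= X](bigID (fun i => th i == th i0)) /=.
apply: (@le_trans _ _ (\sum_(i | th i != th i0) abs2 ((w - T%:C *: (rdiag th *m w)) i 0))).
  rewrite mulr_sumr; apply: ler_sum => i ti.
  have -> : (w - T%:C *: (rdiag th *m w)) i 0 = (1 - T * th i)%:C * w i 0.
    rewrite /rdiag mul_diag_mx; move: (w) => w'; rewrite !mxE rmorphB rmorphM /=.
    by rewrite mulrBl mul1r mulrA.
  by rewrite abs2Zr ler_wpM2r ?abs2_ge0// gap.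
by rewrite lerDr sumr_ge0// => i _; exact: abs2_ge0.
Qed.

(** The normalization becomes [tau th_0^2 S1 ~ 1], as the other coordinates are
    negligible. *)
Lemma eigenvector_spike :
  `|1 - tau * th i0 ^+ 2 * S1| <= Th ^+ 2 * Num.sqrt e2 + `|tau| * (Th ^+ 2 * S2).
Proof.
set y := rdiag th *m w.
have e : 1 - tau * fro2 y = ip y ((compression X V (tker l 2) - tau%:C%:M) *m y).
  by rewrite mulmxBl ipDr ipNr eigenvector_norm mul_scalar_mx ipZr.
have a1 : `|1 - tau * fro2 y| <= Th ^+ 2 * Num.sqrt e2.
  have y0 := fro2_ge0 y.
  rewrite e -sqrtr_sqr -(ger0_norm (sqr_ge0 Th)) -sqrtr_sqr -sqrtrM ?sqr_ge0//.
  apply: ler_wsqrtr; apply: le_trans (ip_CS _ _) _.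
  have h : fro2 ((compression X V (tker l 2) - tau%:C%:M) *m y) <= e2 * Th ^+ 2.
    apply: le_trans (fro2_mul _ _) _.
    by apply: ler_wpM2l => //; exact: fro2_ge0.
  apply: le_trans (ler_pM y0 (fro2_ge0 _) thw h) _.
  by apply: le_refl_of_eq; move: (e2) (Th ^+ 2) => p q; ring.
have yE : fro2 y = th i0 ^+ 2 * S1 + \sum_(i | th i != th i0) th i ^+ 2 * abs2 (w i 0).
  rewrite fro2_rdiag (bigID (fun i => th i == th i0)) /= mulr_sumr.
  by congr (_ + _); apply: eq_bigr => i /eqP ->.
set Q := \sum_(i | _) _ in yE.
have Q0 : 0 <= Q by apply: sumr_ge0 => i _; rewrite mulr_ge0 ?sqr_ge0 ?abs2_ge0.
have QS : Q <= Th ^+ 2 * S2.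
  by rewrite mulr_sumr; apply: ler_sum => i _; rewrite ler_wpM2r ?abs2_ge0.
have -> : 1 - tau * th i0 ^+ 2 * S1 = (1 - tau * fro2 y) + tau * Q.
  by rewrite yE; move: (S1) (Q) => s q; ring.
apply: le_trans (ler_normD _ _) _; apply: lerD => //.
by rewrite normrM ler_wpM2l ?normr_ge0// (ger0_norm Q0).
Qed.

End SpikeEigenvector.

(** * Concentration of compressed resolvents *)

Section ResolventCutoff.
Variable R : realType.
Notation C := R[i].
Variables (z dl : R).
Hypothesis dl0 : 0 < dl.

(** The function [t / (z - t)] has a pole on the real line, hence is unbounded
    on Hermitian matrices. This is a bounded rational substitute, which agrees
    with it in the limit [dl -> 0]. *)
Definition cutoff (t : R) : R := t * (z - t) / ((z - t) ^+ 2 + dl ^+ 2).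

Let den_gt0 t : 0 < (z - t) ^+ 2 + dl ^+ 2.
Proof. by rewrite ltr_wpDl ?sqr_ge0 ?exprn_gt0. Qed.

Lemma cutoff_le t : `|cutoff t| <= `|z| / dl + 1.
Proof.
rewrite /cutoff normrM normfV (gtr0_norm (den_gt0 t)) ler_pdivrMr//.
have -> : t * (z - t) = z * (z - t) - (z - t) ^+ 2 by ring.
apply: le_trans (ler_normB _ _) _; rewrite normrM (ger0_norm (sqr_ge0 (z - t))).
have : `|z - t| * dl <= (z - t) ^+ 2 + dl ^+ 2.
  rewrite -(real_normK (num_real (z - t))); move: (`|z - t|) => s.
  have := sqr_ge0 (s - dl); have := sqr_ge0 (s + dl); nra.
move=> h; rewrite [leRHS]mulrDl mul1r; apply: lerD.
  by rewrite -mulrA ler_wpM2l// mulrC ler_pdivlMr.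
by rewrite lerDl ltW// exprn_gt0.
Qed.

Lemma cutoff_sub t (kap B : R) : 0 < kap -> kap <= `|z - t| -> `|t| <= B ->
  `|cutoff t - t / (z - t)| <= B * dl ^+ 2 / kap ^+ 3.
Proof.
move=> k0 kt tB.
have zt : z - t != 0 by rewrite -normr_gt0 (lt_le_trans k0).
have -> : cutoff t - t / (z - t) =
    - (t * dl ^+ 2 * ((z - t) * ((z - t) ^+ 2 + dl ^+ 2))^-1).
  by rewrite /cutoff; field; rewrite zt gt_eqF.
have B0 : 0 <= B := le_trans (normr_ge0 t) tB.
rewrite normrN normrM; apply: ler_pM => //; rewrite ?normr_ge0//.
  by rewrite normrM (ger0_norm (sqr_ge0 dl)) ler_wpM2r ?sqr_ge0.
have pk : 0 < kap ^+ 3 by rewrite exprn_gt0.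
have d0 : (z - t) * ((z - t) ^+ 2 + dl ^+ 2) != 0 by rewrite mulf_neq0// gt_eqF.
rewrite normfV lef_pV2 ?posrE ?normr_gt0//.
rewrite normrM (gtr0_norm (den_gt0 t)) exprS ler_pM ?(ltW k0) ?sqr_ge0//.
rewrite -[leLHS]addr0 -(real_normK (num_real (z - t))).
by apply: lerD; [rewrite lerXn2r ?nnegrE ?normr_ge0 ?(ltW k0) | exact: sqr_ge0].
Qed.

End ResolventCutoff.

Section CutoffCalculus.
Variable R : realType.
Notation C := R[i].
Variables (n : nat) (z dl : R) (k : nat).
Hypothesis dl0 : 0 < dl.
Implicit Types M N D G : 'M[C]_n.

(** Cramer's formula makes the measurability of the inverse plain. *)
Definition cramer_inv N : 'M[C]_n := (\det N)^-1 *: \adj N.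

Lemma cramer_invE N D : N *m D = 1%:M -> cramer_inv N = D.
Proof.
move=> ND; rewrite /cramer_inv.
have d0 : \det N != 0.
  by have /eqP := congr1 determinant ND; rewrite det_mulmx det1; apply: contraTneq => ->; rewrite mul0r eq_sym oner_eq0.
have -> : \adj N = \det N *: D.
  by rewrite -[LHS]mulmx1 -ND mulmxA mul_adj_mx mul_scalar_mx.
by rewrite scalerA mulVf// scale1r.
Qed.

Definition cutoff_den M : 'M[C]_n :=
  (z%:C%:M - M) *m (z%:C%:M - M) + (dl ^+ 2)%:C%:M.

(** Expressed without the spectral decomposition, whose choice of eigenvectors
    need not be measurable. *)
Definition cutoff_mx M : 'M[C]_n :=
  iter k (mulmx (cramer_inv (cutoff_den M) *m (M *m (z%:C%:M - M)))) 1%:M.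

Let inv_den t : ((z - t) ^+ 2 + dl ^+ 2)%:C * (((z - t) ^+ 2 + dl ^+ 2)^-1)%:C = 1 :> C.
Proof.
rewrite -rmorphM mulfV// gt_eqF//.
by rewrite ltr_wpDl ?sqr_ge0 ?exprn_gt0.
Qed.

Let shiftE M : M \is hermsymmx -> z%:C%:M - M = fcalc (fun t => (z - t)%:C) M.
Proof.
move=> Mh; rewrite -{1}(fcalc_id Mh) -(fcalc_cst _ M) fcalcB.
by apply: eq_fcalc => i; rewrite rmorphB.
Qed.

Let denV M : M \is hermsymmx ->
  cutoff_den M *m fcalc (fun t => (((z - t) ^+ 2 + dl ^+ 2)^-1)%:C) M = 1%:M.
Proof.
move=> Mh; rewrite /cutoff_den shiftE// fcalcM -(fcalc_cst _ M) fcalcD fcalcM.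
rewrite -(fcalc_cst _ M); apply: eq_fcalc => i.
apply: etrans (inv_den (evals M i)); apply: (congr1 (fun q => q * _)).
by rewrite -rmorphM -rmorphD -expr2.
Qed.

Lemma cutoff_mxE M : M \is hermsymmx ->
  cutoff_mx M = fcalc (fun t => (cutoff z dl t ^+ k)%:C) M.
Proof.
move=> Mh; have QE : cramer_inv (cutoff_den M) *m (M *m (z%:C%:M - M)) =
    fcalc (fun t => (cutoff z dl t)%:C) M.
  rewrite (cramer_invE (denV Mh)) shiftE//.
  have -> (N D : 'M[C]_n) : N *m (M *m D) = N *m (fcalc (fun t => t%:C) M *m D).
    by rewrite fcalc_id.
  rewrite !fcalcM; apply: eq_fcalc => i.
  by rewrite -rmorphM -rmorphM /cutoff mulrC.
rewrite /cutoff_mx QE; elim: (k) => [|m IH] /=.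
  by rewrite -(fcalc_cst _ M); apply: eq_fcalc => i.
rewrite IH fcalcM; apply: eq_fcalc => i.
by rewrite -rmorphM -exprS.
Qed.

Lemma cutoff_mx_conj M G : M \is hermsymmx -> G \is unitarymx ->
  cutoff_mx (G *m M *m G^t*) = G *m cutoff_mx M *m G^t*.
Proof.
move=> Mh GG; have G1 : G^t* *m G = 1%:M by exact: unitaryK.
have G2 : G *m G^t* = 1%:M by exact/unitarymxP.
have cM (Q Q' : 'M[C]_n) : (G *m Q *m G^t*) *m (G *m Q' *m G^t*) = G *m (Q *m Q') *m G^t*.
  by rewrite !mulmxA -(mulmxA _ (G^t*) G) G1 mulmx1.
have cS (x : C) : x%:M = G *m x%:M *m G^t* :> 'M[C]_n.
  by rewrite mul_mx_scalar -scalemxAl G2 scalemx1.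
have cD (Q Q' : 'M[C]_n) : (G *m Q *m G^t*) + (G *m Q' *m G^t*) = G *m (Q + Q') *m G^t*.
  by rewrite -mulmxDl -mulmxDr.
have cB (Q Q' : 'M[C]_n) : (G *m Q *m G^t*) - (G *m Q' *m G^t*) = G *m (Q - Q') *m G^t*.
  by rewrite -mulmxBl -mulmxBr.
rewrite /cutoff_mx; set D := fcalc (fun t => (((z - t) ^+ 2 + dl ^+ 2)^-1)%:C) M.
have sE : z%:C%:M - G *m M *m G^t* = G *m (z%:C%:M - M) *m G^t*.
  by rewrite {1}(cS z%:C) cB.
have dE : cutoff_den (G *m M *m G^t*) = G *m cutoff_den M *m G^t*.
  by rewrite /cutoff_den sE cM {1}(cS (dl ^+ 2)%:C) cD.
have iE : cutoff_den (G *m M *m G^t*) *m (G *m D *m G^t*) = 1%:M.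
  by rewrite dE cM denV// [RHS]cS.
rewrite (cramer_invE iE) (cramer_invE (denV Mh)) -/D sE !cM.
elim: (k) => [|m IH] /=; first by rewrite -cS.
by rewrite IH cM.
Qed.

Lemma mxmeas_cutoff d (T : measurableType d) (F : T -> 'M[C]_n) :
  mxmeas F -> mxmeas (fun w => cutoff_mx (F w)).
Proof.
move=> mF.
have mS : mxmeas (fun w => z%:C%:M - F w).
  by apply: mxmeasD; [exact: mxmeas_cst | exact: mxmeasN].
have mD : mxmeas (fun w => cutoff_den (F w)).
  by apply: mxmeasD; [exact: mxmeasM | exact: mxmeas_cst].
have mI : mxmeas (fun w => cramer_inv (cutoff_den (F w))).
  by apply: mxmeasZ; [apply/cmeasV/cmeas_det | exact: mxmeas_adjugate].
rewrite /cutoff_mx; elim: (k) => [|m IH] /=; first exact: mxmeas_cst.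
apply: mxmeasM => //; apply: mxmeasM => //; exact: mxmeasM.
Qed.

End CutoffCalculus.

Section CompressionConcentration.
Variable R : realType.
Notation C := R[i].
Local Notation mx_space n :=
  (@g_sigma_algebraType (Pointed.sort (pointed_mx R n)) (@mx_cylinders R n)).

Section Centered.
Variables (n : nat) (z dl : R) (k : nat).
Hypothesis n0 : (0 < n)%N.
Hypothesis dl0 : 0 < dl.

(** The trace is removed because the main term of the total drift of the energy
    is a negative multiple of the energy only for traceless matrices. *)
Definition centered_cutoff (M : 'M[C]_n) : 'M[C]_n :=
  cutoff_mx z dl k M - (n%:R^-1 * \tr (cutoff_mx z dl k M))%:M.

Definition spectral_mean (f : R -> R) (M : 'M[C]_n) : R :=
  n%:R^-1 * \sum_i f (evals M i).

Let nC0 : n%:R != 0 :> C. Proof. by rewrite pnatr_eq0 -lt0n. Qed.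

Lemma centered_cutoffE (M : 'M[C]_n) : M \is hermsymmx ->
  centered_cutoff M =
  fcalc (fun t => (cutoff z dl t ^+ k - spectral_mean (fun t => cutoff z dl t ^+ k) M)%:C) M.
Proof.
move=> Mh; rewrite /centered_cutoff cutoff_mxE// fcalc_trace -(fcalc_cst _ M) fcalcB.
apply: eq_fcalc => i; rewrite rmorphB; apply: (congr1 (fun q => _ - q)).
rewrite /spectral_mean rmorphM fmorphV rmorph_nat rmorph_sum.
by [].
Qed.

Lemma centered_cutoff_trace (M : 'M[C]_n) : \tr (centered_cutoff M) = 0.
Proof.
rewrite /centered_cutoff raddfB /= mxtrace_scalar -[X in _ - X]mulr_natl mulrA mulfV//.
by rewrite mul1r subrr.
Qed.

Lemma centered_cutoff_conj (M G : 'M[C]_n) : M \is hermsymmx -> G \is unitarymx ->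
  centered_cutoff (G *m M *m G^t*) = G *m centered_cutoff M *m G^t*.
Proof.
move=> Mh GG; rewrite /centered_cutoff cutoff_mx_conj//.
rewrite mxtrace_mulC mulmxA unitaryK// mul1mx mulmxBr mulmxBl.
rewrite mul_mx_scalar -[in RHS]scalemxAl (unitarymxP GG) scalemx1.
by [].
Qed.

Lemma mxmeas_centered d (T : measurableType d) (F : T -> 'M[C]_n) :
  mxmeas F -> mxmeas (fun w => centered_cutoff (F w)).
Proof.
move=> mF; have mB := @mxmeas_cutoff R n z dl k d T F mF.
apply: mxmeasD => //; apply: mxmeasN; apply: mxmeas_scalar.
apply: cmeasM; [exact: cmeas_cst | exact: cmeas_tr].
Qed.

Let cutoffX_le t : `|cutoff z dl t ^+ k| <= (`|z| / dl + 1) ^+ k.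
Proof.
rewrite normrX lerXn2r ?nnegrE ?normr_ge0//; last exact: cutoff_le.
exact: le_trans (cutoff_le z dl0 t).
Qed.

Lemma spectral_mean_le (f : R -> R) (M : 'M[C]_n) (K : R) :
  (forall i, `|f (evals M i)| <= K) -> `|spectral_mean f M| <= K.
Proof.
move=> fK; rewrite /spectral_mean normrM normfV normr_nat mulrC.
rewrite ler_pdivrMr ?ltr0n//; apply: le_trans (ler_norm_sum _ _ _) _.
apply: le_trans (ler_sum _ (fun i _ => fK i)) _.
by rewrite sumr_const card_ord mulr_natr.
Qed.

Lemma centered_cutoff_bound (M : 'M[C]_n) (B : 'M[C]_n) : M \is hermsymmx ->
  let K := 4 * ((`|z| / dl + 1) ^+ k) ^+ 2 in
  fro2 (centered_cutoff M *m B) <= K * fro2 B /\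
  fro2 (B *m centered_cutoff M) <= K * fro2 B.
Proof.
move=> Mh K; rewrite centered_cutoffE//.
set s := spectral_mean _ _.
have h i : abs2 (cutoff z dl (evals M i) ^+ k - s)%:C <= K.
  rewrite /abs2 /= expr0n addr0 -(real_normK (num_real _)).
  have -> : K = (2 * (`|z| / dl + 1) ^+ k) ^+ 2 by rewrite exprMn -natrX.
  have b : `|cutoff z dl (evals M i) ^+ k - s| <= 2 * (`|z| / dl + 1) ^+ k.
    rewrite mulr_natl mulr2n; apply: le_trans (ler_normB _ _) _; apply: lerD => //.
    by apply: spectral_mean_le => j; exact: cutoffX_le.
  by rewrite lerXn2r// nnegrE ?(le_trans (normr_ge0 _) b).
by split; [exact: fro2_fcalcl | exact: fro2_fcalcr].
Qed.

End Centered.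

(** The compression of [A] to the range of the frame is controlled by the energy
    of [A], since the perturbation is invertible on that range. *)
Lemma compression_energy_le n r (A P : 'M[C]_n) (V : 'M[C]_(n, r)) (th : 'I_r -> R) :
  (forall i, th i != 0) -> V^t* *m V = 1%:M -> P = V *m rdiag th *m V^t* ->
  fro2 (V^t* *m A *m V) <= fro2 (rdiag (fun i => (th i)^-1)) ^+ 2 * energy P A.
Proof.
move=> th0 VV PE; pose D := rdiag (fun i => (th i)^-1).
have D1 : D *m rdiag th = 1%:M.
  rewrite /D /rdiag mulmx_diag; apply/matrixP => i j; rewrite !mxE.
  by case: (i == j); rewrite ?mulr0n// -rmorphM mulVf// rmorph1.
have D2 : rdiag th *m D = 1%:M.
  rewrite /D /rdiag mulmx_diag; apply/matrixP => i j; rewrite !mxE.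
  by case: (i == j); rewrite ?mulr0n// -rmorphM mulfV// rmorph1.
have VP : D *m (V^t* *m P) = V^t*.
  by rewrite PE !mulmxA -(mulmxA D) VV mulmx1 D1 mul1mx.
have PV : P *m V *m D = V.
  by rewrite PE -!mulmxA (mulmxA (V^t*)) VV mul1mx D2 mulmx1.
have e : V^t* *m A *m V = D *m (V^t* *m ((P *m A *m P) *m V)) *m D.
  by rewrite -{1}VP -{2}PV !mulmxA.
have q0 : 0 <= fro2 D := fro2_ge0 D.
have Y : fro2 (V^t* *m ((P *m A *m P) *m V)) <= energy P A.
  apply: le_trans (isometry_adj_le _ VV) _.
  rewrite -fro2_adj adjM; apply: le_trans (isometry_adj_le _ VV) _.
  by rewrite fro2_adj.
rewrite e -/D; apply: le_trans (fro2_mul _ _) _.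
apply: le_trans (ler_wpM2r q0 (fro2_mul _ _)) _.
apply: le_trans (ler_wpM2r q0 (ler_wpM2l q0 Y)) _.
by apply: le_refl_of_eq; rewrite expr2 mulrAC.
Qed.

Lemma frame_fro2 n r (P : 'M[C]_n) (V : 'M[C]_(n, r)) (th : 'I_r -> R) :
  V^t* *m V = 1%:M -> P = V *m rdiag th *m V^t* -> fro2 P = fro2 (rdiag th).
Proof.
move=> VV ->; rewrite -mulmxA fro2_isoml//.
by rewrite fro2_isomr// trmxCK.
Qed.

Context d (Omega : measurableType d) (Pr : probability Omega R) (c : symmetry_class).
Variables (X P : forall n, Omega -> 'M[C]_n) (r : nat) (th : 'I_r -> R).
Variable V : forall n, Omega -> 'M[C]_(n, r).
Hypothesis r0 : (0 < r)%N.
Hypothesis th0 : forall i, th i != 0.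
Hypothesis rX : forall n, random_mx (X n).
Hypothesis hX : forall n w, X n w \is hermsymmx.
Hypothesis rP : forall n, (r <= n)%N -> random_mx (P n).
Hypothesis VV : forall n w, (r <= n)%N -> (V n w)^t* *m V n w = 1%:M.
Hypothesis PE : forall n w, (r <= n)%N -> P n w = V n w *m rdiag th *m (V n w)^t*.
Hypothesis indep : forall n, (r <= n)%N -> independent_mx Pr (X n) (P n).
Hypothesis inv : forall n, (r <= n)%N ->
  conj_invariant Pr c (X n) \/ conj_invariant Pr c (P n).

(** The energy of the centered function tends to [0] by the second moment bound,
    which holds with constants independent of [n] because the function is
    bounded and the perturbation has a fixed Frobenius norm. *)
Lemma cutoff_compression_cvg (z dl : R) (k : nat) : 0 < dl ->
  {ae Pr, forall w,
     fro2 (compression (X n w) (V n w) (fun t => cutoff z dl t ^+ k) -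
       (spectral_mean (fun t => cutoff z dl t ^+ k) (X n w))%:C%:M)
     @[n --> \oo] --> (0 : R)}.
Proof.
move=> dl0; pose K := 4 * ((`|z| / dl + 1) ^+ k) ^+ 2; pose p := fro2 (rdiag th).
pose N n w := energy (P n w) (centered_cutoff z dl k (X n w)).
have gen n : (r <= n)%N -> bounded_mfun (N n) /\
    ((1 < n)%N -> 0 <= K -> \int[Pr]_w (N n w ^+ 2) <= 65 * K ^+ 2 * p ^+ 4 / (n%:R - 1) ^+ 2).
  move=> rn; have n0 : (0 < n)%N by exact: leq_trans rn.
  have mA : mxmeas (fun M : mx_space n => centered_cutoff z dl k M).
    apply: mxmeas_centered; apply/random_mxP/random_mx_measurable.
    exact: measurable_id.
  have normP w : fro2 (P n w) = p := frame_fro2 (VV w rn) (PE w rn).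
  have trA (M : 'M[C]_n) : M \is hermsymmx -> \tr (centered_cutoff z dl k M) = 0.
    by move=> _; exact: centered_cutoff_trace.
  have eqA := @centered_cutoff_conj n z dl k dl0.
  have opA := fun M Mh B => @centered_cutoff_bound n z dl k n0 dl0 M B Mh.
  split.
    exact: (bounded_energy1 (@rX n) (@rP n rn) (@hX n) normP mA opA).
exact: (energy_second_moment (@rX n) (@rP n rn) (@hX n) normP (@indep n rn) (@inv n rn) mA eqA trA opA).
have Nc : {ae Pr, forall w, N n w @[n --> \oo] --> (0 : R)}.
  apply: (@second_moment_ae_cvg0 _ _ _ _ _ (65 * K ^+ 2 * p ^+ 4) r).
  - by move=> m /gen[].
  - by move=> m w; exact: fro2_ge0.
  - move=> m /gen[_ h] m1; apply: h => //.
    by rewrite mulr_ge0// sqr_ge0.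
apply: filterS Nc => w Nw.
pose q := fro2 (rdiag (fun i => (th i)^-1)) ^+ 2.
have qN : q * N n w @[n --> \oo] --> (0 : R).
  by rewrite -[X in _ --> X](mulr0 q); exact: cvgMr.
apply: squeeze_cvgr (cvg_cst 0) qN.
near=> n.
have rn : (r <= n)%N by near: n; exact: nbhs_infty_ge.
rewrite fro2_ge0 /=.
have -> : compression (X n w) (V n w) (fun t => cutoff z dl t ^+ k) -
    (spectral_mean (fun t => cutoff z dl t ^+ k) (X n w))%:C%:M =
    (V n w)^t* *m centered_cutoff z dl k (X n w) *m V n w.
  rewrite centered_cutoffE//; set s := spectral_mean _ _.
  have -> : fcalc (fun t => (cutoff z dl t ^+ k - s)%:C) (X n w) =
      fcalc (fun t => (cutoff z dl t ^+ k)%:C) (X n w) - (s%:C)%:M.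
    rewrite -(fcalc_cst _ (X n w)) fcalcB; apply: eq_fcalc => i.
    by rewrite rmorphB.
  by rewrite mulmxBr mulmxBl mul_mx_scalar -scalemxAl VV// scalemx1.
exact: compression_energy_le (VV w rn) (PE w rn).
Unshelve. all: by end_near.
Qed.
End CompressionConcentration.

(** * Probability measures with compact support *)

Section CompactSupport.
Variables (R : realType) (mu : probability R R).

(** A point outside the support has a null neighbourhood, which contains a null
    interval with rational ends; these are countably many. *)
Lemma supp_negligible : mu.-negligible (~` supp mu).
Proof.
pose F m : set R := if (unpickle m : option (rat * rat)) is Some pq then
  if mu `](ratr pq.1), (ratr pq.2)[%classic == 0%E then
    `](ratr pq.1), (ratr pq.2)[%classic else set0 else set0.
have nF m : mu.-negligible (F m).
  rewrite /F; case: unpickle => [pq|]; last exact: negligible_set0.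
  case: eqP => [h|_]; last exact: negligible_set0.
  by apply/negligibleP.
apply: negligibleS (negligible_bigcup nF) => x /= nx.
have [U [oU Ux U0]] : exists U : set R, [/\ open U, U x & mu U = 0%E].
  move: nx; rewrite /supp /= => /existsNP[U /not_implyP[oU /not_implyP[Ux h]]].
  exists U; split => //; apply/eqP; rewrite eq_le measure_ge0 andbT leNgt.
  exact/negP.
have /nbhs_ballP[e /= e0 eU] : nbhs x U by exact: open_nbhs_nbhs.
have [p p12] : exists p : rat, ratr p \in `]x - e, x[.
  by apply: rat_in_itvoo; rewrite ltrBlDr ltrDl.
have [q q12] : exists q : rat, ratr q \in `]x, x + e[.
  by apply: rat_in_itvoo; rewrite ltrDl.
move: p12 q12; rewrite !in_itv /= => /andP[p1 p2] /andP[q1 q2].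
have pqU : `](ratr p), (ratr q)[%classic `<=` U.
  move=> y /=; rewrite in_itv /= => /andP[y1 y2]; apply: eU.
  have h1 := lt_trans p1 y1; have h2 := lt_trans y2 q2.
  by rewrite /ball /= ltr_norml; apply/andP; split; move: h1 h2; lra.
have pq0 : mu `](ratr p), (ratr q)[%classic = 0%E.
  apply/eqP; rewrite eq_le measure_ge0 andbT -U0.
  by apply: le_measure => //; rewrite inE//; exact: open_measurable.
exists (pickle (p, q)); first exact: I.
by rewrite /F pickleK pq0 eqxx /= in_itv /= p2 q1.
Qed.

Lemma supp_itv : compact (supp mu) ->
  supp mu !=set0 /\ supp mu `<=` `[inf (supp mu), sup (supp mu)]%classic.
Proof.
move=> /compact_bounded [M [_ hM]].
have bnd x : supp mu x -> `|x| <= M + 1 by apply: hM; rewrite ltrDl.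
split.
  apply/set0P/negP => /eqP s0.
  have := supp_negligible; rewrite s0 setC0 => /negligibleP => /(_ measurableT).
  move=> h; have /eqP := etrans (esym h) (probability_setT mu).
  by rewrite eq_sym onee_eq0.
move=> x sx /=; rewrite in_itv /=; apply/andP; split.
  apply: ge_inf => //; exists (- (M + 1)) => y /bnd.
  by rewrite ler_norml => /andP[].
apply: ub_le_sup => //; exists (M + 1) => y /bnd.
by rewrite ler_norml => /andP[].
Qed.

End CompactSupport.

Section Clamp.
Variables (R : realType) (c d : R).
Hypothesis cd : c <= d.

(** Composing with [clamp] turns integrands that are only controlled on [[c, d]]
    into bounded continuous functions. *)
Definition clamp (t : R) : R := Num.max c (Num.min t d).

Lemma clamp_itv t : c <= clamp t <= d.
Proof. by rewrite /clamp le_max lexx ge_max cd ge_min lexx orbT. Qed.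

Lemma clamp_id t : c <= t <= d -> clamp t = t.
Proof. by move=> /andP[ct td]; rewrite /clamp min_l// max_r. Qed.

Lemma clamp_continuous : continuous clamp.
Proof.
move=> t; suff : {for t, continuous ((fun=> c) \max (id \min (fun=> d)))} by [].
apply: continuous_max; first exact: cvg_cst.
by apply: continuous_min; [exact: cvg_id | exact: cvg_cst].
Qed.

Lemma clamp_measurable : measurable_fun setT clamp.
Proof. exact: continuous_measurable_fun clamp_continuous. Qed.

Lemma clamp_norm t : `|clamp t| <= `|c| + `|d|.
Proof.
have /andP[h1 h2] := clamp_itv t; rewrite ler_norml; apply/andP; split.
  have := ler_norm (- c); have := normr_ge0 d; rewrite normrN; lra.
have := ler_norm d; have := normr_ge0 c; lra.
Qed.

(** This is positive exactly when [z] is outside [[c, d]], and then it is the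
    distance to this interval. *)
Definition gap (z : R) : R := Num.max (c - z) (z - d).

Lemma gap_le z t : c <= t <= d -> gap z <= `|z - t|.
Proof.
move=> /andP[ct td]; rewrite /gap ge_max; apply/andP; split.
  by rewrite distrC; apply: le_trans (ler_norm _); rewrite lerD2r.
by apply: le_trans (ler_norm _); rewrite lerD2l lerN2.
Qed.

Lemma gap_gt0 z : (0 < gap z) = (z < c) || (d < z).
Proof. by rewrite /gap lt_max !subr_gt0. Qed.

Lemma gap_lip z z' : gap z - `|z - z'| <= gap z'.
Proof.
have h1 := ler_norm (z - z'); have h2 := ler_norm (z' - z).
rewrite distrC in h2; rewrite /gap; case: (leP (c - z) (z - d)) => h.
  by rewrite le_max; apply/orP; right; move: h1 h2; lra.
by rewrite le_max; apply/orP; left; move: h1 h2; lra.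
Qed.

Lemma tker_clamp_continuous z k : 0 < gap z -> continuous (fun t => tker z k (clamp t)).
Proof.
move=> g t; apply: (@continuous_comp _ _ _ (fun t => clamp t / (z - clamp t))
  (fun y => y ^+ k)); last exact: exprn_continuous.
have ct : clamp x @[x --> t] --> clamp t by exact: clamp_continuous.
apply: cvgM => //; apply: cvgV; last by apply: cvgB => //; exact: cvg_cst.
by rewrite -normr_gt0; apply: lt_le_trans g _; exact/gap_le/clamp_itv.
Qed.

Lemma tker_le z k t : 0 < gap z -> c <= t <= d ->
  `|tker z k t| <= ((`|c| + `|d|) / gap z) ^+ k.
Proof.
move=> g tcd; have gt := gap_le z tcd.
have b0 : 0 <= `|c| + `|d| by rewrite addr_ge0.
have h : `|t / (z - t)| <= (`|c| + `|d|) / gap z.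
  rewrite normrM normfV -{1}(clamp_id tcd); apply: ler_pM; rewrite ?invr_ge0//.
    exact: clamp_norm.
  by rewrite lef_pV2 ?posrE// (lt_le_trans g).
by rewrite /tker normrX lerXn2r// nnegrE ?(le_trans (normr_ge0 _) h).
Qed.

End Clamp.

(** * The T-transform of a compactly supported measure *)

Section TTransform.
Variables (R : realType) (mu : probability R R) (a b : R).
Hypothesis ab : a <= b.
Hypothesis mu_ab : mu.-negligible (~` `[a, b]%classic).

Notation clamp := (clamp a b).
Notation gap := (gap a b).

Let mean (f : R -> R) : R := \int[mu]_t f (clamp t).

Lemma measurable_clamped (f : R -> R) : measurable_fun setT f ->
  measurable_fun setT (fun t => f (clamp t)).
Proof. by move=> mf; exact: measurableT_comp mf (clamp_measurable a b). Qed.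

Lemma Rintegral_clamp (f : R -> R) : measurable_fun setT f ->
  \int[mu]_t f t = \int[mu]_t f (clamp t).
Proof.
move=> mf; rewrite /Rintegral; congr fine; apply: ae_eq_integral => //.
- exact/measurable_EFinP.
- by apply/measurable_EFinP; exact: measurable_clamped.
apply: negligibleS mu_ab => t /=; apply: contra_not => tab _.
by rewrite clamp_id//; move: tab; rewrite in_itv.
Qed.

Lemma measurable_tker (z : R) k : measurable_fun setT (tker z k).
Proof.
apply: measurable_funX; apply: measurable_funM => //.
apply: (measurableT_comp (@measurable_invr R)).
exact: measurable_funB.
Qed.

Lemma tker_clamp_bounded (z : R) k : 0 < gap z ->
  bounded_mfun (fun t => tker z k (clamp t)).
Proof.
move=> g; split.
  by apply: (@measurable_clamped (tker z k)); exact: measurable_tker.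
by exists (((`|a| + `|b|) / gap z) ^+ k) => t; exact/tker_le/clamp_itv.
Qed.

(** The case [k = 1] is the T-transform; the case [k = 2] governs
    eigenvectors. *)
Definition T_moment (z : R) (k : nat) : R := \int[mu]_t tker z k t.

Lemma T_transformE (z : R) : T_transform mu z = T_moment z 1.
Proof. by apply: eq_Rintegral => t _; rewrite /tker expr1. Qed.

Lemma T_moment_clamp (z : R) k : T_moment z k = \int[mu]_t tker z k (clamp t).
Proof. by apply: Rintegral_clamp; exact: measurable_tker. Qed.

(* [t / (z' - t) - t / (z - t) = (z - z') quot z z' t]. *)
Let quot (z z' t : R) : R := t / ((z - t) * (z' - t)).

Let quot_bounded z z' : 0 < gap z -> 0 < gap z' ->
  bounded_mfun (fun t => quot z z' (clamp t)).
Proof.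
move=> g g'; split.
  apply: (@measurable_clamped (quot z z')); apply: measurable_funM => //.
  apply: (measurableT_comp (@measurable_invr R)); apply: measurable_funM;
    exact: measurable_funB.
exists ((`|a| + `|b|) / (gap z * gap z')) => t; rewrite /quot normrM normfV normrM.
apply: ler_pM; rewrite ?invr_ge0 ?mulr_ge0 ?normr_ge0 ?clamp_norm//.
have := gap_le z (clamp_itv ab t); have := gap_le z' (clamp_itv ab t) => h' h.
rewrite lef_pV2 ?posrE ?mulr_gt0 ?(lt_le_trans g h) ?(lt_le_trans g' h')//.
by apply: ler_pM => //; exact: ltW.
Qed.

Let neq0 z t : 0 < gap z -> z - clamp t != 0.
Proof.
move=> g; rewrite -normr_gt0; apply: lt_le_trans g _.
exact/gap_le/clamp_itv.
Qed.

Lemma T_transformB z z' : 0 < gap z -> 0 < gap z' ->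
  T_transform mu z' - T_transform mu z = (z - z') * mean (quot z z').
Proof.
move=> g g'; rewrite !T_transformE !T_moment_clamp.
rewrite -bexpZ; last exact: quot_bounded.
apply/eqP; rewrite subr_eq -bexpD; last 2 first.
- by apply: bounded_mfunM; [exact: bounded_mfun_cst | exact: quot_bounded].
- exact: tker_clamp_bounded.
apply/eqP; apply: eq_Rintegral => t _; rewrite /tker /quot !expr1.
by have := neq0 t g; have := neq0 t g'; move: (clamp t) => s h' h; field; rewrite h h'.
Qed.

Let quotB z z' : 0 < gap z -> 0 < gap z' ->
  `|mean (quot z z') - mean (quot z z)| <=
  `|z - z'| * ((`|a| + `|b|) / (gap z ^+ 2 * gap z')).
Proof.
move=> g g'; rewrite /mean.
have -> : \int[mu]_t quot z z' (clamp t) - \int[mu]_t quot z z (clamp t) =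
    \int[mu]_t (quot z z' (clamp t) + (-1) * quot z z (clamp t)).
  rewrite bexpD ?bexpZ ?mulN1r//; try exact: quot_bounded.
  by apply: bounded_mfunM; [exact: bounded_mfun_cst | exact: quot_bounded].
apply: norm_bexp_le.
  apply: bounded_mfunD; first exact: quot_bounded.
  by apply: bounded_mfunM; [exact: bounded_mfun_cst | exact: quot_bounded].
move=> t; have -> : quot z z' (clamp t) + -1 * quot z z (clamp t) =
    (z - z') * (clamp t / ((z - clamp t) ^+ 2 * (z' - clamp t))).
  rewrite /quot; have := neq0 t g; have := neq0 t g'; move: (clamp t) => s h' h.
  by field; rewrite h h'.
rewrite normrM ler_wpM2l// normrM normfV normrM normrX.
have := gap_le z (clamp_itv ab t); have := gap_le z' (clamp_itv ab t) => h' h.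
apply: ler_pM; rewrite ?invr_ge0 ?mulr_ge0 ?normr_ge0 ?exprn_ge0 ?clamp_norm//.
rewrite lef_pV2 ?posrE ?mulr_gt0 ?exprn_gt0 ?(lt_le_trans g h) ?(lt_le_trans g' h')//.
apply: ler_pM; rewrite ?exprn_ge0 ?(ltW g) ?(ltW g')//.
by rewrite lerXn2r ?nnegrE ?(ltW g).
Qed.

(** [t^2 = z t - t (z - t)]. *)
Lemma T_moment2 z : 0 < gap z ->
  T_moment z 2 = z * mean (quot z z) - T_transform mu z.
Proof.
move=> g; rewrite T_transformE !T_moment_clamp.
rewrite -bexpZ; last exact: quot_bounded.
apply/eqP; rewrite -subr_eq0 opprB addrA subr_eq0; apply/eqP; rewrite -bexpD.
- apply: eq_Rintegral => t _; rewrite /tker /quot expr1.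
  by have := neq0 t g; move: (clamp t) => s h; field.
- exact: tker_clamp_bounded.
- exact: tker_clamp_bounded.
Qed.

Lemma T_transform_derive z : 0 < gap z ->
  is_derive z 1 (T_transform mu) (- mean (quot z z)).
Proof.
move=> g; set D := - _.
have h : h^-1 *: (T_transform mu (h *: 1 + z) - T_transform mu z) @[h --> 0^'] --> D.
  pose L := 2 * ((`|a| + `|b|) / gap z ^+ 3).
  have L0 : 0 <= L by rewrite mulr_ge0// mulr_ge0 ?addr_ge0// invr_ge0 exprn_ge0// ltW.
  apply/cvgrPdist_le => e e0; near=> h.
  have h0 : h != 0 by near: h; exact: nbhs_dnbhs_neq.
  have hg : `|h| <= gap z / 2.
    near: h; apply: dnbhs0_le; rewrite divr_gt0//.
  have he : `|h| * L <= e.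
    apply: (@le_trans _ _ (`|h| * (L + 1))); first by rewrite ler_wpM2l// lerDl.
    rewrite -ler_pdivlMr ?ltr_wpDl//; near: h; apply: dnbhs0_le.
    by rewrite divr_gt0// ltr_wpDl.
  have g'2 : gap z / 2 <= gap (h + z).
    have := gap_lip a b z (h + z); rewrite opprD addrCA subrr addr0 normrN => hl.
    apply: le_trans hl; move: hg; move: (gap z) (`|h|) => x y; lra.
  have g' : 0 < gap (h + z) by apply: lt_le_trans g'2; rewrite divr_gt0.
  rewrite scaler1 T_transformB// opprD addrCA subrr addr0 mulNr scalerN.
  rewrite /D -opprD normrN /GRing.scale /= mulrA mulVf// mul1r -normrN opprB.
  apply: le_trans (quotB g g') _; rewrite opprD addrCA subrr addr0 normrN.
  apply: le_trans he; rewrite ler_wpM2l// /L mulrCA ler_wpM2l ?addr_ge0//.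
  have -> : 2 / gap z ^+ 3 = (gap z ^+ 2 * (gap z / 2))^-1.
    by field; rewrite gt_eqF.
  rewrite lef_pV2 ?posrE ?mulr_gt0 ?exprn_gt0 ?invr_gt0//.
  by rewrite ler_wpM2l// exprn_ge0// ltW.
split; first by apply/cvg_ex; exists D.
by apply: cvg_lim.
Unshelve. all: by end_near.
Qed.

Lemma T_transform_continuous z : 0 < gap z -> {for z, continuous (T_transform mu)}.
Proof.
move=> g; have [h _] := T_transform_derive g.
exact/differentiable_continuous/derivable1_diffP.
Qed.

Lemma T_moment2_derive z : 0 < gap z ->
  T_moment z 2 = - (z * derive1 (T_transform mu) z + T_transform mu z).
Proof.
move=> g; have [_ h] := T_transform_derive g.
by rewrite derive1E h T_moment2// mulrN opprD opprK.
Qed.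

Hypothesis a0 : 0 <= a.
Hypothesis mu_neq0 : ~ (forall A : set R, measurable A -> mu A = \d_(0 : R) A).

(** This is where the measure must differ from the Dirac mass at [0]. *)
Lemma mean_gt0 (f : R -> R) : bounded_mfun (fun t => f (clamp t)) ->
  (forall t, a <= t <= b -> 0 <= f t) ->
  (forall t, a <= t <= b -> f t = 0 -> t = 0) -> 0 < mean f.
Proof.
move=> bf f0 fz; rewrite lt_def andbC Rintegral_ge0/=; last first.
  by move=> t _; apply: f0; exact: clamp_itv.
apply/negP => /eqP m0; apply: mu_neq0.
have fi := bounded_mfun_integrable mu bf.
have i0 : (\int[mu]_t `|(f (clamp t))%:E|)%E = 0%E.
  transitivity ((mean f)%:E); last by rewrite m0.
  rewrite /mean /Rintegral fineK; last exact: integrable_fin_num.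
  apply: eq_integral => t _; rewrite gee0_abs// lee_fin; apply: f0.
  exact: clamp_itv.
have n0 : mu.-negligible (~` [set 0 : R]).
  have mf : measurable_fun setT (fun t => (f (clamp t))%:E).
    by apply/measurable_EFinP; case: bf.
  have [/(_ i0) h _] := ae_eq_integral_abs mu measurableT mf.
  apply: negligibleS (negligibleU h mu_ab) => t /= tn0.
  have [tab|tab] := boolP (t \in `[a, b]); last by right; exact/negP.
  left => /(_ I) [ft]; apply: tn0; move: tab; rewrite in_itv /= => tab.
  by apply: fz => //; rewrite clamp_id in ft.
have nA (A : set R) : measurable A -> ~ A 0 -> mu A = 0%E.
  move=> mA A0; apply/negligibleP => //; apply: negligibleS n0 => t At /= t0.
  by apply: A0; rewrite -t0.
move=> A mA; rewrite diracE; have [A0|A0] := boolP (0 \in A).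
  have h : mu (~` A) = 0%E.
    by apply: nA; [exact: measurableC | move=> /=; apply; exact/set_mem].
  have := probability_setC mu (measurableC mA); rewrite setCK h sube0.
  by [].
by rewrite nA// => /mem_set; exact/negP.
Qed.

Lemma T_moment2_gt0 z : 0 < gap z -> 0 < T_moment z 2.
Proof.
move=> g; rewrite T_moment_clamp; apply: mean_gt0.
- exact: tker_clamp_bounded.
- by move=> t _; exact: sqr_ge0.
- move=> t tab /eqP; rewrite sqrf_eq0 mulf_eq0 invr_eq0.
  have := neq0 t g; rewrite clamp_id// => /negPf ->.
  by rewrite orbF => /eqP.
Qed.

(** [z] lies to the right of [[a, b]] when [sg = 1], to its left when [sg = -1].
    Points on either side are treated together by this sign. *)
Definition outside (sg z : R) := forall t, a <= t <= b -> sg * t < sg * z.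

Lemma outside_gap sg z : sg = 1 \/ sg = -1 -> outside sg z -> 0 < gap z.
Proof.
move=> sg1 oz; rewrite gap_gt0; case: sg1 oz => -> oz.
  by apply/orP; right; have := oz b; rewrite lexx ab !mul1r; apply.
by apply/orP; left; have := oz a; rewrite lexx ab !mulN1r ltrN2; apply.
Qed.

Lemma T_transform_sign sg z : sg = 1 \/ sg = -1 -> outside sg z ->
  0 < sg * T_transform mu z.
Proof.
move=> sg1 oz; have g := outside_gap sg1 oz.
rewrite T_transformE T_moment_clamp -bexpZ; last exact: tker_clamp_bounded.
have sgz t : a <= t <= b -> 0 < sg * (z - t).
  by move=> /oz; rewrite mulrBr subr_gt0.
have e t : sg * tker z 1 t = t / (sg * (z - t)).
  rewrite /tker expr1 invfM; case: sg1 => ->; first by rewrite invr1 !mul1r.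
  by rewrite invrN1 mulrCA.
apply: (@mean_gt0 (fun t => sg * tker z 1 t)).
- by apply: bounded_mfunM; [exact: bounded_mfun_cst | exact: tker_clamp_bounded].
- move=> t tab; rewrite e divr_ge0 ?(ltW (sgz t tab))//.
  by apply: le_trans a0 _; case/andP: tab.
- move=> t tab /eqP; rewrite e mulf_eq0 invr_eq0 (gt_eqF (sgz t tab)) orbF.
  by move/eqP.
Qed.

Lemma T_transform_decr sg z z' : sg = 1 \/ sg = -1 -> outside sg z -> outside sg z' ->
  z < z' -> T_transform mu z' < T_transform mu z.
Proof.
move=> sg1 oz oz' zz'.
have g := outside_gap sg1 oz; have g' := outside_gap sg1 oz'.
rewrite -subr_lt0 T_transformB// nmulr_rlt0 ?subr_lt0//.
have pos t : a <= t <= b -> 0 < (z - t) * (z' - t).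
  move=> tab; have := oz t tab; have := oz' t tab; case: sg1 => ->.
    by rewrite !mul1r => h h'; rewrite mulr_gt0 ?subr_gt0.
  by rewrite !mulN1r !ltrN2 => h h'; rewrite nmulr_rgt0 subr_lt0.
apply: mean_gt0; first exact: quot_bounded.
- move=> t tab; rewrite divr_ge0 ?(ltW (pos t tab))//.
  by apply: le_trans a0 _; case/andP: tab.
- move=> t tab /eqP; rewrite mulf_eq0 invr_eq0 (gt_eqF (pos t tab)) orbF.
  by move/eqP.
Qed.

Lemma T_transform_sdecr sg z z' : sg = 1 \/ sg = -1 -> outside sg z -> outside sg z' ->
  sg * z < sg * z' -> sg * T_transform mu z' < sg * T_transform mu z.
Proof.
move=> sg1 oz oz'; have dec := T_transform_decr sg1.
case: sg1 dec oz oz' => -> dec oz oz'; first by rewrite !mul1r; exact: dec.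
by rewrite !mulN1r !ltrN2; exact: dec.
Qed.

Lemma T_transform_le z : 0 < gap z -> `|T_transform mu z| <= b / gap z.
Proof.
move=> g; rewrite T_transformE T_moment_clamp; apply: norm_bexp_le.
  exact: tker_clamp_bounded.
move=> t; have tab := clamp_itv ab t; have /andP[t1 t2] := tab.
rewrite /tker expr1 normrM normfV ger0_norm ?(le_trans a0)//.
have h := gap_le z tab.
apply: ler_pM => //; rewrite ?invr_ge0 ?(le_trans a0)//.
by rewrite lef_pV2 ?posrE// (lt_le_trans g).
Qed.

Let one1 : (1 : R) = 1 \/ (1 : R) = -1. Proof. by left. Qed.
Let mone1 : (-1 : R) = 1 \/ (-1 : R) = -1. Proof. by right. Qed.

Lemma outside_right z : b < z -> outside 1 z.
Proof. by move=> bz t /andP[_ tb]; rewrite !mul1r (le_lt_trans tb). Qed.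

Lemma outside_left z : z < a -> outside (-1) z.
Proof. by move=> za t /andP[ta _]; rewrite !mulN1r ltrN2 (lt_le_trans za). Qed.

Let T_ivt y z z' : z <= z' -> (forall x, z <= x <= z' -> 0 < gap x) ->
  T_transform mu z' <= y <= T_transform mu z ->
  exists2 x, z <= x <= z' & T_transform mu x = y.
Proof.
move=> zz' g /andP[y1 y2].
have [|||x xz xy] := @IVT _ (T_transform mu) z z' y; first by [].
- apply: continuous_in_subspaceT => x /set_mem /=; rewrite in_itv /= => xz.
  exact/T_transform_continuous/g.
- by rewrite ge_min y1 orbT le_max y2.
- by exists x => //; move: xz; rewrite in_itv.
Qed.

(** The T-transform decreases from its limit at [b] to [0] at infinity. *)
Lemma T_transform_onto_right y : 0 < y -> (y%:E < T_right mu b)%E ->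
  exists z, b < z /\ T_transform mu z = y.
Proof.
move=> y0 yT.
have Td z z' : b < z -> z <= z' -> T_transform mu z' <= T_transform mu z.
  move=> bz; rewrite le_eqVlt => /predU1P[->//|zz']; apply: ltW.
  exact: (T_transform_decr one1 (outside_right bz) (outside_right (lt_trans bz zz'))).
have /cvg_lim : (T_transform mu x)%:E @[x --> b^'+] -->
    ereal_sup [set (T_transform mu x)%:E | x in [set` `]b, +oo[ ]].
  apply: (@nonincreasing_at_right_cvge _ (fun x => (T_transform mu x)%:E) b (BInfty _ false)) => //.
  move=> z z'; rewrite !in_itv /= !andbT => bz bz' zz'; rewrite lee_fin.
  exact: Td.
move=> /(_ (@ereal_hausdorff _)) TE; move: yT; rewrite /T_right TE.
move=> /ereal_sup_gt[_ [z /= bz <-]]; rewrite lte_fin => yz.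
rewrite in_itv /= andbT in bz.
have b0 : 0 <= b := le_trans a0 ab.
pose z' := b + (b / y + 1).
have bz' : b < z' by rewrite ltrDl ltr_wpDl// divr_ge0// ltW.
have Tz' : T_transform mu z' < y.
  have g : 0 < gap z' by rewrite gap_gt0 bz' orbT.
  apply: le_lt_trans (ler_norm _) _; apply: le_lt_trans (T_transform_le g) _.
  rewrite ltr_pdivrMr//; apply: (@lt_le_trans _ _ (y * (b / y + 1))).
    by rewrite mulrDr mulrCA mulfV ?gt_eqF// !mulr1 ltrDl.
  rewrite ler_wpM2l ?(ltW y0)// /gap le_max; apply/orP; right.
  by rewrite /z' addrAC subrr add0r.
have zz' : z <= z'.
  by rewrite leNgt; apply/negP => /ltW /(Td _ _ bz') h; have := lt_le_trans yz (le_trans h (ltW Tz')); rewrite ltxx.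
have gx x : z <= x <= z' -> 0 < gap x.
  by move=> /andP[zx _]; rewrite gap_gt0 (lt_le_trans bz zx) orbT.
have yy : T_transform mu z' <= y <= T_transform mu z by rewrite !ltW.
have [x /andP[zx _] xy] := T_ivt zz' gx yy.
by exists x; split => //; exact: lt_le_trans zx.
Qed.

Lemma T_transform_onto_left y : y < 0 -> (T_left mu a < y%:E)%E ->
  exists z, z < a /\ T_transform mu z = y.
Proof.
move=> y0 yT.
have Td z z' : z' < a -> z <= z' -> T_transform mu z' <= T_transform mu z.
  move=> az; rewrite le_eqVlt => /predU1P[->//|zz']; apply: ltW.
  exact: (T_transform_decr mone1 (outside_left (lt_trans zz' az)) (outside_left az)).
have /cvg_lim : (T_transform mu x)%:E @[x --> a^'-] -->
    ereal_inf [set (T_transform mu (- x))%:E | x in [set` `](- a), +oo[ ]].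
  apply/cvg_at_leftNP.
  apply: (@nondecreasing_at_right_cvge _ (fun x => (T_transform mu (- x))%:E) (- a) (BInfty _ false)) => //.
  move=> z z'; rewrite !in_itv /= !andbT => bz bz' zz'; rewrite lee_fin.
  by apply: Td; rewrite ?lerN2// ltrNl.
move=> /(_ (@ereal_hausdorff _)) TE; move: yT; rewrite /T_left TE.
move=> /ereal_inf_lt[_ [x /= + <-]]; rewrite in_itv /= andbT ltrNl => za.
move: (- x) za => z za; rewrite lte_fin => yz.
have b0 : 0 <= b := le_trans a0 ab.
pose z' := a - (b / - y + 1).
have y0' : 0 < - y by rewrite oppr_gt0.
have za' : z' < a by rewrite gtrBl ltr_wpDl// divr_ge0// ltW.
have Tz' : y < T_transform mu z'.
  have g : 0 < gap z' by rewrite gap_gt0 za'.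
  rewrite -ltrN2; apply: le_lt_trans (ler_norm _) _; rewrite normrN.
  apply: le_lt_trans (T_transform_le g) _.
  rewrite ltr_pdivrMr//; apply: (@lt_le_trans _ _ (- y * (b / - y + 1))).
    by rewrite mulrDr mulrCA mulfV ?gt_eqF// !mulr1 ltrDl.
  rewrite ler_wpM2l ?(ltW y0')// /gap le_max; apply/orP; left.
  by rewrite /z' opprB addrCA subrr addr0.
have zz' : z' <= z.
  by rewrite leNgt; apply/negP => /ltW /(Td _ _ za') h; have := lt_le_trans Tz' (le_trans h (ltW yz)); rewrite ltxx.
have gx v : z' <= v <= z -> 0 < gap v.
  by move=> /andP[_ xz]; rewrite gap_gt0 (le_lt_trans xz za).
have yy : T_transform mu z <= y <= T_transform mu z' by rewrite !ltW.
have [u /andP[_ uz] uy] := T_ivt zz' gx yy.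
by exists u; split => //; exact: le_lt_trans za.
Qed.

End TTransform.

(** * Spectral means and compressed resolvents *)

Section SpectralMeans.
Variable R : realType.
Notation C := R[i].

Lemma evals_lambda_le n (M : 'M[C]_n) i : M \is hermsymmx -> evals M i <= lambda 1 M.
Proof.
move=> Mh; rewrite leNgt; apply/negP => h.
have n0 : (0 < n)%N by exact: leq_ltn_trans (ltn_ord i).
have := lambda_gt (lambda 1 M) (eigenvalues_herm Mh) n0; rewrite ltxx => /esym/negP; apply.
by apply/card_gt0P; exists i; rewrite inE.
Qed.

Lemma evals_lambda_ge n (M : 'M[C]_n) i : M \is hermsymmx -> lambda n M <= evals M i.
Proof.
case: n M i => [|n] M i Mh; first by case: i.
rewrite leNgt (lambda_gt _ (eigenvalues_herm Mh) (ltnSn n)) -leqNgt.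
apply: (@leq_trans #|predC1 i|); last by rewrite cardC1 card_ord.
apply: subset_leq_card; apply/fintype.subsetP => j; rewrite !inE.
by apply: contraTneq => ->; rewrite ltxx.
Qed.

Lemma sum_lambda n (M : 'M[C]_n) (f : R -> R) : M \is hermsymmx ->
  \sum_(k < n) f (lambda k.+1 M) = \sum_i f (evals M i).
Proof.
move=> Mh; pose s := sort >=%R [seq complex.Re z | z <- eigenvalues M].
have pe : perm_eq s [seq evals M i | i <- enum 'I_n].
  rewrite perm_sort (_ : [seq evals M i | i <- _] =
    [seq complex.Re z | z <- [seq (evals M i)%:C | i <- enum 'I_n]]); last first.
    by rewrite -map_comp.
  by apply: perm_map; exact: eigenvalues_herm.
have sn : size s = n by rewrite (perm_size pe) size_map size_enum_ord.
transitivity (\sum_(x <- s) f x).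
  by rewrite (big_nth 0) sn big_mkord.
by rewrite (perm_big _ pe) big_map big_enum.
Qed.

(** Nonnegativity lets the integral be computed term by term in the sum of Dirac
    masses; bounded functions reduce to it by adding a constant. *)
Lemma esd_integral n (M : 'M[C]_n) (f : R -> R) : M \is hermsymmx ->
  measurable_fun setT f -> (forall t, 0 <= f t) ->
  \int[esd M]_t f t = spectral_mean f M.
Proof.
move=> Mh mf f0; rewrite /Rintegral /esd.
have mf' : measurable_fun setT (fun t => (f t)%:E) by apply/measurable_EFinP.
have f0' t : setT t -> (0 <= (f t)%:E)%E by rewrite lee_fin.
rewrite ge0_integral_mscale// ge0_integral_measure_sum//.
under eq_bigr do rewrite integral_dirac// diracT mul1e.
by rewrite sumEFin -EFinM /= sum_lambda.
Qed.

Lemma spectral_mean_cvg (M : forall n, 'M[C]_n) (mu : probability R R) (f : R -> R) (K : R) :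
  (forall n, M n \is hermsymmx) -> weak_cvg (fun n => esd (M n)) mu ->
  continuous f -> (forall t, `|f t| <= K) ->
  spectral_mean f (M n) @[n --> \oo] --> \int[mu]_t f t.
Proof.
move=> Mh wc cf fK.
have mf := continuous_measurable_fun cf.
have bf : bounded_mfun f by split => //; exists K.
have g0 t : 0 <= f t + K by have := fK t; rewrite ler_norml => /andP[]; lra.
have cg : continuous (fun t => f t + K).
  by move=> t; apply: cvgD; [exact: cf | exact: cvg_cst].
have bg : bounded_fun (fun t => f t + K).
  exists (K + K); split; first exact: num_real.
  move=> y Ky t _; apply: le_trans (ltW Ky); apply: le_trans (ler_normD _ _) _.
  apply: lerD => //; apply: le_trans (ler_norm _) _.
  by rewrite normr_id ger0_norm// (le_trans _ (fK 0)).
have h := wc _ cg bg.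
have mg : measurable_fun setT (fun t => f t + K) by exact: continuous_measurable_fun.
rewrite (bexpD mu bf (bounded_mfun_cst _ K)) bexp_cst in h.
have h' : spectral_mean f (M n) + K @[n --> \oo] --> \int[mu]_t f t + K.
  apply: cvg_trans h; apply: near_eq_cvg; near=> n.
  have n0 : (0 < n)%N by near: n; exact: nbhs_infty_gt.
  rewrite esd_integral// /spectral_mean big_split /= sumr_const card_ord mulrDr.
  by rewrite -[K *+ n]mulr_natl mulKf// pnatr_eq0 -lt0n.
have h2 : spectral_mean f (M n) + K - K @[n --> \oo] --> \int[mu]_t f t + K - K.
  by apply: cvgB; [exact: h' | exact: cvg_cst].
rewrite addrK in h2; apply: cvg_trans h2; apply: near_eq_cvg.
by apply: nearW => n; rewrite addrK.
Unshelve. all: by end_near.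
Qed.

Lemma expr_lipschitz (B : R) k : 0 <= B -> exists2 L : R, 0 <= L &
  forall x y : R, `|x| <= B -> `|y| <= B -> `|x ^+ k - y ^+ k| <= L * `|x - y|.
Proof.
move=> B0; elim: k => [|k [L L0 IH]].
  by exists 0 => // x y _ _; rewrite !expr0 subrr normr0 mul0r.
exists (B * L + B ^+ k) => [|x y xB yB]; first by rewrite addr_ge0 ?mulr_ge0 ?exprn_ge0.
have -> : x ^+ k.+1 - y ^+ k.+1 = x * (x ^+ k - y ^+ k) + y ^+ k * (x - y).
  by rewrite !exprS; ring.
rewrite mulrDl; apply: le_trans (ler_normD _ _) _; rewrite !normrM normrX.
apply: lerD; last by rewrite ler_wpM2r// lerXn2r// nnegrE.
by rewrite -mulrA ler_pM// IH.
Qed.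

Lemma spectral_meanB n (f g : R -> R) (M : 'M[C]_n) (K : R) : (0 < n)%N ->
  (forall i, `|f (evals M i) - g (evals M i)| <= K) ->
  `|spectral_mean f M - spectral_mean g M| <= K.
Proof.
move=> n0 fg.
have -> : spectral_mean f M - spectral_mean g M = spectral_mean (fun t => f t - g t) M.
  by rewrite /spectral_mean -mulrBr sumrB.
exact: spectral_mean_le.
Qed.

Lemma compressionB_le n r (X : 'M[C]_n) (V : 'M[C]_(n, r)) (f g : R -> R) (K : R) :
  V^t* *m V = 1%:M -> (forall i, `|f (evals X i) - g (evals X i)| <= K) ->
  fro2 (compression X V f - compression X V g) <= r%:R * K ^+ 2.
Proof.
move=> VV fg.
have -> : compression X V f - compression X V g =
    V^t* *m (fcalc (fun t => (f t - g t)%:C) X *m V).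
  rewrite [RHS]mulmxA /compression -mulmxBl -mulmxBr fcalcB.
  apply: (congr1 (fun D => V^t* *m D *m V)); apply: eq_fcalc => i.
  by rewrite rmorphB.
apply: le_trans (isometry_adj_le _ VV) _; rewrite -(fro2_isometry VV) mulrC.
apply: fro2_fcalcl => i; rewrite /abs2 /= expr0n addr0 -(real_normK (num_real _)).
by rewrite lerXn2r// nnegrE ?(le_trans (normr_ge0 _) (fg i)).
Qed.

Lemma fro2_scalar r (x : R) : fro2 (x%:C%:M : 'M[C]_r) = r%:R * x ^+ 2.
Proof.
rewrite -scalemx1 fro2Z mulrC; apply: (congr1 (fun q => q * _)).
by apply: fro2_isometry; rewrite adj_scalar rmorph1 mulmx1.
Qed.

End SpectralMeans.

Section CompressionLimit.
Variable R : realType.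
Notation C := R[i].

Lemma gap_widen (c d eta z : R) : gap c d z - eta <= gap (c - eta) (d + eta) z.
Proof.
rewrite /gap; case: (leP (c - z) (z - d)) => h; rewrite le_max; apply/orP.
  by right; lra.
by left; lra.
Qed.

Lemma itv_norm_le (c d t : R) : c <= t <= d -> `|t| <= `|c| + `|d|.
Proof.
move=> tcd; have /andP[h1 h2] := tcd.
by rewrite -(clamp_id tcd); apply: clamp_norm; exact: le_trans h1 h2.
Qed.

(** Uniform on an interval away from [z], hence on the spectra of the
    matrices. *)
Lemma cutoff_tker (c d z : R) k : 0 < gap c d z -> exists2 D : R, 0 <= D &
  forall dl t, 0 < dl <= 1 -> c <= t <= d ->
  `|cutoff z dl t ^+ k - tker z k t| <= D * dl ^+ 2.
Proof.
move=> g; pose B := `|c| + `|d|.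
have B0 : 0 <= B by rewrite addr_ge0.
pose q := B / gap c d z ^+ 3.
have q0 : 0 <= q by rewrite divr_ge0// exprn_ge0// ltW.
pose B2 := B / gap c d z + q.
have B20 : 0 <= B2 by rewrite addr_ge0// divr_ge0// ltW.
have [L L0 hL] := expr_lipschitz k B20.
exists (L * q) => [|dl t /andP[dl0 dl1] tcd]; first exact: mulr_ge0.
have h : `|cutoff z dl t - t / (z - t)| <= q * dl ^+ 2.
  by rewrite mulrAC; apply: cutoff_sub => //; [exact: gap_le | exact: itv_norm_le].
have h1 : `|t / (z - t)| <= B / gap c d z.
  have /andP[t1 t2] := tcd.
  by have := tker_le (le_trans t1 t2) 1 g tcd; rewrite /tker !expr1.
have h2 : `|cutoff z dl t| <= B2.
  rewrite -[cutoff z dl t](subrK (t / (z - t))) addrC /B2.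
  apply: le_trans (ler_normD _ _) _; apply: lerD => //; apply: le_trans h _.
  by rewrite ler_piMr// exprn_ile1// ltW.
apply: le_trans (hL _ _ h2 _) _; first by apply: le_trans h1 _; rewrite lerDl.
by rewrite -mulrA ler_wpM2l.
Qed.

Let four_terms_le (e x1 x2 y1 y2 y3 : R) : 4 * (2 * y3) <= e / 2 ->
  x1 <= y3 -> x2 <= e / 16 -> y1 <= y3 -> y2 <= e / 16 ->
  2 * (2 * (x1 + x2) + 2 * (y1 + y2)) <= e.
Proof. lra. Qed.

Variables (mu : probability R R) (a b : R).
Hypothesis ab : a <= b.
Hypothesis mu_ab : mu.-negligible (~` `[a, b]%classic).
Variables (r : nat) (X : forall n, 'M[C]_n) (V : forall n, 'M[C]_(n, r)).
Hypothesis Xh : forall n, X n \is hermsymmx.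
Hypothesis wc : weak_cvg (fun n => esd (X n)) mu.
Hypothesis Xmin : lambda n (X n) @[n --> \oo] --> a.
Hypothesis Xmax : lambda 1 (X n) @[n --> \oo] --> b.
Hypothesis VV : forall n, (r <= n)%N -> (V n)^t* *m V n = 1%:M.

Lemma evals_near eta : 0 < eta ->
  \forall n \near \oo, forall i, a - eta <= evals (X n) i <= b + eta.
Proof.
move=> e0; near=> n => i; apply/andP; split.
  apply: le_trans (evals_lambda_ge i (Xh n)).
  by near: n; apply: (cvgr_ge a); [exact: Xmin | rewrite gtrBl].
apply: le_trans (evals_lambda_le i (Xh n)) _.
by near: n; apply: (cvgr_le b); [exact: Xmax | rewrite ltrDl].
Unshelve. all: by end_near.
Qed.

Lemma spectral_mean_tker_cvg z k : 0 < gap a b z ->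
  spectral_mean (tker z k) (X n) @[n --> \oo] --> T_moment mu z k.
Proof.
move=> g; pose eta := gap a b z / 2; have e0 : 0 < eta by rewrite divr_gt0.
pose c := a - eta; pose d := b + eta.
have g' : 0 < gap c d z.
  by apply: lt_le_trans (gap_widen a b eta z); rewrite /eta; move: g; lra.
have cd : c <= d by move: ab e0; rewrite /c /d; lra.
have mu_cd : mu.-negligible (~` `[c, d]%classic).
  apply: negligibleS mu_ab => t /=; apply: contra_not; rewrite !in_itv /= => /andP[h1 h2].
  by rewrite /c /d; move: h1 h2 e0 => h1 h2 e0; apply/andP; split; lra.
rewrite (T_moment_clamp mu_cd).
have h : spectral_mean (fun t => tker z k (clamp c d t)) (X n) @[n --> \oo] -->
    \int[mu]_t tker z k (clamp c d t).
  apply: (@spectral_mean_cvg _ _ _ _ (((`|c| + `|d|) / gap c d z) ^+ k)) => //.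
    exact: tker_clamp_continuous.
  by move=> t; exact/tker_le/clamp_itv.
apply: cvg_trans h; apply: near_eq_cvg; near=> n.
have ev : forall i, c <= evals (X n) i <= d by near: n; exact: evals_near.
by rewrite /spectral_mean; congr (_ * _); apply: eq_bigr => i _; rewrite clamp_id.
Unshelve. all: by end_near.
Qed.

(** The cutoff is removed: its error is uniform in [n], so first [n] tends to
    infinity at a fixed cutoff parameter, and then this parameter tends to [0].
    The scalar that the compression approaches is identified by weak
    convergence. *)
Lemma compression_tker_cvg z k : 0 < gap a b z ->
  (forall j, fro2 (compression (X n) (V n) (fun t => cutoff z (harmonic j) t ^+ k) -
       (spectral_mean (fun t => cutoff z (harmonic j) t ^+ k) (X n))%:C%:M)
     @[n --> \oo] --> (0 : R)) ->
  fro2 (compression (X n) (V n) (tker z k) - (T_moment mu z k)%:C%:M)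
    @[n --> \oo] --> (0 : R).
Proof.
move=> g hj; pose eta := gap a b z / 2; have e0 : 0 < eta by rewrite divr_gt0.
have g' : 0 < gap (a - eta) (b + eta) z.
  by apply: lt_le_trans (gap_widen a b eta z); rewrite /eta; move: g; lra.
have [D D0 hD] := cutoff_tker k g'.
apply/cvgr0Pnorm_le => e ep.
pose q := 8 * r%:R * D ^+ 2.
have q0 : 0 <= q by rewrite !mulr_ge0 ?exprn_ge0.
have [j hq] : exists j, harmonic j <= e / 2 / (q + 1) :> R.
  have : \forall j \near \oo, harmonic j <= e / 2 / (q + 1) :> R.
    by apply: (cvgr_le (0 : R)); [exact: cvg_harmonic | rewrite !divr_gt0// ltr_wpDl].
  by case=> j _ /(_ j (leqnn j)) h; exists j.
pose dl : R := harmonic j.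
have dl0 : 0 < dl by rewrite /dl /harmonic invr_gt0.
have dl1 : dl <= 1 by rewrite /dl /harmonic invf_le1// ler1n.
have qe : 4 * (2 * (r%:R * (D * dl ^+ 2) ^+ 2)) <= e / 2.
  have -> : 4 * (2 * (r%:R * (D * dl ^+ 2) ^+ 2)) = q * dl ^+ 4 by rewrite /q; ring.
  apply: (@le_trans _ _ ((q + 1) * dl)); last by rewrite mulrC -ler_pdivlMr ?ltr_wpDl.
  apply: ler_pM; rewrite ?exprn_ge0 ?(ltW dl0) ?lerDl//.
  by rewrite exprS ler_piMr ?(ltW dl0)// exprn_ile1// ltW.
have mc := @spectral_mean_tker_cvg z k g.
have mc2 : r%:R * (spectral_mean (tker z k) (X n) - T_moment mu z k) ^+ 2
    @[n --> \oo] --> (0 : R).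
  have h : spectral_mean (tker z k) (X n) - T_moment mu z k @[n --> \oo] --> (0 : R).
    by rewrite -(subrr (T_moment mu z k)); apply: cvgB; [exact: mc | exact: cvg_cst].
  have -> : 0 = r%:R * (0 * 0) :> R by rewrite !mulr0.
  by apply: cvgMr; under eq_fun do rewrite expr2; exact: cvgM.
near=> n.
have rn : (r <= n)%N by near: n; exact: nbhs_infty_ge.
have n0 : (0 < n)%N by near: n; exact: nbhs_infty_gt.
have ev : forall i, a - eta <= evals (X n) i <= b + eta by near: n; exact: evals_near.
have hi i : `|cutoff z dl (evals (X n) i) ^+ k - tker z k (evals (X n) i)| <= D * dl ^+ 2.
  by apply: hD => //; rewrite dl0.
have tB : fro2 (compression (X n) (V n) (fun t => cutoff z dl t ^+ k) -
    (spectral_mean (fun t => cutoff z dl t ^+ k) (X n))%:C%:M) <= e / 16.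
  by near: n; apply: (cvgr_le (0 : R)); [exact: hj | rewrite divr_gt0].
have tD : r%:R * (spectral_mean (tker z k) (X n) - T_moment mu z k) ^+ 2 <= e / 16.
  by near: n; apply: (cvgr_le (0 : R)); [exact: mc2 | rewrite divr_gt0].
rewrite ger0_norm ?fro2_ge0//.
pose Kt := compression (X n) (V n) (tker z k).
pose Kc := compression (X n) (V n) (fun t => cutoff z dl t ^+ k).
pose mt := spectral_mean (tker z k) (X n).
pose mm := spectral_mean (fun t => cutoff z dl t ^+ k) (X n).
rewrite -/Kc -/mm in tB; rewrite -/mt in tD.
have tA : fro2 (Kt - Kc) <= r%:R * (D * dl ^+ 2) ^+ 2.
  by apply: compressionB_le (VV rn) _ => i; rewrite distrC.
have tC : r%:R * (mm - mt) ^+ 2 <= r%:R * (D * dl ^+ 2) ^+ 2.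
  rewrite ler_wpM2l// -(real_normK (num_real (mm - mt))).
  have hm : `|mm - mt| <= D * dl ^+ 2.
    exact: (@spectral_meanB _ _ (fun t => cutoff z dl t ^+ k) _ _ _ n0 hi).
  by rewrite lerXn2r// nnegrE ?(le_trans (normr_ge0 _) hm).
have -> : Kt - (T_moment mu z k)%:C%:M = ((Kt - Kc) + (Kc - mm%:C%:M)) +
    ((mm - mt)%:C%:M + (mt - T_moment mu z k)%:C%:M).
  have -> : (mm - mt)%:C%:M + (mt - T_moment mu z k)%:C%:M =
      mm%:C%:M - (T_moment mu z k)%:C%:M :> 'M[C]_r.
    by rewrite -raddfD /= -rmorphD addrA subrK rmorphB raddfB.
  by rewrite !addrA !subrK.
apply: le_trans (fro2D_le _ _) _.
have h1 := fro2D_le (Kt - Kc) (Kc - mm%:C%:M).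
have h2 := fro2D_le ((mm - mt)%:C%:M : 'M[C]_r) ((mt - T_moment mu z k)%:C%:M).
rewrite !fro2_scalar in h2.
apply: le_trans (ler_wpM2l (ler0n _ 2) (lerD h1 h2)) _.
exact: four_terms_le qe tA tB tC tD.
Unshelve. all: by end_near.
Qed.

Lemma tker_lipschitz (c d z : R) k : 0 < gap c d z -> exists2 D : R, 0 <= D &
  forall z' t, gap c d z / 2 <= gap c d z' -> c <= t <= d ->
  `|tker z' k t - tker z k t| <= D * `|z' - z|.
Proof.
move=> g; pose B := `|c| + `|d|.
have B0 : 0 <= B by rewrite addr_ge0.
have g2 : 0 < gap c d z / 2 by rewrite divr_gt0.
pose B2 := B / (gap c d z / 2).
have B20 : 0 <= B2 by rewrite divr_ge0// ltW.
have [L L0 hL] := expr_lipschitz k B20.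
pose q := B / (gap c d z / 2 * gap c d z).
have q0 : 0 <= q by rewrite divr_ge0// mulr_ge0// ltW.
exists (L * q) => [|z' t g' tcd]; first exact: mulr_ge0.
have zt := gap_le z tcd; have z't := le_trans g' (gap_le z' tcd).
have b1 y : gap c d z / 2 <= `|y - t| -> `|t / (y - t)| <= B2.
  move=> h; rewrite normrM normfV ler_pM ?invr_ge0//; first exact: itv_norm_le.
  by rewrite lef_pV2 ?posrE// (lt_le_trans g2).
have z1 : z - t != 0 by rewrite -normr_gt0 (lt_le_trans g).
have z2 : z' - t != 0 by rewrite -normr_gt0 (lt_le_trans g2).
apply: le_trans (hL _ _ (b1 _ z't) (b1 _ _)) _.
  by apply: le_trans zt; rewrite ler_pdivrMr// ler_peMr ?ler1n// ltW.
rewrite -mulrA ler_wpM2l//.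
have -> : t / (z' - t) - t / (z - t) = t / ((z' - t) * (z - t)) * (z - z').
  by field; rewrite z1 z2.
rewrite normrM [`|z' - z|]distrC ler_wpM2r// normrM normfV normrM.
rewrite ler_pM ?invr_ge0 ?mulr_ge0//; first exact: itv_norm_le.
rewrite lef_pV2 ?posrE ?mulr_gt0 ?(lt_le_trans g zt) ?(lt_le_trans g2 z't)//.
by apply: ler_pM => //; exact: ltW.
Qed.

(** The spectral parameter may converge along with [n], because the integrand is
    uniformly Lipschitz in [z] on the spectra. *)
Lemma compression_tker_shift z k (l : nat -> R) : 0 < gap a b z ->
  l n @[n --> \oo] --> z ->
  fro2 (compression (X n) (V n) (tker z k) - (T_moment mu z k)%:C%:M)
    @[n --> \oo] --> (0 : R) ->
  fro2 (compression (X n) (V n) (tker (l n) k) - (T_moment mu z k)%:C%:M)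
    @[n --> \oo] --> (0 : R).
Proof.
move=> g lz h; pose eta := gap a b z / 2; have e0 : 0 < eta by rewrite divr_gt0.
have g' : 0 < gap (a - eta) (b + eta) z.
  by apply: lt_le_trans (gap_widen a b eta z); rewrite /eta; move: g; lra.
have [D D0 hD] := tker_lipschitz k g'.
have bnd : 2 * (r%:R * (D * `|l n - z|) ^+ 2 +
    fro2 (compression (X n) (V n) (tker z k) - (T_moment mu z k)%:C%:M))
    @[n --> \oo] --> (0 : R).
  have l0 : `|l n - z| @[n --> \oo] --> (0 : R).
    rewrite -(normr0 R) -(subrr z); apply: cvg_norm.
    by apply: cvgB; [exact: lz | exact: cvg_cst].
  have -> : 0 = 2 * (r%:R * ((D * 0) * (D * 0)) + 0) :> R by rewrite !mulr0 addr0 mulr0.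
  apply: cvgMr; apply: cvgD; last exact: h.
  by apply: cvgMr; under eq_fun do rewrite expr2; apply: cvgM; exact: cvgMr.
have /cvgrPdist_le lz' := lz.
apply: squeeze_cvgr (cvg_cst 0) bnd; near=> n; rewrite fro2_ge0 /=.
have rn : (r <= n)%N by near: n; exact: nbhs_infty_ge.
have ev : forall i, a - eta <= evals (X n) i <= b + eta by near: n; exact: evals_near.
have gl : gap (a - eta) (b + eta) z / 2 <= gap (a - eta) (b + eta) (l n).
  have hl : `|z - l n| <= gap (a - eta) (b + eta) z / 2.
    by near: n; apply: lz'; rewrite divr_gt0.
  apply: le_trans (gap_lip _ _ z (l n)).
  by rewrite lerBrDl -lerBrDr {1}(splitr (gap _ _ z)) addrK.
have tri (A B D' : 'M[C]_r) : fro2 (A - D') <= 2 * (fro2 (A - B) + fro2 (B - D')).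
  by have := fro2D_le (A - B) (B - D'); rewrite addrA subrK.
apply: le_trans (tri _ (compression (X n) (V n) (tker z k)) _) _.
rewrite ler_wpM2l// lerD2r.
by apply: compressionB_le (VV rn) _ => i; exact: hD.
Unshelve. all: by end_near.
Qed.

End CompressionLimit.

(** * Limits along a fixed sample *)

Section SampleLimits.
Variable R : realType.
Notation C := R[i].
Variables (mu : probability R R) (a b : R).
Hypothesis ab : a <= b.
Hypothesis a0 : 0 <= a.
Hypothesis mu_ab : mu.-negligible (~` `[a, b]%classic).
Hypothesis mu_neq0 : ~ (forall A : set R, measurable A -> mu A = \d_(0 : R) A).
Variables (r : nat) (th : 'I_r -> R) (i0 : 'I_r).
Hypothesis th_noninc : forall i j : 'I_r, (i <= j)%N -> th j <= th i.
Variables (sg rho : R).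
Hypothesis sg1 : sg = 1 \/ sg = -1.
Hypothesis th0 : 0 < sg * th i0.
Hypothesis orho : outside a b sg rho.
Hypothesis Trho : T_transform mu rho = (th i0)^-1.

Variables (X P : forall n, 'M[C]_n) (V : forall n, 'M[C]_(n, r)).
Hypothesis Xh : forall n, X n \is hermsymmx.
Hypothesis X0 : forall n i, 0 <= evals (X n) i.
Hypothesis wc : weak_cvg (fun n => esd (X n)) mu.
Hypothesis Xmin : lambda n (X n) @[n --> \oo] --> a.
Hypothesis Xmax : lambda 1 (X n) @[n --> \oo] --> b.
Hypothesis VV : forall n, (r <= n)%N -> (V n)^t* *m V n = 1%:M.
Hypothesis PE : forall n, (r <= n)%N -> P n = V n *m rdiag th *m (V n)^t*.

Let K z k n := fro2 (compression (X n) (V n) (tker z k) - (T_moment mu z k)%:C%:M).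
Hypothesis K_rho : forall k, K rho k n @[n --> \oo] --> (0 : R).
Hypothesis K_near : forall (s : R) m, s = 1 \/ s = -1 -> 0 < gap a b (rho + s * harmonic m) ->
  K (rho + s * harmonic m) 1 n @[n --> \oo] --> (0 : R).

Let l n := spiked_eigenvalue th i0 (X n *m (1%:M + P n)).

Let sg2 : sg * sg = 1. Proof. by case: sg1 => ->; rewrite ?mulrNN mulr1. Qed.

Let g_rho : 0 < gap a b rho. Proof. exact: outside_gap sg1 orho. Qed.

Let Trho1 : (sg * T_transform mu rho) * (sg * th i0) = 1.
Proof.
rewrite mulrACA sg2 mul1r Trho mulVf//.
by apply: contraTneq th0 => ->; rewrite mulr0 ltxx.
Qed.

Let half_lt (x y t : R) : x < y -> t <= x + (y - x) / 2 -> t < y.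
Proof. lra. Qed.

Let half_gt (x y t : R) : x < y -> y - (y - x) / 2 <= t -> x < t.
Proof. lra. Qed.

Let evals_outside z : outside a b sg z ->
  \forall n \near \oo, forall i, sg * evals (X n) i < sg * z.
Proof.
move=> oz; have aab : a <= a <= b by rewrite lexx.
have bab : a <= b <= b by rewrite lexx andbT.
case: sg1 oz => -> oz.
  have zb : b < z by have := oz b bab; rewrite !mul1r.
  have e0 : 0 < (z - b) / 2 by rewrite divr_gt0 ?subr_gt0.
  apply: filterS (evals_near Xh Xmin Xmax e0) => n ev i; rewrite !mul1r.
  by have /andP[_ h] := ev i; exact: half_lt zb h.
have za : z < a by have := oz a aab; rewrite !mulN1r ltrN2.
have e0 : 0 < (a - z) / 2 by rewrite divr_gt0 ?subr_gt0.
apply: filterS (evals_near Xh Xmin Xmax e0) => n ev i; rewrite !mulN1r ltrN2.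
by have /andP[h _] := ev i; exact: half_gt za h.
Qed.

(* [dl] moves [rho] towards the interval when positive. *)
Let shifted (dl : R) : R := rho - sg * dl.

Let outside_shift dl : dl < gap a b rho -> outside a b sg (shifted dl).
Proof.
move=> dg t tab; have := gap_le rho tab; have := orho tab.
rewrite /shifted mulrBr mulrA sg2 mul1r => h1 h2.
have e : `|rho - t| = sg * rho - sg * t.
  rewrite -mulrBr; case: sg1 h1 => ->.
    by rewrite !mul1r => h; rewrite gtr0_norm// subr_gt0.
  by rewrite !mulN1r ltrN2 => h; rewrite ltr0_norm// subr_lt0.
by move: h2 dg; rewrite e; move: (sg * rho) (sg * t) => p q h2 dg; rewrite ltrBrDr -ltrBrDl (lt_le_trans dg).
Qed.

Let sg_shifted dl : sg * shifted dl = sg * rho - dl.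
Proof. by rewrite mulrBr mulrA sg2 mul1r. Qed.

Let T_shift_in dl : 0 < dl -> dl < gap a b rho ->
  1 < (sg * T_transform mu (shifted dl)) * (sg * th i0).
Proof.
move=> d0 dg; rewrite -Trho1 ltr_pM2r//.
apply: (T_transform_sdecr ab mu_ab a0 mu_neq0 sg1 (outside_shift dg) orho).
by rewrite sg_shifted gtrBl.
Qed.

Let T_shift_out dl : dl < 0 -> (sg * T_transform mu (shifted dl)) * (sg * th i0) < 1.
Proof.
move=> d0; rewrite -Trho1 ltr_pM2r//.
have dg : dl < gap a b rho by exact: lt_trans d0 g_rho.
apply: (T_transform_sdecr ab mu_ab a0 mu_neq0 sg1 orho (outside_shift dg)).
by rewrite sg_shifted ltrBrDr gtrDl.
Qed.

Let K_shift (eps dl : R) m : dl = harmonic m \/ dl = - harmonic m ->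
  dl < gap a b rho -> 0 < eps ->
  \forall n \near \oo, fro2 (compression (X n) (V n) (tker (shifted dl) 1) -
    (T_transform mu (shifted dl))%:C%:M) <= eps ^+ 2.
Proof.
move=> dE dg eps0; have g := outside_gap ab sg1 (outside_shift dg).
have [s s1 sE] : exists2 s : R, s = 1 \/ s = -1 & shifted dl = rho + s * harmonic m.
  rewrite /shifted; case: dE => ->; case: sg1 => ->.
  - by exists (-1); [right | rewrite mul1r mulN1r].
  - by exists 1; [left | rewrite mulN1r opprK mul1r].
  - by exists 1; [left | rewrite !mul1r opprK].
  - by exists (-1); [right | rewrite mulrNN mulN1r mul1r].
rewrite sE T_transformE; apply: (cvgr_le (0 : R)); last by rewrite exprn_gt0.
by apply: K_near => //; rewrite -sE.
Qed.

Let Th := \sum_i `|th i|.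

Let thT i : `|th i| <= Th.
Proof. by rewrite /Th (bigD1 i)//= lerDl sumr_ge0. Qed.

Let Th0 : 0 <= Th. Proof. exact: sumr_ge0. Qed.

(* the precision at which the compressed resolvent must be known for a spike
   beyond [1 / T'] to be detected *)
Let tolerance (T' t : R) : 0 < T' -> 1 < T' * t ->
  exists2 eps, 0 < eps & 0 < T' ^+ 2 * t - 2 * T' * Th * eps - Th * eps ^+ 2 - T' - eps.
Proof.
move=> T0 Tt; pose g := T' * (T' * t - 1); pose c := 2 * T' * Th + Th + 1.
have g0 : 0 < g by rewrite mulr_gt0// subr_gt0.
have c0 : 0 < c by rewrite ltr_wpDl// addr_ge0// !mulr_ge0// ltW.
have cg : 0 < c + g by rewrite addr_gt0.
exists (g / (c + g)); first by rewrite divr_gt0.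
set eps := g / (c + g).
have eps0 : 0 < eps by rewrite divr_gt0.
have eps1 : eps <= 1 by rewrite ler_pdivrMr// mul1r lerDr ltW.
have epsc : eps * c < g.
  by rewrite mulrAC ltr_pdivrMr// ltr_pM2l// ltrDl.
have h : Th * eps ^+ 2 <= Th * eps.
  by rewrite ler_wpM2l// expr2 ler_piMr// ltW.
have -> : T' ^+ 2 * t - 2 * T' * Th * eps - Th * eps ^+ 2 - T' - eps =
    (g - eps * c) + (Th * eps - Th * eps ^+ 2) by rewrite /g /c; ring.
by rewrite ltr_wpDr ?subr_ge0// subr_gt0.
Qed.

Let spiked_lower m : harmonic m < gap a b rho ->
  \forall n \near \oo, sg * rho - harmonic m <= sg * l n.
Proof.
move=> mg; have h0 : 0 < harmonic m :> R by rewrite /harmonic invr_gt0.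
have os := outside_shift mg.
have T0 := T_transform_sign ab mu_ab a0 mu_neq0 sg1 os.
have Tt : 1 < sg * T_transform mu (shifted (harmonic m)) * (sg * th i0).
  exact: T_shift_in.
have [eps eps0 pos] := tolerance T0 Tt.
near=> n.
have rn : (r <= n)%N by near: n; exact: nbhs_infty_ge.
have ev : forall i, sg * evals (X n) i < sg * shifted (harmonic m).
  by near: n; exact: evals_outside.
have KT : fro2 (compression (X n) (V n) (tker (shifted (harmonic m)) 1) -
    (T_transform mu (shifted (harmonic m)))%:C%:M) <= eps ^+ 2.
  by near: n; apply: (@K_shift _ _ m) => //; left.
have := @spiked_eigenvalue_lower R n r (X n) (P n) (V n) th i0 rn (Xh n) (@X0 n) (PE rn)
  th_noninc sg _ _ eps sg1 ev T0 th0 (ltW eps0) KT Th Th0 thT pos.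
by rewrite sg_shifted.
Unshelve. all: by end_near.
Qed.

Let spiked_upper m : \forall n \near \oo, sg * l n <= sg * rho + harmonic m.
Proof.
have h0 : 0 < harmonic m :> R by rewrite /harmonic invr_gt0.
have d0 : - harmonic m < 0 :> R by rewrite oppr_lt0.
have mg := lt_trans d0 g_rho; have os := outside_shift mg.
have T0 := T_transform_sign ab mu_ab a0 mu_neq0 sg1 os.
have Tt := T_shift_out d0.
set T' := sg * T_transform mu (shifted (- harmonic m)) in T0 Tt.
pose eps := T' * (1 - T' * (sg * th i0)).
have eps0 : 0 < eps by rewrite mulr_gt0// subr_gt0.
have bnd : sg * th i0 + eps / T' ^+ 2 <= T'^-1.
  apply: le_refl_of_eq; rewrite /eps; move: (T') (sg * th i0) T0 => t u t0.
  by field; rewrite gt_eqF.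
near=> n.
have rn : (r <= n)%N by near: n; exact: nbhs_infty_ge.
have ev : forall i, sg * evals (X n) i < sg * shifted (- harmonic m).
  by near: n; exact: evals_outside.
have KT : fro2 (compression (X n) (V n) (tker (shifted (- harmonic m)) 1) -
    (T_transform mu (shifted (- harmonic m)))%:C%:M) <= eps ^+ 2.
  by near: n; apply: (@K_shift _ _ m) => //; right.
have := @spiked_eigenvalue_upper R n r (X n) (P n) (V n) th i0 rn (Xh n) (@X0 n) (PE rn)
  th_noninc sg _ _ eps sg1 ev T0 th0 (ltW eps0) KT bnd.
by rewrite sg_shifted opprK.
Unshelve. all: by end_near.
Qed.

Let dist_le (x y h : R) : x - h <= y -> y <= x + h -> `|x - y| <= h.
Proof. by move=> h1 h2; rewrite ler_norml; apply/andP; split; lra. Qed.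

(** The eigenvalue is trapped between [rho - 1 / m] and [rho + 1 / m]: the
    T-transform times the spike exceeds [1] on the side of [rho] that faces
    [[a, b]], and is less than [1] on the other side. *)
Lemma spiked_eigenvalue_cvg : l n @[n --> \oo] --> rho.
Proof.
apply/cvgrPdist_le => e e0.
have [m [mg me]] : exists m, harmonic m < gap a b rho /\ harmonic m <= e.
  have h1 : \forall m \near \oo, harmonic m < gap a b rho.
    by apply: (cvgr_lt (0 : R)); [exact: cvg_harmonic | exact: g_rho].
  have h2 : \forall m \near \oo, harmonic m <= e.
    by apply: (cvgr_le (0 : R)); [exact: cvg_harmonic | exact: e0].
  by case: (filterI h1 h2) => m _ /(_ m (leqnn m)) h; exists m.
apply: filterS2 (spiked_lower mg) (spiked_upper m) => n lo up.
apply: le_trans me.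
have -> : `|rho - l n| = `|sg * rho - sg * l n|.
  by rewrite -mulrBr normrM; case: sg1 => ->; rewrite ?normrN normr1 mul1r.
exact: dist_le lo up.
Qed.

Variable u : forall n, 'cV[C]_n.
Hypothesis u1 : forall n, (r <= n)%N -> fro2 (u n) = 1.
Hypothesis eigu : forall n, (r <= n)%N ->
  X n *m (1%:M + P n) *m u n = (l n)%:C *: u n.

Let evals_neq : \forall n \near \oo, forall i, evals (X n) i != l n.
Proof.
have [m mg] : exists m, harmonic m < gap a b rho.
  have : \forall m \near \oo, harmonic m < gap a b rho.
    by apply: (cvgr_lt (0 : R)); [exact: cvg_harmonic | exact: g_rho].
  by case=> m _ /(_ m (leqnn m)) h; exists m.
apply: filterS2 (spiked_lower mg) (evals_outside (outside_shift mg)) => n lo ev i.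
apply/eqP => e; have := lt_le_trans (ev i) (le_trans _ lo).
by rewrite sg_shifted lexx e ltxx => /(_ isT).
Qed.

Let K_eig k : fro2 (compression (X n) (V n) (tker (l n) k) -
    (T_moment mu rho k)%:C%:M) @[n --> \oo] --> (0 : R).
Proof.
exact: (compression_tker_shift Xh Xmin Xmax VV g_rho spiked_eigenvalue_cvg (@K_rho k)).
Qed.

Let w n := (V n)^t* *m u n.
Let S1 n := \sum_(i | th i == th i0) abs2 (w n i 0).
Let S2 n := \sum_(i | th i != th i0) abs2 (w n i 0).

Let Tth : T_transform mu rho * th i0 = 1.
Proof. by rewrite Trho mulVf//; apply: contraTneq th0 => ->; rewrite mulr0 ltxx. Qed.

Let gap_spikes : exists2 dl : R, 0 < dl &
  forall i, th i != th i0 -> dl <= (1 - T_transform mu rho * th i) ^+ 2.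
Proof.
exists (\big[Num.min/1]_(i | th i != th i0) (1 - T_transform mu rho * th i) ^+ 2).
  apply/bigmin_gtP; split => // i ti; rewrite exprn_even_gt0//= subr_eq0 eq_sym.
  apply: contra ti => /eqP h; apply/eqP.
  have T0 : T_transform mu rho != 0.
    by apply: contra_eq_neq Tth => ->; rewrite mul0r eq_sym oner_eq0.
  by apply: (mulfI T0); rewrite h Tth.
by move=> i ti; apply: bigmin_le_cond.
Qed.

Lemma other_spikes_cvg0 : S2 n @[n --> \oo] --> (0 : R).
Proof.
have [dl dl0 hdl] := gap_spikes.
have bnd : dl^-1 * (Th ^+ 2 * fro2 (compression (X n) (V n) (tker (l n) 1) -
    (T_moment mu rho 1)%:C%:M)) @[n --> \oo] --> (0 : R).
  have -> : 0 = dl^-1 * (Th ^+ 2 * 0) :> R by rewrite !mulr0.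
  by apply: cvgMr; apply: cvgMr; exact: K_eig.
apply: squeeze_cvgr (cvg_cst 0) bnd; near=> n.
have rn : (r <= n)%N by near: n; exact: nbhs_infty_ge.
have ev : forall i, evals (X n) i != l n by near: n; exact: evals_neq.
rewrite sumr_ge0 /=; last by move=> i _; exact: abs2_ge0.
rewrite [leRHS]mulrC ler_pdivlMr// [leLHS]mulrC -T_transformE.
exact: (eigenvector_other_spikes (Xh n) (VV rn) (PE rn) (u1 rn) (eigu rn) ev thT hdl).
Unshelve. all: by end_near.
Qed.

Lemma spike_mass_cvg : S1 n @[n --> \oo] -->
  (T_moment mu rho 2 * th i0 ^+ 2)^-1.
Proof.
set tau := T_moment mu rho 2.
have t0 : th i0 != 0 by apply: contraTneq th0 => ->; rewrite mulr0 ltxx.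
have q0 : 0 < tau * th i0 ^+ 2.
  rewrite mulr_gt0 ?exprn_even_gt0//.
  exact: (T_moment2_gt0 ab mu_ab mu_neq0 g_rho).
have bnd : Th ^+ 2 * Num.sqrt (fro2 (compression (X n) (V n) (tker (l n) 2) - tau%:C%:M))
    + `|tau| * (Th ^+ 2 * S2 n) @[n --> \oo] --> (0 : R).
  have -> : 0 = Th ^+ 2 * 0 + `|tau| * (Th ^+ 2 * 0) :> R by rewrite !mulr0 addr0.
  apply: cvgD; last by apply: cvgMr; apply: cvgMr; exact: other_spikes_cvg0.
  apply: cvgMr; rewrite -[X in _ --> X]sqrtr0.
  exact: (continuous_cvg _ (@sqrt_continuous R 0) (@K_eig 2)).
have h : 1 - tau * th i0 ^+ 2 * S1 n @[n --> \oo] --> (0 : R).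
  apply/norm_cvg0P; apply: squeeze_cvgr (cvg_cst 0) bnd; near=> n.
  have rn : (r <= n)%N by near: n; exact: nbhs_infty_ge.
  have ev : forall i, evals (X n) i != l n by near: n; exact: evals_neq.
  rewrite normr_ge0 /=.
  exact: (eigenvector_spike (Xh n) (VV rn) (PE rn) (u1 rn) (eigu rn) ev i0 tau thT).
have lim : (tau * th i0 ^+ 2)^-1 * (1 - (1 - tau * th i0 ^+ 2 * S1 n)) @[n --> \oo] -->
    (tau * th i0 ^+ 2)^-1 * (1 - 0).
  by apply: cvgMr; apply: cvgB; [exact: cvg_cst | exact: h].
rewrite subr0 mulr1 in lim; apply: cvg_trans lim; apply: near_eq_cvg.
by apply: nearW => n; rewrite subKr mulKf// gt_eqF.
Unshelve. all: by end_near.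
Qed.

End SampleLimits.

(** * Limits of the spiked eigenvalue and of its eigenvector *)

Section Preliminaries.
Variable R : realType.
Notation C := R[i].

Lemma ae_nonempty d (T : measurableType d) (Pr : probability T R) (Q : T -> Prop) :
  {ae Pr, forall w, Q w} -> exists w, Q w.
Proof.
move=> h; apply: contrapT => /forallNP nQ.
have : Pr.-negligible [set: T] by apply: negligibleS h => w _ /=; exact: nQ.
move=> /negligibleP => /(_ measurableT) h0.
have /eqP := etrans (esym h0) (probability_setT Pr).
by rewrite eq_sym onee_eq0.
Qed.

(** Test the form on the eigenvectors. *)
Lemma nonneg_def_evals n (M : 'M[C]_n) i : nonneg_def M -> 0 <= evals M i.
Proof.
move=> [Mh pos]; pose U := spectralmx M.
pose v : 'cV[C]_n := U^t* *m delta_mx i 0.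
have := pos v.
have -> : v^t* *m M *m v = (delta_mx i 0 : 'cV[C]_n)^t* *m
    diag_mx (\row_j (evals M j)%:C) *m (delta_mx i 0 : 'cV[C]_n).
  rewrite -{1}(fcalc_id Mh) /fcalc /v adjM trmxCK -/U !mulmxA.
  rewrite -(mulmxA _ U (U^t*)) spectralKV mulmx1 -(mulmxA _ U (U^t*)) spectralKV mulmx1.
  by [].
rewrite -mulmxA mul_diag_mx mxE (bigD1 i)//= big1 ?addr0; last first.
  by move=> j ji; rewrite !mxE (negPf ji) /= rmorph0 mul0r.
by rewrite !mxE !eqxx /= rmorph1 mul1r mulr1 lecR.
Qed.

Lemma vnorm_eq1 n (x : 'cV[C]_n) : vnorm x = 1 -> fro2 x = 1.
Proof.
rewrite vnorm_fro2 => h.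
by rewrite -(sqr_sqrtr (fro2_ge0 x)) h expr1n.
Qed.

End Preliminaries.

Theorem theorem2p7 (R : realType) (d : measure_display)
  (Omega : measurableType d) (Pr : probability Omega R)
  (c : symmetry_class)
  (X P : forall n : nat, Omega -> 'M[R[i]]_n)
  (mu : probability R R) (a b : R)
  (r s : nat) (theta : 'I_r -> R)
  (hX_rand : forall n, random_mx (X n))
  (hX_sym : forall n w, selfadjoint_mx c (X n w))
  (hX_pos : forall n w, nonneg_def (X n w))
  (hmu_supp : compact (supp mu))
  (hmu_neq0 : ~ (forall A : set R, measurable A -> mu A = \d_(0 : R) A))
  (hmu_cvg : {ae Pr, forall w, weak_cvg (fun n => esd (X n w)) mu})
  (ha : a = inf (supp mu)) (hb : b = sup (supp mu))
  (hX_min : {ae Pr, forall w, lambda n (X n w) @[n --> \oo] --> a})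
  (hX_max : {ae Pr, forall w, lambda 1 (X n w) @[n --> \oo] --> b})
  (hr : (1 <= r)%N)
  (htheta_noninc : forall i j : 'I_r, (i <= j)%N -> theta j <= theta i)
  (hs : (s <= r)%N)
  (htheta_pos : forall i : 'I_r, (i < s)%N -> 0 < theta i)
  (htheta_neg : forall i : 'I_r, (s <= i)%N -> theta i < 0)
  (hP_rand : forall n, (r <= n)%N -> random_mx (P n))
  (hP_sym : forall n w, (r <= n)%N -> selfadjoint_mx c (P n w))
  (hP_rank : forall n w, (r <= n)%N -> \rank (P n w) = r)
  (hP_eig : forall n w, (r <= n)%N ->
     perm_eq [seq z <- eigenvalues (P n w) | z != 0]
             [seq (theta i)%:C | i <- enum 'I_r])
  (hindep : forall n, (r <= n)%N -> independent_mx Pr (X n) (P n))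
  (hinv : forall n, (r <= n)%N ->
     conj_invariant Pr c (X n) \/ conj_invariant Pr c (P n))
  (i0 : 'I_r)
  (htheta_i0 : (T_left mu a < ((theta i0)^-1)%:E < T_right mu b)%E)
  (u : forall n : nat, Omega -> 'cV[R[i]]_n)
  (hu : forall n w, (r <= n)%N ->
     let M := X n w *m (1%:M + P n w) in
     unit_eigenvector c M (spiked_eigenvalue theta i0 M) (u n w)) :
  let rho := T_inv mu (theta i0)^-1 in
  [/\ {ae Pr, forall w,
        spiked_eigenvalue theta i0 (X n w *m (1%:M + P n w))
          @[n --> \oo] --> rho},
      {ae Pr, forall w,
        `| proj_norm (u n w) (cker ((theta i0)%:C%:M - P n w)) | ^+ 2
          @[n --> \oo] -->
        -1 / (theta i0 ^+ 2 * rho * derive1 (T_transform mu) rho + theta i0)} &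
      {ae Pr, forall w,
        proj_norm (u n w)
          (\sum_(t <- undup [seq theta i | i <- enum 'I_r] | t != theta i0)
             cker (t%:C%:M - P n w))%MS
          @[n --> \oo] --> 0}].

Proof.
have [[x0 sx0] supp_ab] := supp_itv hmu_supp; rewrite -ha -hb in supp_ab.
have ab : a <= b.
  by have := supp_ab _ sx0; rewrite /= in_itv /= => /andP[]; exact: le_trans.
have mu_ab : mu.-negligible (~` `[a, b]%classic).
  by apply: negligibleS (supp_negligible mu); exact: subsetC.
have Xh n w : X n w \is hermsymmx by case: (hX_pos n w).
have X0 n w i : 0 <= evals (X n w) i by exact: nonneg_def_evals.
have a0 : 0 <= a.
  have [w hw] := ae_nonempty hX_min; rewrite leNgt; apply/negP => a_lt0.
  have : \forall n \near \oo, lambda n (X n w) < 0 by exact: (cvgr_lt a).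
  case=> N _ /(_ N.+1 (leqnSn N)) /=.
  have [i ->] := lambda_nth (eigenvalues_herm (Xh N.+1 w)) (ltnSn N).
  by rewrite ltNge X0.
have th_neq0 i : theta i != 0.
  have [si|is_] := leqP s i; first by rewrite lt_eqF// htheta_neg.
  by rewrite gt_eqF// htheta_pos.
set rho := T_inv mu (theta i0)^-1.
have [sg [sg1 th0 orho Trho]] : exists sg : R, [/\ sg = 1 \/ sg = -1, 0 < sg * theta i0,
    outside a b sg rho & T_transform mu rho = (theta i0)^-1].
  have /andP[Ta Tb] := htheta_i0; rewrite /rho /T_inv invr_gt0.
  have [tp|tn] := ltP 0 (theta i0).
    have : exists z, sup (supp mu) < z /\ T_transform mu z = (theta i0)^-1.
      rewrite -hb; apply: (T_transform_onto_right ab mu_ab a0 hmu_neq0) Tb.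
      by rewrite invr_gt0.
    move=> /(xgetPex 0) /= []; rewrite -hb => bz Tz.
    by exists 1; split; [left | rewrite mul1r | exact: outside_right | ].
  have {}tn : theta i0 < 0 by rewrite lt_neqAle th_neq0.
  have : exists z, z < inf (supp mu) /\ T_transform mu z = (theta i0)^-1.
    rewrite -ha; apply: (T_transform_onto_left ab mu_ab a0 hmu_neq0) Ta.
    by rewrite invr_lt0.
  move=> /(xgetPex 0) /= []; rewrite -ha => za Tz.
  by exists (-1); split; [right | rewrite mulN1r oppr_gt0 | exact: outside_left | ].
have Ph n w : (r <= n)%N -> P n w \is hermsymmx.
  by move=> rn; have /andP[] := @hP_sym n w rn.
have frame n w : exists V : 'M[R[i]]_(n, r), (r <= n)%N ->
    V^t* *m V = 1%:M /\ P n w = V *m rdiag theta *m V^t*.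
  have [rn|nr] := leqP r n; last by exists 0.
  by have [V hV] := frame_exists hr (Ph n w rn) th_neq0 (@hP_eig n w rn); exists V.
pose V n w := projT1 (cid (frame n w)).
have VV n w : (r <= n)%N -> (V n w)^t* *m V n w = 1%:M.
  by move=> rn; have [] := projT2 (cid (frame n w)) rn.
have PE n w : (r <= n)%N -> P n w = V n w *m rdiag theta *m (V n w)^t*.
  by move=> rn; have [] := projT2 (cid (frame n w)) rn.
have Kz z k : 0 < gap a b z -> {ae Pr, forall w,
    fro2 (compression (X n w) (V n w) (tker z k) - (T_moment mu z k)%:C%:M)
      @[n --> \oo] --> (0 : R)}.
  move=> g.
  have hc : {ae Pr, forall w, forall j,
      fro2 (compression (X n w) (V n w) (fun t => cutoff z (harmonic j) t ^+ k) -
        (spectral_mean (fun t => cutoff z (harmonic j) t ^+ k) (X n w))%:C%:M)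
      @[n --> \oo] --> (0 : R)}.
    apply: ae_foralln => j.
    apply: (@cutoff_compression_cvg R d Omega Pr c X P r theta V hr th_neq0 hX_rand
      Xh hP_rand VV PE hindep hinv z (harmonic j) k).
    by rewrite /harmonic invr_gt0.
  apply: filterS3 (filterI hmu_cvg hc) hX_min hX_max => w [wc hj] mi ma.
  exact: (compression_tker_cvg ab mu_ab (fun n => Xh n w) wc mi ma (fun n => VV n w) g hj).
have g_rho : 0 < gap a b rho := outside_gap ab sg1 orho.
have K_rho : {ae Pr, forall w, forall k,
    fro2 (compression (X n w) (V n w) (tker rho k) - (T_moment mu rho k)%:C%:M)
      @[n --> \oo] --> (0 : R)}.
  by apply: ae_foralln => k; exact: Kz.
have K_side (q : R) : {ae Pr, forall w, forall m, 0 < gap a b (rho + q * harmonic m) ->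
    fro2 (compression (X n w) (V n w) (tker (rho + q * harmonic m) 1) -
      (T_moment mu (rho + q * harmonic m) 1)%:C%:M) @[n --> \oo] --> (0 : R)}.
  apply: ae_foralln => m.
  have [g|g] := boolP (0 < gap a b (rho + q * harmonic m)).
    by apply: filterS (Kz _ 1 g) => w h _.
  by apply: aeW => w.
have u1 n w : (r <= n)%N -> fro2 (u n w) = 1.
  by move=> rn; have [_ /vnorm_eq1] := @hu n w rn.
have eigu n w : (r <= n)%N -> X n w *m (1%:M + P n w) *m u n w =
    (spiked_eigenvalue theta i0 (X n w *m (1%:M + P n w)))%:C *: u n w.
  by move=> rn; have [] := @hu n w rn.
have good : {ae Pr, forall w,
    [/\ weak_cvg (fun n => esd (X n w)) mu,
     lambda n (X n w) @[n --> \oo] --> a & lambda 1 (X n w) @[n --> \oo] --> b] /\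
    ((forall k, fro2 (compression (X n w) (V n w) (tker rho k) - (T_moment mu rho k)%:C%:M)
      @[n --> \oo] --> (0 : R)) /\
    (forall (q : R) m, q = 1 \/ q = -1 -> 0 < gap a b (rho + q * harmonic m) ->
      fro2 (compression (X n w) (V n w) (tker (rho + q * harmonic m) 1) -
      (T_moment mu (rho + q * harmonic m) 1)%:C%:M) @[n --> \oo] --> (0 : R)))}.
  apply: filterS3 (filterI hmu_cvg K_rho) (filterI hX_min hX_max)
    (filterI (K_side 1) (K_side (-1))) => w [wc kr] [mi ma] [k1 k2].
  by split; [split | split => // q m [->|->] g; [exact: k1 | exact: k2]].
have lim_l w := fun h => @spiked_eigenvalue_cvg _ _ _ _ ab a0 mu_ab hmu_neq0 _ _ _
  htheta_noninc _ _ sg1 th0 orho Trho (X ^~ w) (P ^~ w) (V ^~ w) (Xh ^~ w) (X0 ^~ w) h.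
have lim_2 w := fun h => @other_spikes_cvg0 _ _ _ _ ab a0 mu_ab hmu_neq0 _ _ _
  htheta_noninc _ _ sg1 th0 orho Trho (X ^~ w) (P ^~ w) (V ^~ w) (Xh ^~ w) (X0 ^~ w) h.
have lim_1 w := fun h => @spike_mass_cvg _ _ _ _ ab a0 mu_ab hmu_neq0 _ _ _
  htheta_noninc _ _ sg1 th0 orho Trho (X ^~ w) (P ^~ w) (V ^~ w) (Xh ^~ w) (X0 ^~ w) h.
split; apply: filterS good => w [[wc mi ma] [kr ks]].
- exact: (lim_l w mi ma (fun n => PE n w) ks).
- have h := lim_1 w mi ma (fun n => VV n w) (fun n => PE n w) kr ks (u ^~ w)
    (fun n => u1 n w) (fun n => eigu n w).
  have -> : -1 / (theta i0 ^+ 2 * rho * derive1 (T_transform mu) rho + theta i0) =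
      (T_moment mu rho 2 * theta i0 ^+ 2)^-1.
    rewrite (T_moment2_derive ab mu_ab g_rho) Trho mulN1r -invrN; apply: (congr1 GRing.inv).
    by move: (derive1 _ _) (th_neq0 i0) => D t0; field.
  apply: cvg_trans h; apply: near_eq_cvg; near=> n.
  have rn : (r <= n)%N by near: n; exact: nbhs_infty_ge.
  have /= -> := frame_proj_norm (VV n w rn) (u n w) (cker_frame (VV n w rn) (PE n w rn) (th_neq0 i0)).
  rewrite ger0_norm ?sqrtr_ge0// sqr_sqrtr// sumr_ge0// => i _; exact: abs2_ge0.
- have h := lim_2 w mi ma (fun n => VV n w) (fun n => PE n w) kr ks (u ^~ w)
    (fun n => u1 n w) (fun n => eigu n w).
  have h' : Num.sqrt (\sum_(i | theta i != theta i0) abs2 (((V n w)^t* *m u n w) i 0))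
      @[n --> \oo] --> (0 : R).
    rewrite -[X in _ --> X]sqrtr0.
    exact: (continuous_cvg _ (@sqrt_continuous R 0) h).
  apply: cvg_trans h'; apply: near_eq_cvg; near=> n.
  have rn : (r <= n)%N by near: n; exact: nbhs_infty_ge.
  rewrite (frame_proj_norm (VV n w rn) (u n w) (sum_cker_frame (VV n w rn) (PE n w rn) _ _ _ _)) //.
  + exact: undup_uniq.
  + by move=> t; rewrite mem_undup => /mapP[i _ ->].
  + by move=> i; rewrite mem_undup map_f ?mem_enum.
Unshelve. all: by end_near.
Qed.
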